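(* Let $\mathbf T=(T_1,\dots,T_k)\in B(\mathcal H)^{n_1}\times\cdots\times B(\mathcal H)^{n_k}$ and let $J$ be a $w^*$-closed left ideal of $F^\infty(\mathbf D^{\mathbf m}_{\mathbf f})$. Then $\mathbf T$ is a pure element of the noncommutative variety $\mathcal V^{\mathbf m}_{\mathbf f,J}(\mathcal H)$ if and only if there is a unital completely positive and $w^*$-continuous linear map $$\Psi:\overline{\mathrm{span}}^{\,w^*}\{\mathbf S_{(\alpha)}\mathbf S_{(\beta)}^*:\ (\alpha),(\beta)\in\mathbb F^+_{n_1}\times\cdots\times\mathbb F^+_{n_k}\}\to B(\mathcal H)$$ such that $$\Psi(\mathbf S_{(\alpha)}\mathbf S_{(\beta)}^* )=\mathbf T_{(\alpha)}\mathbf T_{(\beta)}^*,\qquad (\alpha),(\beta)\in\mathbb F^+_{n_1}\times\cdots\times\mathbb F^+_{n_k}.$$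
   Context: Fix $k\ge 1$ and $(n_1,\dots,n_k)$, $\mathbf m=(m_1,\dots,m_k)$ in $\mathbb N^k$, $\mathbb N=\{1,2,\dots\}$. Hilbert spaces are complex and separable. $\mathbb F^+_{n_i}$ is the free unital semigroup on generators $g^i_1,\dots,g^i_{n_i}$ with identity $g^i_0$; $|\alpha|$ is word length. For $X_i=(X_{i,1},\dots,X_{i,n_i})$ and $\alpha=g^i_{j_1}\cdots g^i_{j_p}$ put $X_{i,\alpha}=X_{i,j_1}\cdots X_{i,j_p}$, $X_{i,g^i_0}=I$; for $\mathbf X=(X_1,\dots,X_k)$ and $(\alpha)=(\alpha_1,\dots,\alpha_k)$ put $\mathbf X_{(\alpha)}=X_{1,\alpha_1}\cdots X_{k,\alpha_k}$. $\mathbf f=(f_1,\dots,f_k)$, where each $f_i=\sum_{\alpha\in\mathbb F^+_{n_i}}a_{i,\alpha}Z_{i,\alpha}$ is a positive regular free holomorphic function: $a_{i,\alpha}\ge0$, $a_{i,g^i_0}=0$, $a_{i,g^i_j}>0$ for $1\le j\le n_i$, and $\limsup_{p\to\infty}(\sum_{|\alpha|=p}|a_{i,\alpha}|^2)^{1/2p}<\infty$. Put $\Phi_{f_i,X_i}(Y)=\sum_{|\alpha|\ge1}a_{i,\alpha}X_{i,\alpha}YX_{i,\alpha}^*$ (weak operator convergence) and, for $\mathbf p\in\mathbb Z_+^k$, $\Delta^{\mathbf p}_{\mathbf f,\mathbf X}=(id-\Phi_{f_1,X_1})^{p_1}\circ\cdots\circ(id-\Phi_{f_k,X_k})^{p_k}$.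 The noncommutative polydomain $\mathbf D^{\mathbf m}_{\mathbf f}(\mathcal H)$ is the set of all $\mathbf X\in B(\mathcal H)^{n_1}\times\cdots\times B(\mathcal H)^{n_k}$ such that the entries of $X_s$ commute with those of $X_t$ for $s\ne t$ and $\Delta^{\mathbf p}_{\mathbf f,\mathbf X}(I)\ge0$ for all $\mathbf 0\le\mathbf p\le\mathbf m$ (componentwise). $\mathbf X\in\mathbf D^{\mathbf m}_{\mathbf f}(\mathcal H)$ is pure if $\lim_{\mathbf q\in\mathbb Z_+^k}(id-\Phi_{f_k,X_k}^{q_k})\cdots(id-\Phi_{f_1,X_1}^{q_1})(I)=I$ (weak operator topology). Universal model: $F^2(H_{n_i})=\mathbb C1\oplus\bigoplus_{p\ge1}H_{n_i}^{\otimes p}$ is the full Fock space over an $n_i$-dimensional Hilbert space, with orthonormal basis $\{e^i_\alpha\}_{\alpha\in\mathbb F^+_{n_i}}$, $e^i_{g^i_0}=1$. Set $b^{(m_i)}_{i,g^i_0}=1$ and $b^{(m_i)}_{i,\alpha}=\sum_{p=1}^{|\alpha|}\sum_{\gamma_1\cdots\gamma_p=\alpha,\,|\gamma_s|\ge1}a_{i,\gamma_1}\cdots a_{i,\gamma_p}\binom{p+m_i-1}{m_i-1}$ for $|\alpha|\ge1$; $W_{i,j}e^i_\alpha=\sqrt{b^{(m_i)}_{i,\alpha}/b^{(m_i)}_{i,g^i_j\alpha}}\;e^i_{g^i_j\alpha}$; and $\mathbf W_{i,j}=I\otimes\cdots\otimes W_{i,j}\otimes\cdots\otimes I$ ($i$-th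 factor) on $\otimes_{i=1}^kF^2(H_{n_i})$. $F^\infty(\mathbf D^{\mathbf m}_{\mathbf f})$ is the sequential SOT- (equivalently WOT-, $w^*$-) closure of the polynomials in the $\mathbf W_{i,j}$ and $I$. Each $g\in F^\infty(\mathbf D^{\mathbf m}_{\mathbf f})$ has a unique Fourier representation $g=\sum_{(\beta)}c_{(\beta)}\mathbf W_{(\beta)}$, and for pure $\mathbf X\in\mathbf D^{\mathbf m}_{\mathbf f}(\mathcal H)$ the functional calculus is $g(\mathbf X)=\text{SOT-}\lim_{r\to1}\sum_{q\ge0}\sum_{|\beta_1|+\cdots+|\beta_k|=q}r^qc_{(\beta)}\mathbf X_{(\beta)}$. For a left ideal $J$: $\mathcal M_J$ is the closure of $J(\otimes_iF^2(H_{n_i}))$, $\mathcal N_J=[\otimes_iF^2(H_{n_i})]\ominus\mathcal M_J$, always assumed $\ne\{0\}$; $\mathcal N_J$ is invariant under each $\mathbf W_{i,j}^*$, and $\mathbf S_{i,j}=P_{\mathcal N_J}\mathbf W_{i,j}|_{\mathcal N_J}$. A pure element of $\mathcal V^{\mathbf m}_{\mathbf f,J}(\mathcal H)$ is a pure $\mathbf T\in\mathbf D^{\mathbf m}_{\mathbf f}(\mathcal H)$ with $g(\mathbf T)=0$ for all $g\in J$. *)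

(* Defs.v *)
From HB Require Import structures.
From mathcomp Require Import all_boot all_order all_algebra.
From mathcomp Require Import sesquilinear complex.
From mathcomp Require Import all_classical all_reals all_analysis.

Set Implicit Arguments.
Unset Strict Implicit.
Unset Printing Implicit Defensive.

Import Order.TTheory GRing.Theory Num.Theory.
Import numFieldNormedType.Exports.

Local Open Scope classical_set_scope.
Local Open Scope ring_scope.
Local Open Scope complex_scope.

(* The inner product is linear in its first argument; the norm of a normed
   module over R[i] takes its (real nonnegative) values in R[i]. *)
HB.mixin Record NormedModule_isHilbert (R : realType) H
    & CompleteNormedModule R[i] H := {
  hdot : {dot H for @Num.conj R[i]};
  hdot_norm : forall x : H, `|x| ^+ 2 = hdot x x
}.

#[short(type="hilbertType")]
HB.structure Definition Hilbert (R : realType) :=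
  { H of NormedModule_isHilbert R H & CompleteNormedModule R[i] H }.

Notation "''[' x , y ]" := (hdot x y) : ring_scope.

Section BoundedOperators.
Variable R : realType.
Implicit Types U V : hilbertType R.

Definition bounded_linear U V : {pred U -> V} := fun A =>
  `[< (forall (c : R[i]) x y, A (c *: x + y) = c *: A x + A y) /\
      exists2 M : R[i], 0 <= M & forall x, `|A x| <= M * `|x| >].

Lemma bounded_linear_submod_closed U V :
  subsemimod_closed (@bounded_linear U V).
Proof.
split; first split.
- apply/asboolP; split => [c x y|].
    by rewrite -[LHS]/0 -[X in _ = _ *: X + _]/0 scaler0 add0r.
  by exists 0 => // x; rewrite mul0r -[X in `|X|]/0 normr0.
- move=> A B /asboolP[lA [M M0 hM]] /asboolP[lB [N N0 hN]].
  apply/asboolP; split.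
    move=> c x y; rewrite -![(A + B) _]/(A _ + B _) lA lB scalerDr.
    by rewrite addrACA.
  exists (M + N) => [|x]; first exact: addr_ge0.
  rewrite -[(A + B) _]/(A _ + B _) mulrDl.
  by rewrite (le_trans (ler_normD _ _))// lerD.
- move=> c A /asboolP[lA [M M0 hM]]; apply/asboolP; split.
    move=> d x y; rewrite -![(c *: A) _]/(c *: A _) lA scalerDr !scalerA.
    by rewrite mulrC.
  exists (`|c| * M) => [|x]; first exact: mulr_ge0.
  by rewrite -[(c *: A) _]/(c *: A _) normrZ -mulrA ler_wpM2l.
Qed.

HB.instance Definition _ U V := GRing.isSubmodClosed.Build R[i] (U -> V)
  (@bounded_linear U V) (@bounded_linear_submod_closed U V).

Record bop U V := Bop {
  bop_fun :> U -> V;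
  bopP : bop_fun \in @bounded_linear U V
}.

HB.instance Definition _ U V := [isSub for @bop_fun U V].
HB.instance Definition _ U V := [Choice of bop U V by <:].
HB.instance Definition _ U V := [SubChoice_isSubLmodule of bop U V by <:].

Lemma bop_linear U V (A : bop U V) : linear A.
Proof. by have /asboolP[] := bopP A. Qed.

HB.instance Definition _ U V (A : bop U V) :=
  GRing.isLinear.Build R[i] U V *:%R A (bop_linear A).

Lemma bop_id_subproof U : (fun x : U => x) \in @bounded_linear U U.
Proof.
by apply/asboolP; split => //; exists 1 => // x; rewrite mul1r.
Qed.

Definition bop_id U : bop U U := Bop (bop_id_subproof U).

Lemma bop_comp_subproof U V W (A : bop V W) (B : bop U V) :
  (fun x => A (B x)) \in @bounded_linear U W.
Proof.
have /asboolP[lA [M M0 hM]] := bopP A.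
have /asboolP[lB [N N0 hN]] := bopP B.
apply/asboolP; split => [c x y|]; first by rewrite lB lA.
exists (M * N) => [|x]; first exact: mulr_ge0.
by rewrite (le_trans (hM _))// -mulrA ler_wpM2l.
Qed.

Definition bop_comp U V W (A : bop V W) (B : bop U V) : bop U W :=
  Bop (bop_comp_subproof A B).

(* The adjoint exists and is unique by the Riesz representation theorem, so
   the default value 0 is never used. *)
Definition adj U V (A : bop U V) : bop V U :=
  xget (0 : bop V U) [set B | forall x y, '[A x, y] = '[x, B y]].

Definition psd U (A : bop U U) := forall x, 0 <= '[A x, x].

Definition psd_mx U d (A : 'I_d -> 'I_d -> bop U U) :=
  forall x : 'I_d -> U, 0 <= \sum_i \sum_j '[A i j (x j), x i].

Definition wot_cvg U V (T : Type) (F : set_system T) (A : T -> bop U V)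
    (L : bop U V) :=
  forall x y, ('[A t x, y] : R[i]^o) @[t --> F] --> ('[L x, y] : R[i]^o).

(* The w*-topology of B(U, V) is induced by its predual, the trace class
   operators: the w*-continuous functionals are the
   A |-> \sum_n <A xi_n, eta_n> with xi and eta square summable. *)
Definition square_summable U (xi : nat -> U) :=
  cvgn (series (fun n => `|xi n| ^+ 2 : R[i]^o)).

Definition wstar_eval U V (A : bop U V) :
    {ptws {p : (nat -> U) * (nat -> V) |
             square_summable p.1 /\ square_summable p.2} -> R[i]^o} :=
  fun p => limn (series (fun n => '[A ((sval p).1 n), (sval p).2 n] : R[i]^o)).

Definition wstar U V := initial_topology (@wstar_eval U V).

Definition is_subspace (V : lmodType R[i]) (A : set V) :=
  A 0 /\ forall c x y, A x -> A y -> A (c *: x + y).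

Definition lin_span (V : lmodType R[i]) (A : set V) : set V :=
  smallest (@is_subspace V) A.

Definition separable U := exists2 D : set U, countable D & dense D.

Definition orthonormal_basis (I : eqType) U (e : I -> U) :=
  (forall i j, '[e i, e j] = (i == j)%:R) /\
  closure (lin_span (range e)) = setT.

(* K, with t : (x_i)_i |-> x_1 (x) ... (x) x_k, is the Hilbert space tensor
   product of the F_i. *)
Definition hilbert_tensor k (F : 'I_k -> hilbertType R) (K : hilbertType R)
    (t : (forall i, F i) -> K) :=
  [/\ forall (x : forall i, F i) i c (u v : F i),
        t (dfwith x i (c *: u + v)) =
        c *: t (dfwith x i u) + t (dfwith x i v),
      forall x y, '[t x, t y] = \prod_i '[x i, y i] &
      closure (lin_span (range t)) = setT].

End BoundedOperators.

Arguments bop {R} U V.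
Arguments bop_id {R} U.
Arguments wstar {R} U V.
Arguments separable {R} U.
Infix "\*b" := bop_comp (at level 40, left associativity) : ring_scope.

(* A word of the free semigroup on d generators is a [seq 'I_d], the identity
   being [::]; a tuple (alpha) is a function i |-> alpha_i. *)
Notation mword n := (forall i, seq 'I_(n i)).

Unset Implicit Arguments.

Section Polydomain.
Context {R : realType}.

Definition positive_regular {d} (f : seq 'I_d -> R) :=
  [/\ forall w, 0 <= f w, f [::] = 0, forall j, 0 < f [:: j] &
      (limn_esup (fun p : nat =>
         ((\sum_(w : p.-tuple 'I_d) `|f w| ^+ 2) `^ (2 * p)%N%:R^-1)%:E)
       < +oo)%E].

(* Indexed by the factorizations alpha = gamma_1 ... gamma_p into nonempty
   words. *)
Definition weight {d} (f : seq 'I_d -> R) (m : nat) (alpha : seq 'I_d) : R :=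
  if alpha is [::] then 1 else
  \sum_(1 <= p < (size alpha).+1)
    \sum_(g \in [set g : seq (seq 'I_d) |
                  [/\ size g = p, [::] \notin g & flatten g = alpha]])
      (\prod_(w <- g) f w) * 'C(p + m - 1, m - 1)%:R.

Context {k : nat} {n : 'I_k -> nat}.
Variable f : forall i, seq 'I_(n i) -> R.
Variable m : 'I_k -> nat.

Definition word_op {H : hilbertType R} {d} (X : 'I_d -> bop H H)
    (w : seq 'I_d) : bop H H :=
  foldr (fun j A => X j \*b A) (bop_id H) w.

Definition mword_op {H : hilbertType R} (X : forall i, 'I_(n i) -> bop H H)
    (b : mword n) : bop H H :=
  foldr (fun i A => word_op (X i) (b i) \*b A) (bop_id H) (enum 'I_k).

Section OneOperatorTuple.
Context {H : hilbertType R}.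
Variable X : forall i, 'I_(n i) -> bop H H.

Definition Phi_sum i (Y : bop H H) (N : nat) : bop H H :=
  \sum_(1 <= p < N.+1) \sum_(w : p.-tuple 'I_(n i))
    (f i w)%:C *: (word_op (X i) w \*b Y \*b adj (word_op (X i) w)).

Definition Phi_defined i :=
  forall Y, exists Z, wot_cvg \oo (Phi_sum i Y) Z.

Definition Phi i (Y : bop H H) : bop H H :=
  xget (0 : bop H H) [set Z | wot_cvg \oo (Phi_sum i Y) Z].

Definition Delta (p : 'I_k -> nat) (Y : bop H H) : bop H H :=
  foldr (fun i => iter (p i) (fun Z => Z - Phi i Z)) Y (enum 'I_k).

Definition polydomain :=
  [/\ forall s t j l, s != t -> X s j \*b X t l = X t l \*b X s j,
      forall i, Phi_defined i &
      forall p, (forall i, (p i <= m i)%N) -> psd (Delta p (bop_id H))].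

(* The limit is along Z_+^k directed by the componentwise order. *)
Definition pure :=
  wot_cvg
    (filter_from setT (fun q0 => [set q : 'I_k -> nat |
                                   forall i, (q0 i <= q i)%N]))
    (fun q => foldl (fun Z i => Z - iter (q i) (Phi i) Z) (bop_id H)
                    (enum 'I_k))
    (bop_id H).

(* \sum_(|beta_1| + ... + |beta_k| = q) c_beta X_beta x; a word beta_i of such
   a beta has length at most q. *)
Definition hom_part (c : mword n -> R[i]) (q : nat) (x : H) : H :=
  \sum_(b : {dffun forall i, q.-bseq 'I_(n i)} | (\sum_i size (b i))%N == q)
    c (fun i => b i) *: mword_op X (fun i => b i) x.

Definition func_calculus (c : mword n -> R[i]) (G : bop H H) :=
  forall x : H,
    (forall r : R, 0 < r < 1 ->
       cvgn (series (fun q => (r ^+ q)%:C *: hom_part c q x))) /\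
    limn (series (fun q => (r ^+ q)%:C *: hom_part c q x)) @[r --> 1^'-]
      --> G x.

End OneOperatorTuple.

Section UniversalModel.
Context {F : 'I_k -> hilbertType R} {K : hilbertType R}.
Variables (e : forall i, seq 'I_(n i) -> F i) (t : (forall i, F i) -> K).
Variable W : forall i, 'I_(n i) -> bop K K.

Definition weighted_shifts (w : forall i, 'I_(n i) -> bop (F i) (F i)) :=
  forall i j alpha, w i j (e i alpha) =
    (Num.sqrt (weight (f i) (m i) alpha /
               weight (f i) (m i) (j :: alpha)))%:C *: e i (j :: alpha).

(* W_(i,j) = I (x) ... (x) w_(i,j) (x) ... (x) I *)
Definition ampliation (w : forall i, 'I_(n i) -> bop (F i) (F i)) :=
  forall i j (x : forall i, F i), W i j (t x) = t (dfwith x i (w i j (x i))).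

(* As W_(s,j) and W_(t,l) commute for s != t, the monomials W_(beta) span the
   polynomials. *)
Definition model_polynomial : set (bop K K) := lin_span (range (mword_op W)).

Definition Finfty : set (bop K K) := [set g |
  exists2 p : nat -> bop K K, forall q, model_polynomial (p q) &
    forall x, p q x @[q --> \oo] --> g x].

(* g = \sum_beta c_beta W_beta, in the sense that both sides agree on the
   orthonormal basis vectors e_(alpha). *)
Definition fourier_rep (g : bop K K) (c : mword n -> R[i]) :=
  forall alpha : mword n,
    series (fun q => hom_part W c q (t (fun i => e i (alpha i)))) @ \oo
      --> g (t (fun i => e i (alpha i))).

Definition wstar_closed_left_ideal (J : set (bop K K)) :=
  [/\ is_subspace J, J `<=` Finfty,
      forall g h, Finfty g -> J h -> J (g \*b h) &
      closed (J : set (wstar K K))].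

Definition MJ (J : set (bop K K)) : set K :=
  closure (lin_span [set y | exists2 g, J g & exists x, y = g x]).

Definition NJ (J : set (bop K K)) : set K :=
  [set y | forall x, MJ J x -> '[x, y] = 0].

Definition pure_variety (J : set (bop K K)) {H : hilbertType R}
    (T : forall i, 'I_(n i) -> bop H H) :=
  [/\ polydomain T, pure T &
      forall g, J g ->
        exists2 c, fourier_rep g c & func_calculus T c 0].

End UniversalModel.

(* For iota : N -> K the inclusion of a closed subspace, adj iota is the
   orthogonal projection with codomain restricted to N. *)
Definition compression {N K : hilbertType R} (iota : bop N K)
    (W : forall i, 'I_(n i) -> bop K K) i (j : 'I_(n i)) : bop N N :=
  adj iota \*b W i j \*b iota.

Definition op_space {N : hilbertType R}
    (S : forall i, 'I_(n i) -> bop N N) : set (wstar N N) :=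
  closure (lin_span [set A | exists alpha beta,
    A = mword_op S alpha \*b adj (mword_op S beta)] : set (wstar N N)).

End Polydomain.

Section MapsOnOperatorSpaces.
Context {R : realType} {N H : hilbertType R}.
Variables (E : set (bop N N)) (Psi : bop N N -> bop H H).

Definition linear_on :=
  forall (c : R[i]) A B, E A -> E B -> Psi (c *: A + B) = c *: Psi A + Psi B.

Definition unital := Psi (bop_id N) = bop_id H.

Definition completely_positive :=
  forall d (A : 'I_d -> 'I_d -> bop N N), (forall i j, E (A i j)) ->
    psd_mx A -> psd_mx (fun i j => Psi (A i j)).

Definition wstar_continuous :=
  {within (E : set (wstar N N)), continuous (Psi : wstar N N -> wstar H H)}.

End MapsOnOperatorSpaces.

(* Main.v *)
Require Import Defs.
From mathcomp Require Import all_boot all_order all_algebra.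
From mathcomp Require Import sesquilinear complex.
From mathcomp Require Import all_classical all_reals all_analysis.
From mathcomp Require Import ring lra zify.

(** The two sides of the equivalence are linked by the Berezin kernel of a pure element T of
    the polydomain. The defect operator Delta^m(I) is positive and H is separable, so it is a
    sum of rank one operators x |-> <x, eta_p> eta_p (psd_rank_one_decomposition). The vectors
    V_p x of the model space with the coefficients sqrt (b_alpha) <x, T_alpha eta_p> satisfy
    sum_p |V_p x|^2 = |x|^2, because the weights b are the coefficients of the power series
    (1 - f)^(-m) and purity allows to invert (1 - Phi)^m by that series (pure_resolution).
    They intertwine the adjoints, W_alpha^* V_p = V_p T_alpha^* (berezin_kernels). Hence
    A |-> sum_p V_p^* A V_p (compress_ampl) is unital, completely positive and w*-continuous
    and maps W_alpha W_beta^* to T_alpha T_beta^*.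

    If moreover g(T) = 0 for g in J, then the ranges of the V_p lie in N_J (kernel_NJ): the
    Fourier series of g at a basis vector is mapped by V_p^* to a series whose Abel limit is
    0. As N_J is invariant under the W^*, the same formula with V_p corestricted to N_J
    defines Psi (pure_variety_map).

    Conversely let Psi be given, and let Theta A = Psi (iota^* A iota), where iota is the
    inclusion of N_J. Since Theta maps W_alpha W_alpha^* to T_alpha T_alpha^*, the product of
    the images of the factors, the operators W_alpha^* lie in the multiplicative domain of
    Theta, so that the entries of T inherit the commutation relations of those of W
    (mword_op_cat_T, T_commute). By w*-continuity Theta
    carries Phi for W to Phi for T (covariant_Phi), hence the operators Delta^p(I) and the
    products of the purity condition for W to those for T. The universal model itself is a
    pure element of the polydomain, because all operators in question are diagonal in the
    basis with eigenvalues computed from the weights (W_polydomain, W_pure); so T is one too.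

    It remains to see that g(T) = 0 for g in J. Let Lambda be the map A |-> sum_p V_p^* A V_p
    of T. An operator g in the Hardy algebra is the strong limit of its Abel means g_r, which
    are bounded by the norm of g and are norm limits of polynomials (abel_bound, abel_sum_cvg,
    abel_cvg). Therefore Lambda g = Theta g, and Theta g = 0 as the range of g is orthogonal
    to N_J; and the Abel means of the series of g(T) at x are (Lambda g_r) x, which tend to
    (Lambda g) x (func_calculus_zero). *)

Set Implicit Arguments.
Unset Strict Implicit.
Unset Printing Implicit Defensive.

Import Order.TTheory GRing.Theory Num.Theory.
Import numFieldNormedType.Exports.

Local Open Scope classical_set_scope.
Local Open Scope ring_scope.
Local Open Scope complex_scope.

Local Notation Re := complex.Re.
Local Notation Im := complex.Im.

(** * Complex numbers and Hilbert spaces *)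

Section ComplexNumbers.
Variable R : realType.
Implicit Types (z : R[i]) (r : R).

(** Modulus, inner product and norm are replaced by real-valued versions, cabs, rip
    and nm, since the values of the originals in R[i] are only partially ordered. *)
Definition cabs z : R := Re `|z|.

Lemma normC_cabs z : `|z| = (cabs z)%:C.
Proof. by rewrite /cabs normc_def. Qed.

Lemma conjE z : Num.conj z = conjc z.
Proof. by []. Qed.

Lemma cRe_conj z : Re (Num.conj z) = Re z.
Proof. by rewrite conjE; case: z. Qed.

Lemma cIm_conj z : Im (Num.conj z) = - Im z.
Proof. by rewrite conjE; case: z. Qed.

Lemma cReD z1 z2 : Re (z1 + z2) = Re z1 + Re z2.
Proof. by move: z1 z2 => [a b] [c d]. Qed.
Lemma cImD z1 z2 : Im (z1 + z2) = Im z1 + Im z2.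
Proof. by move: z1 z2 => [a b] [c d]. Qed.
Lemma cReN z : Re (- z) = - Re z.
Proof. by case: z. Qed.
Lemma cImN z : Im (- z) = - Im z.
Proof. by case: z. Qed.
Lemma cReB z1 z2 : Re (z1 - z2) = Re z1 - Re z2.
Proof. by rewrite cReD cReN. Qed.
Lemma cImB z1 z2 : Im (z1 - z2) = Im z1 - Im z2.
Proof. by rewrite cImD cImN. Qed.
Lemma cReM z1 z2 : Re (z1 * z2) = Re z1 * Re z2 - Im z1 * Im z2.
Proof. by move: z1 z2 => [a b] [c d]. Qed.
Lemma cImM z1 z2 : Im (z1 * z2) = Re z1 * Im z2 + Im z1 * Re z2.
Proof. by move: z1 z2 => [a b] [c d]. Qed.
Lemma Re_sum I (s : seq I) (P : pred I) (F : I -> R[i]) :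
  Re (\sum_(i <- s | P i) F i) = \sum_(i <- s | P i) Re (F i).
Proof. by apply: (big_ind2 (fun z r => Re z = r)) => // z1 r1 z2 r2 <- <-; rewrite cReD. Qed.
Lemma Im_sum I (s : seq I) (P : pred I) (F : I -> R[i]) :
  Im (\sum_(i <- s | P i) F i) = \sum_(i <- s | P i) Im (F i).
Proof. by apply: (big_ind2 (fun z r => Im z = r)) => // z1 r1 z2 r2 <- <-; rewrite cImD. Qed.

Lemma complex_eq z1 z2 : Re z1 = Re z2 -> Im z1 = Im z2 -> z1 = z2.
Proof. by move: z1 z2 => [a b] [c d] /= -> ->. Qed.

Lemma cabs_ge0 z : 0 <= cabs z.
Proof. by rewrite -lecR -normC_cabs; exact: normr_ge0. Qed.

Lemma cabsM z1 z2 : cabs (z1 * z2) = cabs z1 * cabs z2.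
Proof. by apply: complexI; rewrite rmorphM /= -!normC_cabs normrM. Qed.

Lemma ler_cabsD z1 z2 : cabs (z1 + z2) <= cabs z1 + cabs z2.
Proof. by rewrite -lecR rmorphD /= -!normC_cabs ler_normD. Qed.

Lemma cabs_sqr z : cabs z ^+ 2 = Re z ^+ 2 + Im z ^+ 2.
Proof. by apply: complexI; rewrite add_Re2_Im2 rmorphXn /= normC_cabs. Qed.

Lemma Re_le_cabs z : `|Re z| <= cabs z.
Proof. by rewrite -lecR -normC_cabs normc_ge_Re. Qed.

Lemma Im_le_cabs z : `|Im z| <= cabs z.
Proof.
rewrite -(ler_pXn2r (_ : 0 < 2)%N) ?nnegrE ?normr_ge0 ?cabs_ge0//.
by rewrite cabs_sqr real_normK ?num_real// lerDr sqr_ge0.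
Qed.

Lemma cabs_le_ReIm z : cabs z <= `|Re z| + `|Im z|.
Proof.
rewrite -(ler_pXn2r (_ : 0 < 2)%N) ?nnegrE ?addr_ge0 ?normr_ge0 ?cabs_ge0//.
rewrite cabs_sqr sqrrD !real_normK ?num_real//.
by rewrite lerD2r lerDl mulrn_wge0// mulr_ge0.
Qed.

Lemma cabs_real r : cabs r%:C = `|r|.
Proof. by rewrite /cabs normc_def/= expr0n/= addr0 sqrtr_sqr. Qed.

Lemma complex_ge0 z : (0 <= z) = (Im z == 0) && (0 <= Re z).
Proof. by rewrite lecE. Qed.

Section Cvg.
Context {T : Type} (F : set_system T) {FF : Filter F}.

Lemma cvgr_eps (f : T -> R) l :
  f @ F --> l <-> forall e : R, 0 < e -> \forall t \near F, `|l - f t| < e.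
Proof. exact: cvgrPdist_lt. Qed.

Lemma cvgc_eps (f : T -> R[i]^o) (l : R[i]) :
  f @ F --> (l : R[i]^o) <->
  forall e : R, 0 < e -> \forall t \near F, cabs (l - f t) < e.
Proof.
rewrite cvgrPdist_lt; split=> H e e0.
  have := H e%:C; rewrite ltcR => /(_ e0); apply: filterS => t.
  by rewrite (normC_cabs (l - f t)) ltcR.
have e_real : e = (Re e)%:C.
  by move: e0; rewrite ltcE => /andP[/eqP Ie _]; apply: complex_eq; rewrite ?Ie.
have := H (Re e); rewrite -ltcR -e_real => /(_ e0); apply: filterS => t.
by rewrite (normC_cabs (l - f t)) -ltcR -e_real.
Qed.

Lemma cvgcP (f : T -> R[i]^o) (l : R[i]) :
  f @ F --> (l : R[i]^o) <->
  (fun t => Re (f t)) @ F --> Re l /\ (fun t => Im (f t)) @ F --> Im l.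
Proof.
rewrite cvgc_eps !cvgr_eps; split=> [H|[H1 H2] e e0].
  split=> e /H; apply: filterS => t; apply: le_lt_trans.
    by rewrite -cReB Re_le_cabs.
  by rewrite -cImB Im_le_cabs.
have e20 : 0 < e / 2 by rewrite divr_gt0.
apply: filterS2 (H1 _ e20) (H2 _ e20) => t h1 h2.
rewrite (le_lt_trans (cabs_le_ReIm _))// cReB cImB.
by rewrite (splitr e) ltrD.
Qed.

End Cvg.
End ComplexNumbers.

Section Hilbert.
Variable (R : realType).
Implicit Types H U V : hilbertType R.

Definition rip H (x y : H) : R := Re '[x, y].
Definition nm H (x : H) : R := Re `|x|.

Lemma normE H (x : H) : `|x| = (nm x)%:C.
Proof.
apply: complex_eq => //=; apply: ger0_Im; exact: normr_ge0.
Qed.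

Lemma hdotC H (x y : H) : '[x, y] = Num.conj '[y, x].
Proof. by rewrite hermC expr0 mul1r. Qed.

Lemma hdotDl H (x y z : H) : '[x + y, z] = '[x, z] + '[y, z].
Proof. by rewrite linearDl. Qed.
Lemma hdotDr H (x y z : H) : '[z, x + y] = '[z, x] + '[z, y].
Proof. by rewrite linearDr. Qed.
Lemma hdotZl H c (x y : H) : '[c *: x, y] = c * '[x, y].
Proof. by rewrite linearZl_LR. Qed.
Lemma hdotZr H c (x y : H) : '[x, c *: y] = Num.conj c * '[x, y].
Proof. by rewrite linearZr_LR. Qed.
Lemma hdotNl H (x y : H) : '[- x, y] = - '[x, y].
Proof. by rewrite linearNl. Qed.
Lemma hdotNr H (x y : H) : '[x, - y] = - '[x, y].
Proof. by rewrite linearNr. Qed.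
Lemma hdotBl H (x y z : H) : '[x - y, z] = '[x, z] - '[y, z].
Proof. by rewrite hdotDl hdotNl. Qed.
Lemma hdot0l H (x : H) : '[0, x] = 0.
Proof. by rewrite linear0l. Qed.
Lemma hdot0r H (x : H) : '[x, 0] = 0.
Proof. by rewrite linear0r. Qed.
Lemma hdot_suml H I (s : seq I) (P : pred I) (f : I -> H) y :
  '[\sum_(i <- s | P i) f i, y] = \sum_(i <- s | P i) '[f i, y].
Proof. by rewrite linear_sumlz. Qed.

Lemma ripC H (x y : H) : rip x y = rip y x.
Proof. by rewrite /rip hdotC cRe_conj. Qed.
Lemma ripDl H (x y z : H) : rip (x + y) z = rip x z + rip y z.
Proof. by rewrite /rip hdotDl cReD. Qed.
Lemma ripDr H (x y z : H) : rip z (x + y) = rip z x + rip z y.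
Proof. by rewrite /rip hdotDr cReD. Qed.
Lemma ripNl H (x y : H) : rip (- x) y = - rip x y.
Proof. by rewrite /rip hdotNl cReN. Qed.
Lemma ripNr H (x y : H) : rip x (- y) = - rip x y.
Proof. by rewrite /rip hdotNr cReN. Qed.
Lemma ripBl H (x y z : H) : rip (x - y) z = rip x z - rip y z.
Proof. by rewrite ripDl ripNl. Qed.
Lemma ripBr H (x y z : H) : rip z (x - y) = rip z x - rip z y.
Proof. by rewrite ripDr ripNr. Qed.
Lemma rip0l H (x : H) : rip 0 x = 0.
Proof. by rewrite /rip hdot0l. Qed.
Lemma rip0r H (x : H) : rip x 0 = 0.
Proof. by rewrite /rip hdot0r. Qed.
Lemma ripZl H (r : R) (x y : H) : rip (r%:C *: x) y = r * rip x y.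
Proof. by rewrite /rip hdotZl cReM/= mul0r subr0. Qed.
Lemma ripZr H (r : R) (x y : H) : rip x (r%:C *: y) = r * rip x y.
Proof. by rewrite ripC ripZl ripC. Qed.
Lemma rip_suml H I (s : seq I) (P : pred I) (f : I -> H) y :
  rip (\sum_(i <- s | P i) f i) y = \sum_(i <- s | P i) rip (f i) y.
Proof. by rewrite /rip hdot_suml Re_sum. Qed.

(** The imaginary part of an inner product is the real part of another one,
    so that identities between sesquilinear forms may be checked on real parts. *)
Lemma Im_hdot H (x y : H) : Im '[x, y] = rip x ('i *: y).
Proof. by rewrite /rip hdotZr cReM cRe_conj cIm_conj /= mul0r sub0r mulN1r opprK. Qed.

Lemma nm_ge0 H (x : H) : 0 <= nm x.
Proof. by rewrite -lecR -normE; exact: normr_ge0. Qed.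

Lemma hdotxx H (x : H) : '[x, x] = (nm x ^+ 2)%:C.
Proof. by rewrite -hdot_norm normE rmorphXn. Qed.

Lemma ripxx H (x : H) : rip x x = nm x ^+ 2.
Proof. by rewrite /rip hdotxx. Qed.

Lemma nmN H (x : H) : nm (- x) = nm x.
Proof. by rewrite /nm normrN. Qed.

Lemma nm_sub H (x y : H) : nm (x - y) = nm (y - x).
Proof. by rewrite -nmN opprB. Qed.

Lemma nm0 H : nm (0 : H) = 0.
Proof. by rewrite /nm normr0. Qed.

Lemma nm_eq0 H (x : H) : nm x = 0 -> x = 0.
Proof. by move=> h; apply/eqP; rewrite -normr_eq0 normE h. Qed.

Lemma nmZ H c (x : H) : nm (c *: x) = cabs c * nm x.
Proof. by apply: complexI; rewrite rmorphM /= -!normE -normC_cabs normrZ. Qed.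

Lemma nmD H (x y : H) : nm (x + y) <= nm x + nm y.
Proof. by rewrite -lecR rmorphD /= -!normE ler_normD. Qed.

Lemma nm_sqrD H (x y : H) : nm (x + y) ^+ 2 = nm x ^+ 2 + nm y ^+ 2 + 2 * rip x y.
Proof. rewrite -!ripxx ripDl !ripDr (ripC y x); ring. Qed.

Lemma nm_sqrB H (x y : H) : nm (x - y) ^+ 2 = nm x ^+ 2 + nm y ^+ 2 - 2 * rip x y.
Proof. by rewrite nm_sqrD nmN ripNr mulrN. Qed.

Lemma rip_le H (x y : H) : `|rip x y| <= nm x * nm y.
Proof.
have key (u v : H) : rip u v <= nm u * nm v.
  have [/nm_eq0 ->|u0] := eqVneq (nm u) 0; first by rewrite rip0l nm0 mul0r.
  have [/nm_eq0 ->|v0] := eqVneq (nm v) 0; first by rewrite rip0r nm0 mulr0.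
  have up : 0 < nm u by rewrite lt0r u0 nm_ge0.
  have vp : 0 < nm v by rewrite lt0r v0 nm_ge0.
  have := sqr_ge0 (nm ((nm v)%:C *: u - (nm u)%:C *: v)).
  rewrite nm_sqrB !nmZ !cabs_real !ger0_norm ?nm_ge0// ripZl ripZr => h.
  rewrite -(ler_pM2l (mulr_gt0 up vp)); nra.
rewrite ler_norml key andbT lerNl -ripNl (le_trans (key _ _))// nmN lexx//.
Qed.

Lemma hdot_le H (x y : H) : cabs '[x, y] <= nm x * nm y.
Proof.
set z := '[x, y].
have [z0|z0] := eqVneq (cabs z) 0; first by rewrite z0 mulr_ge0 ?nm_ge0.
have zp : 0 < cabs z by rewrite lt0r z0 cabs_ge0.
have h : rip (Num.conj z *: x) y = cabs z ^+ 2.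
  by rewrite /rip hdotZl -/z cReM cRe_conj cIm_conj cabs_sqr; ring.
have := le_trans (ler_norm _) (rip_le (Num.conj z *: x) y).
rewrite h nmZ expr2 -mulrA.
have -> : cabs (Num.conj z) = cabs z.
  by apply: (pexpIrn (n := 2)); rewrite ?nnegrE ?cabs_ge0 // !cabs_sqr cRe_conj cIm_conj sqrrN.
by rewrite ler_pM2l.
Qed.

Lemma eq_rip H (x y : H) : (forall z, rip x z = rip y z) -> x = y.
Proof.
move=> h; apply/eqP; rewrite -subr_eq0; apply/eqP/nm_eq0/eqP.
by rewrite -sqrf_eq0 -ripxx ripBl h subrr.
Qed.

Section Cvg.
Context {T : Type} (F : set_system T) {FF : Filter F}.

Lemma hcvg_eps H (f : T -> H) (l : H) :
  f @ F --> l <->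
  forall e : R, 0 < e -> \forall t \near F, nm (l - f t) < e.
Proof.
rewrite cvgrPdist_lt; split=> h e e0.
  have := h e%:C; rewrite ltcR => /(_ e0); apply: filterS => t.
  by rewrite normE ltcR.
have e_real : e = (Re e)%:C.
  by move: e0; rewrite ltcE => /andP[/eqP Ie _]; apply: complex_eq; rewrite ?Ie.
have := h (Re e); rewrite -ltcR -e_real => /(_ e0); apply: filterS => t.
by rewrite normE -ltcR -e_real.
Qed.

Lemma cvg_ripl H (f : T -> H) (l y : H) :
  f @ F --> l -> (fun t => rip (f t) y) @ F --> rip l y.
Proof.
move=> /hcvg_eps h; apply/cvgr_eps => e e0.
have d0 : 0 < e / (nm y + 1) by rewrite divr_gt0// ltr_wpDl ?nm_ge0.
apply: filterS (h _ d0) => t ht; rewrite -ripBl (le_lt_trans (rip_le _ _))//.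
have := nm_ge0 y => y0.
rewrite (@le_lt_trans _ _ (nm (l - f t) * (nm y + 1)))//.
  by rewrite ler_wpM2l ?nm_ge0// lerDl.
by rewrite -ltr_pdivlMr// ltr_wpDl.
Qed.

Lemma cvg_nm H (f : T -> H) (l : H) :
  f @ F --> l -> (fun t => nm (f t)) @ F --> nm l.
Proof.
move=> /hcvg_eps h; apply/cvgr_eps => e /h; apply: filterS => t; apply: le_lt_trans.
have h1 := nmD (f t - l) l; have h2 := nmD (l - f t) (f t).
rewrite !subrK nm_sub in h1 h2.
by rewrite ler_norml; apply/andP; split; rewrite ?lerBrDl ?lerBlDr ?(addrC (nm l)) ?lerNl; lra.
Qed.

End Cvg.

Lemma hcauchy_cvg H (u : nat -> H) :
  (forall e : R, 0 < e -> exists N, forall i j, (N <= i)%N -> (N <= j)%N ->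
     nm (u i - u j) < e) -> exists l : H, u @ \oo --> l.
Proof.
move=> h; suff : cvgn u by move=> c; exists (limn u).
apply/cauchy_cvgP/cauchyP => e e0.
have e_real : e = (Re e)%:C.
  by move: e0; rewrite ltcE => /andP[/eqP Ie _]; apply: complex_eq; rewrite ?Ie.
have [|N hN] := h (Re e); first by rewrite -ltcR -e_real.
exists (u N); exists N => // j /= Nj.
by rewrite -ball_normE /ball_ /= normE e_real ltcR hN.
Qed.

Lemma closure_eps H (A : set H) x :
  closure A x -> forall e : R, 0 < e -> exists2 a, A a & nm (x - a) < e.
Proof.
move=> h e e0; have e0' : 0 < e%:C by rewrite ltcR.
have [a [Aa /=]] := h _ (nbhsx_ballx x _ e0').
by rewrite -ball_normE /ball_ /= normE ltcR => ?; exists a.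
Qed.

End Hilbert.

(** * Limits and series *)

Section RealLimits.
Variable R : realType.

Section Filters.
Context {T : Type} (F : set_system T) {FF : ProperFilter F}.
Implicit Types (f g : T -> R) (l : R).

Lemma cvg_ge f l c : f @ F --> l -> (\forall t \near F, c <= f t) -> c <= l.
Proof.
move=> /cvgr_eps fl fc; rewrite leNgt; apply/negP => lc.
have e0 : 0 < c - l by rewrite subr_gt0.
have [t [ft ct]] := filter_ex (filterI (fl _ e0) fc).
by move: ft; rewrite ltr_norml => /andP[]; lra.
Qed.

Lemma cvg_le f l c : f @ F --> l -> (\forall t \near F, f t <= c) -> l <= c.
Proof.
move=> /cvgr_eps fl fc; rewrite leNgt; apply/negP => lc.
have e0 : 0 < l - c by rewrite subr_gt0.
have [t [ft ct]] := filter_ex (filterI (fl _ e0) fc).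
by move: ft; rewrite ltr_norml => /andP[]; lra.
Qed.

Lemma cvgr_uniq f l1 l2 : f @ F --> l1 -> f @ F --> l2 -> l1 = l2.
Proof. by move=> h1 h2; apply: (cvg_unique _ h1 h2). Qed.

Lemma cvgc_uniq (f : T -> R[i]^o) (l1 l2 : R[i]^o) :
  f @ F --> l1 -> f @ F --> l2 -> l1 = l2.
Proof.
move=> /cvgcP[h1 h2] /cvgcP[h3 h4]; apply: complex_eq.
  exact: cvgr_uniq h1 h3.
exact: cvgr_uniq h2 h4.
Qed.

Lemma hcvg_uniq (H : hilbertType R) (f : T -> H) (l1 l2 : H) :
  f @ F --> l1 -> f @ F --> l2 -> l1 = l2.
Proof.
move=> h1 h2; apply: eq_rip => z.
exact: (cvgr_uniq (cvg_ripl (y := z) h1) (cvg_ripl (y := z) h2)).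
Qed.

End Filters.

Lemma squeeze0 (T : Type) (F : set_system T) {FF : Filter F} (f g : T -> R) :
  (\forall t \near F, `|f t| <= g t) -> g @ F --> (0 : R) -> f @ F --> (0 : R).
Proof.
move=> fg /cvgr_eps h; apply/cvgr_eps => e /h; apply: filterS2 fg => t ft gt.
rewrite sub0r normrN (le_lt_trans ft)//; move: gt; rewrite sub0r normrN.
by apply: le_lt_trans; rewrite ler_norm.
Qed.

Lemma seriesS (V : zmodType) (a : nat -> V) N : series a N.+1 = series a N + a N.
Proof. by rewrite /series /= big_nat_recr. Qed.

Lemma series0 (V : zmodType) (a : nat -> V) : series a 0%N = 0.
Proof. by rewrite /series /= big_geq. Qed.

Lemma cvgn_eps (a : nat -> R) l :
  a @ \oo --> l <-> forall e, 0 < e -> exists N, forall n, (N <= n)%N -> `|l - a n| < e.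
Proof.
rewrite cvgr_eps; split=> h e /h; first by case=> N _ hN; exists N.
by case=> N hN; exists N.
Qed.

Lemma series_mono (a : nat -> R) N M : (forall n, 0 <= a n) -> (N <= M)%N ->
  series a N <= series a M.
Proof.
move=> a0 /subnK <-; elim: (M - N)%N => [|k IH]; first by rewrite add0n.
by rewrite addSn seriesS ler_wpDr.
Qed.

Lemma series_le_lim (a : nat -> R) s : (forall n, 0 <= a n) ->
  series a @ \oo --> s -> forall N, series a N <= s.
Proof.
move=> a0 h N; apply: (cvg_ge h); exists N => // M /= NM; exact: series_mono.
Qed.

Lemma series_bounded_cvg (a : nat -> R) M : (forall n, 0 <= a n) ->
  (forall N, series a N <= M) -> exists2 s, series a @ \oo --> s & s <= M.
Proof.
move=> a0 aM; have c : cvgn (series a).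
  apply: nondecreasing_is_cvgn.
    by move=> i j ij; apply: series_mono.
  by exists M => _ [N _ <-].
by exists (limn (series a)) => //; apply: (cvg_le c); exists 0%N => // N _.
Qed.

Lemma series_tail (a : nat -> R) s e : series a @ \oo --> s -> 0 < e ->
  (forall n, 0 <= a n) -> exists N, forall M, (N <= M)%N -> s - e < series a M <= s.
Proof.
move=> h e0 a0; have /cvgn_eps /(_ _ e0) [N hN] := h.
exists N => M NM; have := hN _ NM; rewrite ltr_norml => /andP[h1 h2].
by rewrite (series_le_lim a0 h) andbT; lra.
Qed.

Lemma ler_norm_series (a w : nat -> R) N M : (forall n, `|a n| <= w n) ->
  (N <= M)%N -> `|series a M - series a N| <= series w M - series w N.
Proof.
move=> aw /subnK <-; elim: (M - N)%N => [|k IH]; first by rewrite add0n !subrr normr0.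
rewrite addSn !seriesS (addrAC _ (a _)) (addrAC _ (w _)).
by rewrite (le_trans (ler_normD _ _))// lerD.
Qed.

Lemma dominated_series (a w : nat -> R) s : (forall n, `|a n| <= w n) ->
  series w @ \oo --> s -> exists2 l, series a @ \oo --> l &
    forall N, `|l - series a N| <= s - series w N.
Proof.
move=> aw ws.
have w0 n : 0 <= w n by apply: le_trans (aw n).
have c : cvgn (series a).
  apply/cauchy_cvgP/cauchyP => e e0; have [N hN] := series_tail ws e0 w0.
  exists (series a N); exists N => // M /= NM.
  rewrite /ball /= distrC (le_lt_trans (ler_norm_series aw NM))//.
  by have /andP[h1 h2] := hN _ NM; have /andP[h3 h4] := hN _ (leqnn N); lra.
exists (limn (series a)) => // N.
rewrite ler_norml; apply/andP; split.
  suff : series a N - (s - series w N) <= limn (series a) by lra.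
  apply: (cvg_ge c); exists N => // M /= NM.
  have := ler_norm_series aw NM; rewrite ler_norml => /andP[h _].
  by have := series_le_lim w0 ws M; lra.
suff : limn (series a) <= series a N + (s - series w N) by lra.
apply: (cvg_le c); exists N => // M /= NM.
have := ler_norm_series aw NM; rewrite ler_norml => /andP[_ h].
by have := series_le_lim w0 ws M; lra.
Qed.

(** Dominated convergence: the majorant bounds the tails uniformly along the filter, so
    that only finitely many terms matter. *)
Lemma dominated_series_cvg0 (T : Type) (F : set_system T) {FF : Filter F}
    (a : T -> nat -> R) (w : nat -> R) (s : R) (S : T -> R) :
  (forall t n, `|a t n| <= w n) -> series w @ \oo --> s ->
  (forall n, a ^~ n @ F --> (0 : R)) ->
  (forall t, series (a t) @ \oo --> (S t : R)) -> S @ F --> (0 : R).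
Proof.
move=> aw ws a0 aS.
have w0 : T -> forall n, 0 <= w n by move=> t n; apply: le_trans (aw t n).
have fin N : (fun t => series (a t) N) @ F --> (0 : R).
  elim: N => [|N IH].
    by under eq_fun do rewrite series0; apply: cvg_cst.
  under eq_fun do rewrite seriesS.
  by have := cvgD IH (a0 N); rewrite addr0; apply.
apply/cvgr_eps => e e0; have e20 : 0 < e / 2 by rewrite divr_gt0.
have /cvgn_eps /(_ _ e20) [N hN] := ws.
have := fin N => /cvgr_eps /(_ _ e20); apply: filterS => t.
rewrite !sub0r !normrN => ht.
have [l al hl] := dominated_series (aw t) ws.
have -> : S t = l by apply: cvgr_uniq (aS t) al.
have := hN _ (leqnn N); rewrite ltr_norml => /andP[h1 h2].
rewrite -(subrK (series (a t) N) l) (le_lt_trans (ler_normD _ _))//.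
by rewrite (splitr e) ltrD// (le_lt_trans (hl N)).
Qed.

End RealLimits.

Section ComplexSums.
Variable R : realType.
Implicit Types (z : nat -> R[i]) (w : nat -> R).

Definition csum z : R[i] := limn (series z : nat -> R[i]^o).

Lemma csum_eq z (l : R[i]) : (series z : nat -> R[i]^o) @ \oo --> (l : R[i]^o) -> csum z = l.
Proof. by move=> h; exact: (cvgc_uniq (cvgP _ h) h). Qed.

Lemma Re_series z N : Re (series z N) = series (fun n => Re (z n)) N.
Proof. by rewrite /series /= Re_sum. Qed.
Lemma Im_series z N : Im (series z N) = series (fun n => Im (z n)) N.
Proof. by rewrite /series /= Im_sum. Qed.

Lemma dominated_csum z w (s : R) : (forall n, cabs (z n) <= w n) ->
  series w @ \oo --> s ->
  [/\ (series z : nat -> R[i]^o) @ \oo --> (csum z : R[i]^o),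
      series (fun n => Re (z n)) @ \oo --> Re (csum z),
      series (fun n => Im (z n)) @ \oo --> Im (csum z) &
      cabs (csum z) <= 2 * s].
Proof.
move=> zw ws.
have [|x xl hx] := dominated_series (a := fun n => Re (z n)) _ ws.
  by move=> n; apply: le_trans (zw n); apply: Re_le_cabs.
have [|y yl hy] := dominated_series (a := fun n => Im (z n)) _ ws.
  by move=> n; apply: le_trans (zw n); apply: Im_le_cabs.
have h : (series z : nat -> R[i]^o) @ \oo --> ((x +i* y)%C : R[i]^o).
  by apply/cvgcP => /=; split; [under eq_fun do rewrite Re_series|under eq_fun do rewrite Im_series].
rewrite (csum_eq h); split => //.
have := hx 0%N; have := hy 0%N; rewrite !series0 !subr0 => h1 h2.
rewrite (le_trans (cabs_le_ReIm _))//=.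
lra.
Qed.

End ComplexSums.

(** * Bounded operators *)

Section Operators.
Variable R : realType.
Implicit Types U V W H : hilbertType R.

Lemma bopD U V (A B : bop U V) x : (A + B) x = A x + B x. Proof. by []. Qed.
Lemma bopN U V (A : bop U V) x : (- A) x = - A x. Proof. by []. Qed.
Lemma bopB U V (A B : bop U V) x : (A - B) x = A x - B x. Proof. by []. Qed.
Lemma bopZ U V c (A : bop U V) x : (c *: A) x = c *: A x. Proof. by []. Qed.
Lemma bop0 U V x : (0 : bop U V) x = 0. Proof. by []. Qed.
Lemma bop_sum U V I (s : seq I) (P : pred I) (A : I -> bop U V) x :
  (\sum_(i <- s | P i) A i) x = \sum_(i <- s | P i) A i x.
Proof. by apply: (big_ind2 (fun (B : bop U V) y => B x = y)) => // B1 y1 B2 y2 <- <-. Qed.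
Lemma bopM U V W (A : bop V W) (B : bop U V) x : (A \*b B) x = A (B x). Proof. by []. Qed.
Lemma bop1 U (x : U) : bop_id U x = x. Proof. by []. Qed.

Lemma bop_eq U V (A B : bop U V) : (forall x, A x = B x) -> A = B.
Proof. by move=> h; apply: val_inj; apply/funext. Qed.

Lemma bop_eq_rip U V (A B : bop U V) : (forall x y, rip (A x) y = rip (B x) y) -> A = B.
Proof. by move=> h; apply: bop_eq => x; apply: eq_rip. Qed.

Lemma bop_bound U V (A : bop U V) : exists2 M : R, 0 <= M & forall x, nm (A x) <= M * nm x.
Proof.
have /asboolP[_ [M M0 hM]] := bopP A.
have eM : M = (Re M)%:C.
  by move: M0; rewrite complex_ge0 => /andP[/eqP I0 _]; apply: complex_eq.
exists (Re M); first by move: M0; rewrite complex_ge0 => /andP[].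
by move=> x; rewrite -lecR rmorphM /= -eM -!normE.
Qed.

Lemma mk_bop U V (A : U -> V) (M : R) : linear A -> (forall x, nm (A x) <= M * nm x) ->
  {B : bop U V | forall x, B x = A x}.
Proof.
move=> lA hM; have h : A \in @bounded_linear R U V.
  apply/asboolP; split; first exact: lA.
  exists (`|M|)%:C; first by rewrite ler0c.
  move=> x; rewrite !normE -rmorphM lecR (le_trans (hM x))//.
  by rewrite ler_wpM2r ?nm_ge0// ler_norm.
by exists (Bop h).
Qed.

(** The representing vector of phi minimises |x|^2 - 2 Re (phi x); a minimising
    sequence is Cauchy by the parallelogram identity. *)
Lemma riesz U (phi : U -> R[i]) (M : R) :
  (forall c x y, phi (c *: x + y) = c * phi x + phi y) ->
  (forall x, cabs (phi x) <= M * nm x) -> exists v, forall x, phi x = '[x, v].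
Proof.
move=> lphi bphi.
have phiD x y : phi (x + y) = phi x + phi y by rewrite -[x]scale1r lphi mul1r scale1r.
have phi0 : phi 0 = 0.
  by apply: (addrI (phi 0)); rewrite -phiD !addr0.
have phiZ c x : phi (c *: x) = c * phi x by rewrite -[c *: x]addr0 lphi phi0 addr0.
pose Q x := nm x ^+ 2 - 2 * Re (phi x).
(* Q is bounded below since 2 M |x| <= |x|^2 + M^2. *)
have QM x : - (M ^+ 2) <= Q x.
  have h1 := le_trans (Re_le_cabs (phi x)) (bphi x).
  have h2 := sqr_ge0 (nm x - M).
  by move: h1; rewrite ler_norml => /andP[_]; rewrite /Q; nra.
pose s := inf (range Q).
have hinf : has_inf (range Q).
  by split; [exists (Q 0), 0|exists (- (M ^+ 2)) => _ [x _ <-]].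
have sQ x : s <= Q x by apply: (ge_inf hinf.2); exists x.
have [n|u hu] := @choice _ _ (fun n x => Q x < s + n.+1%:R^-1).
  have i0 : 0 < n.+1%:R^-1 :> R by rewrite invr_gt0.
  have [_ [x _ <-] h] := inf_adherent i0 hinf.
  by exists x.
have par x y : nm (x - y) ^+ 2 <= 2 * (Q x - s) + 2 * (Q y - s).
  have := sQ ((2^-1)%:C *: (x + y)).
  rewrite /Q nmZ phiZ cReM /= mul0r subr0 phiD cReD cabs_real exprMn real_normK ?num_real//.
  have := nm_sqrD x y; have := nm_sqrB x y; rewrite /Q; set p := rip x y.
  by move=> -> ->; lra.
have inv_small (e : R) : 0 < e -> exists N, forall n, (N <= n)%N -> n.+1%:R^-1 < e.
  move=> e0; have [N _ hN] := near_infty_natSinv_lt (PosNum e0).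
  by exists N => n Nn; apply: hN.
have [v uv] : exists v : U, u @ \oo --> v.
  apply: hcauchy_cvg => e e0.
  have [|N hN] := inv_small (e ^+ 2 / 4); first by rewrite divr_gt0// exprn_gt0.
  exists N => i j Ni Nj.
  rewrite -(ltr_pXn2r (_ : 0 < 2)%N) ?nnegrE ?nm_ge0 ?(ltW e0)//.
  have := par (u i) (u j); have := hN _ Ni; have := hN _ Nj.
  have := hu i; have := hu j; move: (Q (u i)) (Q (u j)) => q1 q2.
  by move: (i.+1%:R^-1) (j.+1%:R^-1) => r1 r2; lra.
have key y : rip v y = Re (phi y).
  pose d := rip v y - Re (phi y); pose a := nm y ^+ 2.
  have a0 : 0 <= a by rewrite sqr_ge0.
  have h t : 0 <= t ^+ 2 * a + 2 * t * d.
    pose g n := t ^+ 2 * a + 2 * t * (rip (u n) y - Re (phi y)).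
    have gl : g @ \oo --> t ^+ 2 * a + 2 * t * d.
      apply: cvgD; first exact: cvg_cst.
      apply: cvgM; first exact: cvg_cst.
      by apply: cvgB; [exact: cvg_ripl|exact: cvg_cst].
    have h' (e : R) : 0 < e -> - e <= t ^+ 2 * a + 2 * t * d.
      move=> /inv_small[N hN]; apply: (cvg_ge gl); exists N => // n /= /hN.
      have := sQ (u n + t%:C *: y); have := hu n.
      rewrite /g {2}/Q nm_sqrD nmZ cabs_real exprMn real_normK ?num_real// ripZr.
      rewrite phiD phiZ cReD cReM /= mul0r subr0 /Q -/a.
      by move: (n.+1%:R^-1) => r1; lra.
    rewrite leNgt; apply/negP => lt0.
    have := h' (- (t ^+ 2 * a + 2 * t * d) / 2); lra.
  suff : d = 0 by rewrite /d; lra.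
  apply/eqP/negPn/negP => d0.
  have a1 : 0 < a + 1 by lra.
  have := h (- d / (a + 1)).
  have -> : (- d / (a + 1)) ^+ 2 * a + 2 * (- d / (a + 1)) * d =
            - ((d / (a + 1)) ^+ 2 * (a + 2)) by field; rewrite gt_eqF.
  have : 0 < (d / (a + 1)) ^+ 2 by rewrite exprn_even_gt0//= mulf_neq0// invr_eq0 gt_eqF.
  by nra.
exists v => x; apply: complex_eq; first by rewrite -key ripC.
have := key ('i%C *: x); rewrite phiZ ripC /rip hdotZl !cReM /= !mul0r !mul1r !sub0r.
by move=> /oppr_inj.
Qed.

End Operators.

Lemma cvg_exprn (R : realType) (T : Type) (F : set_system T) (FF : Filter F) (h : T -> R) (l : R) p :
  h @ F --> l -> (fun s => h s ^+ p) @ F --> l ^+ p.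
Proof.
move=> hl; elim: p => [|p IH]; first exact: cvg_cst.
by rewrite exprS; under eq_fun do rewrite exprS; apply: cvgM.
Qed.

(** Abel's theorem. Summation by parts writes the mean minus s as a weighted average of
    the errors of the partial sums, where the weight of any fixed error tends to 0. *)
Lemma abel_theorem (R : realType) (a : nat -> R) (s : R) (A : R -> R) :
  series a @ \oo --> s ->
  (forall r, 0 < r < 1 -> series (fun q => r ^+ q * a q) @ \oo --> A r) ->
  A @ 1^'- --> s.
Proof.
move=> as_ hA; apply/cvgr_eps => eps eps0.
have e4 : 0 < eps / 4 by rewrite divr_gt0.
have /cvgn_eps /(_ _ e4) [N0 hN0] := as_.
pose d q := series a q.+1 - s.
pose C := \sum_(q < N0) `|d q|.
have C0 : 0 <= C by apply: sumr_ge0.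
have C1 : 0 < C + 1 by rewrite ltr_wpDl.
have parts r N : series (fun q => r ^+ q * a q) N - s =
    (1 - r) * series (fun q => r ^+ q * d q) N + r ^+ N * (series a N - s).
  elim: N => [|N IH]; first by rewrite !series0 expr0 mulr0 !sub0r add0r mul1r.
  rewrite !seriesS addrAC IH exprS /d seriesS; ring.
near=> r.
have r0 : 0 < r by near: r; apply: nbhs_left_gt; exact: ltr01.
have r1 : r < 1 by near: r; exact: nbhs_left_lt.
have small : (1 - r) * C <= eps / 4.
  have h : 1 - eps / 4 / (C + 1) <= r.
    near: r; apply: nbhs_left_ge; rewrite gtrBl; by rewrite divr_gt0.
  have h2 : 1 - r <= eps / 4 / (C + 1) by move: h; lra.
  rewrite (le_trans (ler_wpM2r C0 h2))// mulrAC -mulrA -[leRHS]mulr1 ler_wpM2l ?(ltW e4)//.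
  by rewrite ler_pdivrMr// mul1r lerDl.
have bnd N : (N0 <= N)%N -> `|series (fun q => r ^+ q * a q) N - s| <= 3 * (eps / 4).
  move=> NN; rewrite parts (le_trans (ler_normD _ _))//.
  have t2 : `|r ^+ N * (series a N - s)| <= eps / 4.
    rewrite normrM ger0_norm ?exprn_ge0 ?(ltW r0)// distrC; apply: le_trans (ltW (hN0 N NN)).
    by rewrite ler_piMl// exprn_ile1// ltW.
  have t1 : `|series (fun q => r ^+ q * d q) N| <= C + eps / 4 * series (fun q => r ^+ q) N.
    rewrite (le_trans (ler_norm_sum _ _ _))// -(subnKC NN).
    elim: (N - N0)%N => [|j IH].
      rewrite addn0 -[leLHS]addr0 lerD//; last by rewrite mulr_ge0 ?(ltW e4)//; apply: sumr_ge0 => q _; rewrite exprn_ge0// ltW.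
      rewrite big_mkord; apply: ler_sum => q _; rewrite normrM ger0_norm ?exprn_ge0 ?(ltW r0)//.
      by rewrite ler_piMl// exprn_ile1 ?ltW.
    have t : `|r ^+ (N0 + j) * d (N0 + j)%N| <= eps / 4 * r ^+ (N0 + j).
      rewrite normrM ger0_norm ?exprn_ge0 ?(ltW r0)// mulrC ler_wpM2r ?exprn_ge0 ?(ltW r0)//.
      by rewrite /d distrC ltW// hN0//; lia.
    have -> : C + eps / 4 * series (GRing.exp r) (N0 + j.+1)%N =
        C + eps / 4 * series (GRing.exp r) (N0 + j)%N + eps / 4 * r ^+ (N0 + j).
      by rewrite addnS seriesS; ring.
    by rewrite addnS big_nat_recr//= lerD.
  have geo : (1 - r) * series (fun q => r ^+ q) N <= 1.
    have -> : (1 - r) * series (fun q => r ^+ q) N = 1 - r ^+ N.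
      by elim: (N) => [|j IH]; rewrite ?series0 ?mulr0 ?subrr// seriesS mulrDr IH exprS; ring.
    by rewrite gerBl exprn_ge0// ltW.
  rewrite normrM (ger0_norm (_ : 0 <= 1 - r)); last by rewrite subr_ge0 ltW.
  have t3 : (1 - r) * `|series (fun q => r ^+ q * d q) N| <= (1 - r) * (C + eps / 4 * series (fun q => r ^+ q) N).
    by rewrite ler_wpM2l// subr_ge0 ltW.
  have t4 := ler_wpM2l (ltW e4) geo; rewrite mulr1 in t4.
  have t5 : (1 - r) * (C + eps / 4 * series (fun q => r ^+ q) N) =
      (1 - r) * C + eps / 4 * ((1 - r) * series (fun q => r ^+ q) N) by ring.
  rewrite t5 in t3; apply: le_trans (lerD t3 t2) _; apply: le_trans (lerD (lerD small t4) (lexx _)) _.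
  by rewrite le_eqVlt; apply/orP; left; apply/eqP; ring.
have cA : (fun N => `|series (fun q => r ^+ q * a q) N - s|) @ \oo --> `|A r - s|.
  by apply: cvg_norm; apply: cvgB; [apply: hA; rewrite r0|exact: cvg_cst].
rewrite distrC (le_lt_trans (cvg_le cA _ : _ <= 3 * (eps / 4)))//; first by exists N0.
by move: eps0; lra.
Unshelve. all: by end_near. Qed.

(** * Adjoints, positivity and weak limits *)

Section Operators.
Variable R : realType.
Implicit Types U V W H : hilbertType R.

Lemma conjD (a b : R[i]) : Num.conj (a + b) = Num.conj a + Num.conj b.
Proof. exact: rmorphD. Qed.
Lemma conjM (a b : R[i]) : Num.conj (a * b) = Num.conj a * Num.conj b.
Proof. exact: rmorphM. Qed.
Lemma cabs_conj (z : R[i]) : cabs (Num.conj z) = cabs z.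
Proof. by apply: (pexpIrn (n := 2)); rewrite ?nnegrE ?cabs_ge0 // !cabs_sqr cRe_conj cIm_conj sqrrN. Qed.
Lemma conj_real (r : R) : Num.conj r%:C = r%:C.
Proof. by apply: complex_eq; rewrite ?cRe_conj ?cIm_conj //= oppr0. Qed.
Lemma conj0 : Num.conj (0 : R[i]) = 0.
Proof. exact: rmorph0. Qed.
Lemma cabs0 : cabs (0 : R[i]) = 0.
Proof. by rewrite /cabs normr0. Qed.

(** Bounded sesquilinear forms are operators. The bound is asked in the form
    M (|x|^2 + |y|^2), which is what termwise estimates of sums of inner
    products give, and which is equivalent by homogeneity. *)
Lemma sesquilinear_bop U V (B : U -> V -> R[i]) (M : R) :
  (forall c x x' y, B (c *: x + x') y = c * B x y + B x' y) ->
  (forall c x y y', B x (c *: y + y') = Num.conj c * B x y + B x y') ->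
  (forall x y, cabs (B x y) <= M * (nm x ^+ 2 + nm y ^+ 2)) ->
  exists A : bop U V, forall x y, '[A x, y] = B x y.
Proof.
move=> Bl Br BM.
have B0l y : B 0 y = 0.
  by have := Bl 1 0 0 y; rewrite scale1r mul1r add0r => /eqP; rewrite -subr_eq0 opprD addNKr oppr_eq0 => /eqP.
have B0r x : B x 0 = 0.
  by have := Br 1 x 0 0; rewrite scale1r conj_real mul1r add0r => /eqP; rewrite -subr_eq0 opprD addNKr oppr_eq0 => /eqP.
have BZ (a b : R) x y : B (a%:C *: x) (b%:C *: y) = (a * b)%:C * B x y.
  by rewrite -[a%:C *: x]addr0 Bl B0l addr0 -[b%:C *: y]addr0 Br B0r addr0 conj_real rmorphM mulrA.
have bnd x y : cabs (B x y) <= 2 * M * nm x * nm y.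
  have [/nm_eq0 ->|x0] := eqVneq (nm x) 0; first by rewrite B0l cabs0 nm0 mulr0 mul0r.
  have [/nm_eq0 ->|y0] := eqVneq (nm y) 0; first by rewrite B0r cabs0 nm0 mulr0.
  have xp : 0 < nm x by rewrite lt0r x0 nm_ge0.
  have yp : 0 < nm y by rewrite lt0r y0 nm_ge0.
  have := BM ((nm x)^-1%:C *: x) ((nm y)^-1%:C *: y).
  rewrite BZ cabsM !nmZ !cabs_real !ger0_norm ?invr_ge0 ?mulr_ge0 ?invr_ge0 ?nm_ge0//.
  rewrite !mulVf// expr1n -invfM mulrC ler_pdivrMr ?mulr_gt0//.
  by lra.
have ex x : exists v, forall y, '[v, y] = B x y.
  have [|y|v hv] := @riesz _ V (fun y => Num.conj (B x y)) (2 * M * nm x).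
  - by move=> c y y'; rewrite Br conjD conjM conjCK.
  - by rewrite cabs_conj.
  - by exists v => y; rewrite hdotC -hv conjCK.
have [A hA] := choice ex.
have lA : linear A.
  move=> c x y; apply: eq_rip => z; rewrite /rip; congr Re.
  by rewrite hdotDl hdotZl !hA Bl.
have [x|C hC] := @mk_bop _ U V A (2 * `|M|) lA.
  have [a0|a0] := eqVneq (nm (A x)) 0; first by rewrite a0 !mulr_ge0// nm_ge0.
  have ap : 0 < nm (A x) by rewrite lt0r a0 nm_ge0.
  rewrite -(ler_pM2r ap) -expr2 -ripxx /rip hA.
  rewrite (le_trans (le_trans (ler_norm _) (Re_le_cabs _)))// (le_trans (bnd _ _))//.
  by rewrite !ler_wpM2r ?nm_ge0// ler_wpM2l// ler_norm.
by exists C => x y; rewrite hC hA.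
Qed.

(** The adjoint exists because <y, A x> is a bounded sesquilinear form. *)
Lemma adjP U V (A : bop U V) x y : '[A x, y] = '[x, adj A y].
Proof.
have [B hB] : exists B : bop V U, forall y x, '[B y, x] = '[y, A x].
  have [M M0 hM] := bop_bound A.
  apply: (@sesquilinear_bop _ _ (fun y x => '[y, A x]) (M + 1)).
  - by move=> c u u' v; rewrite hdotDl hdotZl.
  - by move=> c u v v'; rewrite linearP hdotDr hdotZr.
  - move=> u v; rewrite (le_trans (hdot_le _ _))//.
    have h1 := hM v; have h2 := sqr_ge0 (nm u - nm v).
    have u0 := nm_ge0 u; have v0 := nm_ge0 v.
    have : nm u * nm (A v) <= nm u * (M * nm v) by rewrite ler_wpM2l.
    have : 0 <= M * (nm u - nm v) ^+ 2 by rewrite mulr_ge0.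
    by have := sqr_ge0 (nm u); have := sqr_ge0 (nm v); nra.
have h : exists B, [set B : bop V U | forall x y, '[A x, y] = '[x, B y]] B.
  by exists B => u v; rewrite hdotC [RHS]hdotC hB.
exact: (xgetPex _ h).
Qed.

Lemma adjPr U V (A : bop U V) x y : '[y, A x] = '[adj A y, x].
Proof. by rewrite hdotC adjP -hdotC. Qed.

Lemma rip_adj U V (A : bop U V) x y : rip (A x) y = rip x (adj A y).
Proof. by rewrite /rip adjP. Qed.
Lemma rip_adjr U V (A : bop U V) x y : rip y (A x) = rip (adj A y) x.
Proof. by rewrite ripC rip_adj ripC. Qed.

Lemma adj_uniq U V (A : bop U V) (B : bop V U) :
  (forall x y, rip (A x) y = rip x (B y)) -> adj A = B.
Proof. by move=> h; apply: bop_eq_rip => y x; rewrite -rip_adjr ripC h ripC. Qed.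

Lemma adjK U V (A : bop U V) : adj (adj A) = A.
Proof. by apply: adj_uniq => y x; rewrite -rip_adjr. Qed.
Lemma adjM U V W (A : bop V W) (B : bop U V) : adj (A \*b B) = adj B \*b adj A.
Proof. by apply: adj_uniq => x y; rewrite !bopM !rip_adj. Qed.
Lemma adj1 U : adj (bop_id U) = bop_id U.
Proof. exact: adj_uniq. Qed.

Lemma adj_bound U V (A : bop U V) M : 0 <= M -> (forall x, nm (A x) <= M * nm x) ->
  forall y, nm (adj A y) <= M * nm y.
Proof.
move=> M0 hM y; have [a0|a0] := eqVneq (nm (adj A y)) 0.
  by rewrite a0 mulr_ge0// nm_ge0.
have ap : 0 < nm (adj A y) by rewrite lt0r a0 nm_ge0.
rewrite -(ler_pM2l ap) -expr2 -ripxx -rip_adj.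
rewrite (le_trans (le_trans (ler_norm _) (rip_le _ _)))//.
by rewrite mulrA [_ * M]mulrC ler_wpM2r ?nm_ge0.
Qed.

Lemma bopMA U V W X (A : bop W X) (B : bop V W) (C : bop U V) :
  A \*b (B \*b C) = A \*b B \*b C.
Proof. exact: bop_eq. Qed.
Lemma bop1M U V (A : bop U V) : bop_id V \*b A = A.
Proof. exact: bop_eq. Qed.
Lemma bopM1 U V (A : bop U V) : A \*b bop_id U = A.
Proof. exact: bop_eq. Qed.

Definition herm U (A : bop U U) := forall x y, rip (A x) y = rip x (A y).
Definition quad U (A : bop U U) x := rip (A x) x.

Lemma ripiN U (x y : U) : rip ('i *: x) ('i *: y) = rip x y.
Proof.
rewrite /rip hdotZl hdotZr mulrA.
have -> : 'i%C * Num.conj ('i%C : R[i]) = 1 by apply: complex_eq; rewrite ?cReM ?cImM cRe_conj cIm_conj /=; ring.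
by rewrite mul1r.
Qed.

Lemma psd_quad U (A : bop U U) x : psd A -> 0 <= quad A x.
Proof. by move=> /(_ x); rewrite complex_ge0 => /andP[]. Qed.

(** Over the complex numbers a real-valued quadratic form is symmetric: this is positivity
    at x + i y. *)
Lemma psd_herm U (A : bop U U) : psd A -> herm A.
Proof.
move=> pA.
have I0 z : rip (A z) ('i *: z) = 0.
  by rewrite -Im_hdot; have := pA z; rewrite complex_ge0 => /andP[/eqP].
have key x y : rip (A x) ('i *: y) + rip (A y) ('i *: x) = 0.
  by have := I0 (x + y); rewrite linearD scalerDr !ripDl !ripDr !I0; lra.
move=> x y; have := key x (- ('i *: y)).
rewrite scalerN scalerA -expr2 sqr_i scaleN1r opprK (linearN A) (linearZ _ y) ripNl ripiN.
by rewrite (ripC x); lra.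
Qed.

Lemma psd_mk U (A : bop U U) : herm A -> (forall x, 0 <= quad A x) -> psd A.
Proof.
move=> hA qA x; rewrite complex_ge0 -/(rip _ _) qA andbT Im_hdot.
have := hA x ('i *: x); have := hA ('i *: x) x; rewrite linearZ /=.
have := ripiN (A x) ('i *: x); rewrite scalerA -expr2 sqr_i scaleN1r ripNr.
move=> h1 h2 h3; apply/eqP; move: h1 h2 h3.
rewrite (ripC ('i *: A x) x) (ripC ('i *: x) (A x)); lra.
Qed.

Lemma hermB U (A B : bop U U) : herm A -> herm B -> herm (A - B).
Proof. by move=> hA hB x y; rewrite !bopB ripBl ripBr hA hB. Qed.
Lemma hermZ U (r : R) (A : bop U U) : herm A -> herm (r%:C *: A).
Proof. by move=> hA x y; rewrite !bopZ ripZl ripZr hA. Qed.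

Lemma quadB U (A B : bop U U) x : quad (A - B) x = quad A x - quad B x.
Proof. by rewrite /quad bopB ripBl. Qed.
Lemma quadZ U (r : R) (A : bop U U) x : quad (r%:C *: A) x = r * quad A x.
Proof. by rewrite /quad bopZ ripZl. Qed.
Lemma quad1 U (x : U) : quad (bop_id U) x = nm x ^+ 2.
Proof. by rewrite /quad bop1 ripxx. Qed.

Lemma psdD U (A B : bop U U) : psd A -> psd B -> psd (A + B).
Proof. by move=> pA pB x; rewrite bopD hdotDl addr_ge0. Qed.
Lemma psdZ U (r : R) (A : bop U U) : 0 <= r -> psd A -> psd (r%:C *: A).
Proof. by move=> r0 pA x; rewrite bopZ hdotZl mulr_ge0 ?ler0c. Qed.
Lemma psd1 U : psd (bop_id U).
Proof. by move=> x; rewrite bop1 hdotxx ler0c sqr_ge0. Qed.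
Lemma psd0 U : psd (0 : bop U U).
Proof. by move=> x; rewrite bop0 hdot0l. Qed.
Lemma psd_conj U V (X : bop U V) (A : bop U U) : psd A -> psd (X \*b A \*b adj X).
Proof. by move=> pA x; rewrite !bopM adjP. Qed.

Lemma herm_polar U (A : bop U U) x y : herm A ->
  rip (A x) y = (quad A (x + y) - quad A (x - y)) / 4.
Proof.
move=> hA; rewrite /quad linearD linearB /= !ripDl !ripDr !ripNl !ripNr.
have := hA x y; rewrite (ripC x) => ->; by field.
Qed.

Lemma herm_eq U (A B : bop U U) : herm A -> herm B ->
  (forall x, quad A x = quad B x) -> A = B.
Proof. by move=> hA hB h; apply: bop_eq_rip => x y; rewrite !herm_polar// !h. Qed.

(** With z the value of the form, positivity at conj z x + t y for all real t makes a
    quadratic polynomial in t nonnegative; its discriminant is the assertion. *)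
Lemma psd_CS U (A : bop U U) x y : psd A ->
  cabs '[A x, y] ^+ 2 <= quad A x * quad A y.
Proof.
move=> pA; have hA := psd_herm pA; have qA z := psd_quad z pA.
have real (u v : U) : rip (A u) v ^+ 2 <= quad A u * quad A v.
  have h t : 0 <= quad A u + 2 * t * rip (A u) v + t ^+ 2 * quad A v.
    have := qA (u + t%:C *: v).
    rewrite {1}/quad linearD linearZ /= !ripDl !ripDr !ripZl !ripZr (ripC (A v)) -hA.
    by rewrite -/(quad A u) -/(quad A v); lra.
  have [v0|v0] := eqVneq (quad A v) 0.
    have [->|b0] := eqVneq (rip (A u) v) 0; first by rewrite expr0n/= v0 mulr0.
    have := h (- (quad A u + 1) / (2 * rip (A u) v)).
    have -> : 2 * (- (quad A u + 1) / (2 * rip (A u) v)) * rip (A u) v = - (quad A u + 1).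
      by field.
    by rewrite v0; lra.
  have vp : 0 < quad A v by rewrite lt0r v0 qA.
  have := h (- rip (A u) v / quad A v).
  have -> : quad A u + 2 * (- rip (A u) v / quad A v) * rip (A u) v + (- rip (A u) v / quad A v) ^+ 2 * quad A v = (quad A u * quad A v - rip (A u) v ^+ 2) / quad A v by field.
  by rewrite pmulr_lge0 ?invr_gt0// subr_ge0.
set z := '[A x, y].
have [z0|z0] := eqVneq (cabs z) 0; first by rewrite z0 expr0n/= mulr_ge0.
have zp : 0 < cabs z ^+ 2 by rewrite exprn_gt0// lt0r z0 cabs_ge0.
have := real (Num.conj z *: x) y.
have -> : rip (A (Num.conj z *: x)) y = cabs z ^+ 2.
  by rewrite linearZ /rip /= hdotZl -/z cReM cRe_conj cIm_conj cabs_sqr; ring.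
have -> : quad A (Num.conj z *: x) = cabs z ^+ 2 * quad A x.
  have -> : cabs z ^+ 2 * quad A x = Re (Num.conj z * z * '[A x, x]).
    rewrite mulrC [Num.conj z * z]mulrC -normCK normC_cabs -rmorphXn cReM /= mul0r subr0.
    by rewrite mulrC.
  by rewrite /quad linearZ /rip /= hdotZl hdotZr conjCK mulrA.
by rewrite expr2 -mulrA ler_pM2l.
Qed.

Section Wot.
Context {T : Type} (F : set_system T) {FF : Filter F}.

Lemma wotP U V (A : T -> bop U V) (L : bop U V) :
  wot_cvg F A L <-> forall x y, (fun t => rip (A t x) y) @ F --> rip (L x) y.
Proof.
split=> [h x y|h x y]; first by have /cvgcP[] := h x y.
apply/cvgcP; split; first exact: h.
by rewrite Im_hdot; under eq_fun do rewrite Im_hdot; exact: h.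
Qed.

(** By polarization. *)
Lemma wot_herm U (A : T -> bop U U) (L : bop U U) :
  (forall t, herm (A t)) -> herm L ->
  (forall x, (fun t => quad (A t) x) @ F --> quad L x) -> wot_cvg F A L.
Proof.
move=> hA hL h; apply/wotP => x y; rewrite herm_polar//.
under eq_fun do rewrite herm_polar//.
by apply: cvgM; [apply: cvgB; exact: h|exact: cvg_cst].
Qed.

Lemma wotB U V (A B : T -> bop U V) (L M : bop U V) :
  wot_cvg F A L -> wot_cvg F B M -> wot_cvg F (fun t => A t - B t) (L - M).
Proof.
move=> /wotP h1 /wotP h2; apply/wotP => x y; rewrite bopB ripBl.
under eq_fun do rewrite bopB ripBl.
exact: cvgB.
Qed.

Lemma wot_conj U V V' U' (A : T -> bop U V) (L : bop U V) (X : bop V V') (Y : bop U' U) :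
  wot_cvg F A L -> wot_cvg F (fun t => X \*b A t \*b Y) (X \*b L \*b Y).
Proof.
move=> /wotP h; apply/wotP => x y; rewrite !bopM rip_adj.
by under eq_fun do rewrite !bopM rip_adj; exact: h.
Qed.

End Wot.

Lemma wot_uniq T (F : set_system T) {FF : ProperFilter F} U V (A : T -> bop U V) L M :
  wot_cvg F A L -> wot_cvg F A M -> L = M.
Proof.
move=> /wotP h1 /wotP h2; apply: bop_eq_rip => x y.
exact: (cvgr_uniq (h1 x y) (h2 x y)).
Qed.

Lemma wot_psd T (F : set_system T) {FF : ProperFilter F} U (A : T -> bop U U) L :
  (forall t, psd (A t)) -> wot_cvg F A L -> psd L.
Proof.
move=> pA /wotP h; apply: psd_mk => [x y|x].
  apply: (cvgr_uniq (h x y)); rewrite ripC.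
  by under eq_fun do rewrite psd_herm// ripC; exact: h.
by apply: (cvg_ge (h x x)); apply: filterE => t; exact: psd_quad.
Qed.

Lemma psd_le_id U (A : bop U U) : psd A -> exists2 c : R, 0 <= c & psd (c%:C *: bop_id U - A).
Proof.
move=> pA; have [M M0 hM] := bop_bound A; exists M => //.
apply: psd_mk => [|x]; first by apply: hermB; [exact: hermZ|exact: psd_herm].
rewrite quadB quadZ quad1 subr_ge0 (le_trans (le_trans (ler_norm _) (rip_le _ _)))//.
by rewrite expr2 mulrA ler_wpM2r ?nm_ge0.
Qed.

End Operators.

(** * Double series *)

Section DoubleSums.
Variable R : realType.

Lemma series_esum (a : nat -> R) (s : R) : (forall n, 0 <= a n) ->
  series a @ \oo --> s <-> (\esum_(n in [set: nat]) (a n)%:E = s%:E)%E.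
Proof.
move=> a0; rewrite -nneseries_esumT; last by move=> n; rewrite lee_fin.
have eE : (fun N => \sum_(0 <= i < N) (a i)%:E)%E = EFin \o series a.
  by apply/funext => N; rewrite sumEFin.
split=> [h|].
  by rewrite eE EFin_lim; [congr EFin; apply/cvg_lim|apply: cvgP h].
rewrite eE => h.
have : EFin \o series a @ \oo --> s%:E.
  rewrite -h -eE; apply: is_cvg_nneseries => n _ _; by rewrite lee_fin.
by move=> /fine_cvgP[].
Qed.

(** Summation over a countable type is summation along its enumeration, the
    gaps of the enumeration being filled with zeros. *)
Lemma esum_pickle (C : countType) (a : C -> \bar R) :
  (\esum_(l in [set: nat]) (if pickle_inv l is Some c then a c else 0) =
   \esum_(c in [set: C]) a c)%E.
Proof.
rewrite [RHS](_ : _ = \esum_(l in range (@pickle C))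
    (if pickle_inv l is Some c then a c else 0))%E; last first.
  rewrite esum_image; last by move=> x y _ _; apply: (pcan_inj pickleK).
  by apply: eq_esum => c _; rewrite pickleK_inv.
rewrite [RHS]esum_mkcond; apply: eq_esum => l _.
case: ifPn => // /negP h; case E : (pickle_inv l) => [c|//]; exfalso; apply: h.
rewrite inE; exists c => //.
by have := @pickle_invK C l; rewrite E.
Qed.

Lemma double_series_nneg (w : nat -> nat -> R) (W : nat -> R) (s : R) :
  (forall j n, 0 <= w j n) -> (forall j, series (w j) @ \oo --> W j) ->
  series W @ \oo --> s ->
  series (fun l => if @pickle_inv (nat * nat)%type l is Some p then w p.1 p.2 else 0) @ \oo --> s.
Proof.
move=> w0 wW Ws.
have W0 j : 0 <= W j by apply: (cvg_ge (wW j)); apply: filterE => N; apply: sumr_ge0.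
apply/series_esum; first by move=> l; case: pickle_inv.
transitivity (\esum_(l in [set: nat]) (if @pickle_inv (nat * nat)%type l is Some p then (w p.1 p.2)%:E else 0))%E.
  by apply: eq_esum => l _; case: pickle_inv.
rewrite (esum_pickle (fun p : nat * nat => (w p.1 p.2)%:E)).
have -> : [set: nat * nat] = [set: nat] `*`` (fun=> [set: nat]).
  by apply/seteqP; split.
rewrite -(@esum_esum _ _ _ _ _ (fun j n => (w j n)%:E)); last by move=> *; rewrite lee_fin.
move/(series_esum _ W0) : Ws => <-.
by apply: eq_esum => j _; apply/series_esum.
Qed.

Lemma seriesDc (a b : nat -> R) (s t : R) : series a @ \oo --> s -> series b @ \oo --> t ->
  series (fun n => a n + b n) @ \oo --> s + t.
Proof. by move=> h1 h2; rewrite (_ : (fun n => a n + b n) = a + b)// seriesD; exact: cvgD. Qed.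

Lemma seriesZc (a : nat -> R) (s c : R) : series a @ \oo --> s ->
  series (fun n => c * a n) @ \oo --> c * s.
Proof.
move=> h; rewrite (_ : series _ = fun n => c * series a n).
  by apply: cvgM => //; exact: cvg_cst.
by apply/funext => n; rewrite /series /= mulr_sumr.
Qed.

Lemma seriesBc (a b : nat -> R) (s t : R) : series a @ \oo --> s -> series b @ \oo --> t ->
  series (fun n => a n - b n) @ \oo --> s - t.
Proof.
move=> h1 /(seriesZc (c := -1)) h2; have := seriesDc h1 h2.
by rewrite mulN1r; under eq_fun do rewrite mulN1r.
Qed.

(** An absolutely convergent double series may be summed along the enumeration of the
    pairs; the nonnegative case is applied to the majorant and to the majorant plus the
    terms. *)
Lemma double_series (a w : nat -> nat -> R) (A W : nat -> R) (s : R) :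
  (forall j n, `|a j n| <= w j n) -> (forall j, series (w j) @ \oo --> W j) ->
  series W @ \oo --> s -> (forall j, series (a j) @ \oo --> A j) ->
  exists2 t : R, series A @ \oo --> t &
    series (fun l => if @pickle_inv (nat * nat)%type l is Some p then a p.1 p.2 else 0) @ \oo --> t.
Proof.
move=> aw wW Ws aA.
have w0 j n : 0 <= w j n by apply: le_trans (aw j n).
have AW j : `|A j| <= W j.
  have [l h1 h2] := dominated_series (aw j) (wW j).
  have -> : A j = l by apply: cvgr_uniq (aA j) h1.
  by have := h2 0%N; rewrite !series0 !subr0.
have [t At _] := dominated_series AW Ws; exists t => //.
have h1 := double_series_nneg w0 wW Ws.
have h2 : series (fun l => if @pickle_inv (nat * nat)%type l is Some p then a p.1 p.2 + w p.1 p.2 else 0) @ \oo --> t + s.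
  apply: (@double_series_nneg (fun j n => a j n + w j n) (fun j => A j + W j)).
  - by move=> j n; have := aw j n; rewrite ler_norml => /andP[]; lra.
  - by move=> j; exact: seriesDc.
  - exact: seriesDc.
have := seriesBc h2 h1; rewrite addrK.
have -> : (fun l => if @pickle_inv (nat * nat)%type l is Some p then a p.1 p.2 else 0) =
  (fun l => (if @pickle_inv (nat * nat)%type l is Some p then a p.1 p.2 + w p.1 p.2 else 0) -
            (if @pickle_inv (nat * nat)%type l is Some p then w p.1 p.2 else 0)).
  by apply/funext => l; case: pickle_inv => [p|]; rewrite ?addrK ?subr0.
exact.
Qed.

Lemma cvgn_single (a : nat -> R) : (forall n, n != 0%N -> a n = 0) ->
  series a @ \oo --> a 0%N.
Proof.
move=> a0; apply/cvgn_eps => e e0; exists 1%N => -[//|n] _.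
suff -> : series a n.+1 = a 0%N by rewrite subrr normr0.
elim: n => [|n IH]; first by rewrite seriesS series0 add0r.
by rewrite seriesS IH (a0 n.+1)// addr0.
Qed.

End DoubleSums.

(** * The w*-topology *)

Section WstarTopology.
Variable R : realType.
Implicit Types U V H : hilbertType R.

Lemma initial_cvgP (S : choiceType) (X : topologicalType) (f : S -> X)
    (F : set_system S) (FF : Filter F) (s : S) :
  F --> (s : initial_topology f) <-> f @ F --> f s.
Proof.
split=> [h|h].
  exact: cvg_trans (cvg_app f h) (@initial_continuous S X f s).
move=> B; rewrite nbhsE => -[C [ [D Dop <-] Ds] CB].
by apply: filterS CB _; apply: h; exact: open_nbhs_nbhs.
Qed.

Lemma wstar_cvgP U V T (F : set_system T) (FF : Filter F) (A : T -> bop U V) (L : bop U V) :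
  A @ F --> (L : wstar U V) <->
  forall p, (fun t => wstar_eval (A t) p) @ F --> (wstar_eval L p : R[i]^o).
Proof.
rewrite initial_cvgP; split=> [h p|h].
  by have /cvg_sup /(_ p) /initial_cvgP := h.
apply/cvg_sup => p; apply/initial_cvgP; exact: h.
Qed.

Lemma sqsumP U (xi : nat -> U) : square_summable xi <->
  exists s : R, series (fun n => nm (xi n) ^+ 2) @ \oo --> s.
Proof.
have E : series (fun n => `|xi n| ^+ 2 : R[i]^o) = fun N => (series (fun n => nm (xi n) ^+ 2) N)%:C.
  apply/funext => N; rewrite /series /= rmorph_sum /=; apply: eq_bigr => n _.
  by rewrite normE rmorphXn.
rewrite /square_summable E; split=> [/cvgP|[s hs]].
  by move=> /cvgcP[h _]; exists (Re (limn (fun N => (series (fun n => nm (xi n) ^+ 2) N)%:C : R[i]^o))).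
by apply: (cvgP (s%:C : R[i]^o)); apply/cvgcP; split => //=; exact: cvg_cst.
Qed.

Definition wpair U V := {p : (nat -> U) * (nat -> V) |
             square_summable p.1 /\ square_summable p.2}.

Lemma wpair_bound U V (p : wpair U V) : exists2 s : R,
  series (fun n => nm ((sval p).1 n) ^+ 2 + nm ((sval p).2 n) ^+ 2) @ \oo --> s & 0 <= s.
Proof.
case: p => -[xi eta] [/= /sqsumP[s hs] /sqsumP[t ht]]; exists (s + t).
  exact: seriesDc.
by apply: addr_ge0; [apply: (cvg_ge hs)|apply: (cvg_ge ht)]; apply: filterE => n;
  apply: sumr_ge0 => i _; rewrite sqr_ge0.
Qed.

Lemma hdot_bop_le U V (A : bop U V) M x y : 0 <= M -> (forall z, nm (A z) <= M * nm z) ->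
  cabs '[A x, y] <= M * (nm x ^+ 2 + nm y ^+ 2).
Proof.
move=> M0 hM; rewrite (le_trans (hdot_le _ _))//.
have h1 := hM x; have h2 := sqr_ge0 (nm x - nm y).
have x0 := nm_ge0 x; have y0 := nm_ge0 y.
have : nm (A x) * nm y <= (M * nm x) * nm y by rewrite ler_wpM2r.
have : 0 <= M * (nm x - nm y) ^+ 2 by rewrite mulr_ge0.
have : 0 <= M * nm x ^+ 2 by rewrite mulr_ge0// sqr_ge0.
have : 0 <= M * nm y ^+ 2 by rewrite mulr_ge0// sqr_ge0.
by lra.
Qed.

Lemma wstar_evalE U V (A : bop U V) (p : wpair U V) :
  wstar_eval A p = csum (fun n => '[A ((sval p).1 n), (sval p).2 n]).
Proof. by []. Qed.

Lemma wstar_wot U V T (F : set_system T) (FF : Filter F) (A : T -> bop U V) (L : bop U V) :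
  A @ F --> (L : wstar U V) -> wot_cvg F A L.
Proof.
move=> /wstar_cvgP h x y.
have sq (W : hilbertType R) (z : W) : square_summable (fun n : nat => if n == 0%N then z else 0 : W).
  by apply/sqsumP; exists (nm z ^+ 2); apply/cvgn_single => -[|n]//=; rewrite nm0 expr0n.
pose p : wpair U V := exist _ (fun n => if n == 0%N then x else 0, fun n => if n == 0%N then y else 0) (conj (sq _ x) (sq _ y)).
have E (B : bop U V) : wstar_eval B p = '[B x, y].
  rewrite wstar_evalE; apply: csum_eq; apply/cvgcP; split.
    rewrite [X in X @ _](_ : _ = series (fun n => Re '[B ((sval p).1 n), (sval p).2 n])).
      by apply/cvgn_single => -[|n]//=; rewrite hdot0r.
    by apply/funext => n; rewrite Re_series.
  rewrite [X in X @ _](_ : _ = series (fun n => Im '[B ((sval p).1 n), (sval p).2 n])).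
    by apply/cvgn_single => -[|n]//=; rewrite hdot0r.
  by apply/funext => n; rewrite Im_series.
have := h p; rewrite E; under eq_fun do rewrite E; exact.
Qed.

(** The series defining a w*-continuous functional is dominated uniformly over a bounded set
    of operators, so its limit may be taken term by term. *)
Lemma bounded_wot_wstar U V T (F : set_system T) (FF : Filter F) (A : T -> bop U V)
    (L : bop U V) (M : R) : 0 <= M ->
  (forall t x, nm (A t x) <= M * nm x) -> wot_cvg F A L -> A @ F --> (L : wstar U V).
Proof.
move=> M0 hM /wotP h; apply/wstar_cvgP => p.
have [ML ML0 hL] := bop_bound L.
have [s hs s0] := wpair_bound p.
have dom (B : bop U V) C : 0 <= C -> (forall x, nm (B x) <= C * nm x) ->
    [/\ series (fun n => Re '[B ((sval p).1 n), (sval p).2 n]) @ \oo --> Re (wstar_eval B p) &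
     series (fun n => Im '[B ((sval p).1 n), (sval p).2 n]) @ \oo --> Im (wstar_eval B p)].
  move=> C0 hC; have := @dominated_csum _ (fun n => '[B ((sval p).1 n), (sval p).2 n]) _ _ _ (seriesZc (c := C) hs).
  by case=> [n|? ? ? ?]; [exact: hdot_bop_le|rewrite wstar_evalE].
have hD t x : nm ((A t - L) x) <= (M + ML) * nm x.
  by rewrite bopB (le_trans (nmD _ _))// nmN mulrDl lerD.
have MML : 0 <= M + ML by rewrite addr_ge0.
have conv0 (f : R[i] -> R) : (forall z, `|f z| <= cabs z) ->
    (forall x y, f x - f y = f (x - y)) ->
    (forall x y, (fun t => f '[(A t - L) x, y]) @ F --> (0 : R)) ->
    (forall (B : bop U V) C, 0 <= C -> (forall x, nm (B x) <= C * nm x) ->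
      series (fun n => f '[B ((sval p).1 n), (sval p).2 n]) @ \oo --> f (wstar_eval B p)) ->
    (fun t => f (wstar_eval (A t) p)) @ F --> f (wstar_eval L p).
  move=> f1 fB f0 fs.
  have := @dominated_series_cvg0 _ _ F _ (fun t n => f '[(A t - L) ((sval p).1 n), (sval p).2 n])
     _ _ (fun t => f (wstar_eval (A t) p) - f (wstar_eval L p)) _ (seriesZc (c := M + ML) hs).
  have -> : (fun t => f (wstar_eval (A t) p)) @ F --> f (wstar_eval L p) <->
     (fun t => f (wstar_eval (A t) p) - f (wstar_eval L p)) @ F --> (0 : R).
    rewrite !cvgr_eps; split=> g e /g; apply: filterS => t;
    by rewrite sub0r normrN distrC.
  apply=> [t n|n|t].
  - by rewrite (le_trans (f1 _))//; exact: hdot_bop_le.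
  - exact: f0.
  - rewrite [X in series X](_ : _ = fun n => f '[A t ((sval p).1 n), (sval p).2 n] - f '[L ((sval p).1 n), (sval p).2 n]).
      by apply: seriesBc; [apply: (fs _ M)|apply: (fs _ ML)].
    by apply/funext => n; rewrite bopB hdotBl fB.
have rip0 x y : (fun t => rip ((A t - L) x) y) @ F --> (0 : R).
  rewrite -[X in _ --> X](subrr (rip (L x) y)).
  by under eq_fun do rewrite bopB ripBl; apply: cvgB; [exact: h|exact: cvg_cst].
apply/cvgcP; split.
  apply: conv0; [exact: Re_le_cabs|by move=> *; rewrite cReB|exact: rip0|].
  by move=> B C C0 hC; case: (dom B C C0 hC).
apply: conv0; [exact: Im_le_cabs|by move=> *; rewrite cImB| |].
  by move=> x y; under eq_fun do rewrite Im_hdot; exact: rip0.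
by move=> B C C0 hC; case: (dom B C C0 hC).
Qed.

End WstarTopology.

Lemma cvgr_sum (R : realType) T (F : set_system T) {FF : Filter F} (I : Type) (r : seq I)
    (f : I -> T -> R) (l : I -> R) : (forall i, f i @ F --> l i) ->
  (fun t => \sum_(i <- r) f i t) @ F --> \sum_(i <- r) l i.
Proof.
move=> h; elim: r => [|i r IH].
  by rewrite big_nil; under eq_fun do rewrite big_nil; exact: cvg_cst.
by rewrite big_cons; under eq_fun do rewrite big_cons; apply: cvgD => //; exact: h.
Qed.

Lemma cvgc_lin (R : realType) T (F : set_system T) {FF : Filter F} (f g : T -> R[i]^o)
    (c l m : R[i]) : f @ F --> (l : R[i]^o) -> g @ F --> (m : R[i]^o) ->
  (fun t => c * f t + g t : R[i]^o) @ F --> (c * l + m : R[i]^o).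
Proof.
move=> /cvgcP[f1 f2] /cvgcP[g1 g2]; apply/cvgcP; split.
  rewrite cReD cReM; under eq_fun do rewrite cReD cReM.
  apply: cvgD => //; apply: cvgB; apply: cvgM => //; exact: cvg_cst.
rewrite cImD cImM; under eq_fun do rewrite cImD cImM.
apply: cvgD => //; apply: cvgD; apply: cvgM => //; exact: cvg_cst.
Qed.

(** * Rank one decompositions and orthonormal expansions *)

Section RankOneDecomposition.
Variables (R : realType) (H : hilbertType R).
Implicit Types (D : bop H H) (x y : H).

Lemma rank_one (eta : H) : {B : bop H H | forall x, B x = '[x, eta] *: eta}.
Proof.
apply: (@mk_bop _ _ _ (fun x => '[x, eta] *: eta) (nm eta ^+ 2)) => [c x y|x].
  by rewrite hdotDl hdotZl scalerDl scalerA.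
rewrite nmZ expr2 -mulrA mulrC ler_wpM2l ?nm_ge0// mulrC.
exact: hdot_le.
Qed.

(** One step of Gaussian elimination at x. If quad D x = 0 then the pivot is 0, as 0 is its
    own inverse, and D is left unchanged. *)
Definition pivot D x : H := ((Num.sqrt (quad D x))^-1)%:C *: D x.
Definition eliminate D x : bop H H := D - sval (rank_one (pivot D x)).

Lemma quad_eliminate D x y :
  quad (eliminate D x) y = quad D y - cabs '[y, pivot D x] ^+ 2.
Proof.
rewrite /eliminate quadB; congr (_ - _).
rewrite /quad (svalP (rank_one _)) /rip hdotZl (hdotC (pivot D x)).
by rewrite -normCK normC_cabs -rmorphXn.
Qed.

Lemma psd_eliminate D x : psd D -> psd (eliminate D x).
Proof.
move=> pD; apply: psd_mk => [|y].
  apply: hermB; first exact: psd_herm.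
  move=> u v; rewrite !(svalP (rank_one _)); move: (pivot D x) => p.
  rewrite /rip hdotZl hdotZr (hdotC p v) [LHS]cReM [RHS]cReM !cRe_conj !cIm_conj; ring.
rewrite quad_eliminate subr_ge0 /pivot hdotZr cabsM cabs_conj cabs_real exprMn.
rewrite real_normK ?num_real// exprVn sqr_sqrtr ?psd_quad//.
have -> : cabs '[y, D x] = cabs '[D x, y] by rewrite [in RHS]hdotC cabs_conj.
have [->|q0] := eqVneq (quad D x) 0; first by rewrite invr0 mul0r psd_quad.
have qp : 0 < quad D x by rewrite lt0r q0 psd_quad.
by rewrite mulrC ler_pdivrMr// mulrC psd_CS.
Qed.

Lemma quad_eliminate_pivot D x : psd D -> quad (eliminate D x) x = 0.
Proof.
move=> pD; rewrite quad_eliminate /pivot hdotZr cabsM cabs_conj cabs_real exprMn.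
rewrite real_normK ?num_real// exprVn sqr_sqrtr ?psd_quad//.
have -> : cabs '[x, D x] = quad D x.
  rewrite hdotC cabs_conj; have := pD x; rewrite complex_ge0 => /andP[/eqP I0 R0].
  have -> : '[D x, x] = (quad D x)%:C by apply: complex_eq.
  by rewrite cabs_real ger0_norm.
have [->|q0] := eqVneq (quad D x) 0; first by rewrite expr0n/= mulr0 subr0.
by rewrite expr2 mulKf// subrr.
Qed.

Lemma psd_quadD D x y : psd D -> quad D (x + y) <= 2 * quad D x + 2 * quad D y.
Proof.
move=> pD; have := psd_quad (x - y) pD.
rewrite /quad linearB linearD /= !ripDl !ripDr !ripNl !ripNr; lra.
Qed.

Lemma dense_sequence : separable H ->
  exists u : nat -> H, forall y (e : R), 0 < e -> exists j, nm (y - u j) < e.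
Proof.
move=> [A cA dA]; have /countable_injP[f finj] := cA.
exists (fun j => xget 0 [set a | A a /\ f a = j]) => y e e0.
have e0' : 0 < e%:C by rewrite ltcR.
have [||a [ya Aa]] := dA (ball y e%:C); first by exists y; exact: ballxx.
  exact: ball_open.
exists (f a); case: xgetP => [b _ [Ab fb]|/(_ a)]; last by case.
have -> : b = a by apply: finj; rewrite ?inE.
by move: ya; rewrite -ball_normE /ball_ /= normE ltcR.
Qed.

(** A positive operator on a separable space is a series of rank one projections.
    Gaussian elimination along a dense sequence subtracts rank one operators from D,
    keeps it positive and makes its quadratic form vanish at more and more points
    of that sequence. *)
Lemma psd_rank_one_decomposition D : separable H -> psd D ->
  exists eta : nat -> H, forall x,
    series (fun n => cabs '[x, eta n] ^+ 2) @ \oo --> quad D x.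
Proof.
move=> /dense_sequence[u du] pD.
pose E := fix E n := if n is k.+1 then eliminate (E k) (u k) else D.
have pE n : psd (E n) by elim: n => [//|n IH]; exact: psd_eliminate.
have E_le n k x : quad (E (n + k)%N) x <= quad (E n) x.
  elim: k => [|k IH]; first by rewrite addn0.
  by rewrite addnS /= quad_eliminate (le_trans _ IH)// lerBlDr lerDl sqr_ge0.
exists (fun n => pivot (E n) (u n)) => x.
have sE N : series (fun n => cabs '[x, pivot (E n) (u n)] ^+ 2) N = quad D x - quad (E N) x.
  elim: N => [|N IH]; first by rewrite series0 subrr.
  by rewrite seriesS IH /= quad_eliminate; lra.
have [M M0 hM] := bop_bound D.
apply/cvgn_eps => e e0.
have e0' : 0 < Num.sqrt (e / (2 * M + 1)) by rewrite sqrtr_gt0 divr_gt0// ltr_wpDl// mulr_ge0.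
have [j hj] := du x _ e0'.
exists j.+1 => n jn; rewrite sE opprB addrC subrK ger0_norm ?psd_quad//.
rewrite -(subnKC jn) (le_lt_trans (E_le _ _ _))//.
rewrite -[x](subrK (u j)) (le_lt_trans (psd_quadD _ _ (pE _)))//.
rewrite {2}/E -/E quad_eliminate_pivot// mulr0 addr0.
have h : quad (E j.+1) (x - u j) <= M * nm (x - u j) ^+ 2.
  rewrite (le_trans (E_le 0%N j.+1 _))// (le_trans (le_trans (ler_norm _) (rip_le _ _)))//.
  by rewrite expr2 mulrA ler_wpM2r ?nm_ge0.
have h2 : nm (x - u j) ^+ 2 < e / (2 * M + 1).
  rewrite -(@sqr_sqrtr _ (e / (2 * M + 1))); last by rewrite divr_ge0 ?(ltW e0)// addr_ge0// mulr_ge0.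
  by rewrite ltr_pXn2r ?nnegrE ?nm_ge0 ?sqrtr_ge0.
have h3 : nm (x - u j) ^+ 2 * (2 * M + 1) < e by rewrite -ltr_pdivlMr// ltr_wpDl// mulr_ge0.
by have := sqr_ge0 (nm (x - u j)); nra.
Qed.

End RankOneDecomposition.

Section RieszFischer.
Variables (R : realType) (K : hilbertType R) (u : nat -> K).
Hypothesis u_orth : forall i j, i != j -> '[u i, u j] = 0.
Hypothesis u_norm : forall i, u i = 0 \/ nm (u i) = 1.

(** Vectors u i equal to 0 are allowed, so that the family may be indexed by the
    enumeration of a countable type. *)
Lemma riesz_fischer (c : nat -> R[i]) (s : R) : (forall i, u i = 0 -> c i = 0) ->
  series (fun i => cabs (c i) ^+ 2) @ \oo --> s ->
  exists y : K, [/\ series (fun i => c i *: u i) @ \oo --> y,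
    forall j, '[y, u j] = c j & nm y ^+ 2 = s].
Proof.
move=> c0 cs; pose S := series (fun i => c i *: u i).
have uu i : c i * '[u i, u i] = c i.
  by have [u0|u1] := u_norm i; [rewrite c0// mul0r|rewrite hdotxx u1 expr1n mulr1].
have Su N j : '[S N, u j] = if (j < N)%N then c j else 0.
  elim: N => [|N IH]; first by rewrite /S series0 hdot0l.
  rewrite /S seriesS -/(S N) hdotDl IH hdotZl.
  have -> : (j < N.+1)%N = (j == N) || (j < N)%N by rewrite ltnS leq_eqVlt.
  have [->|jN] := eqVneq j N; first by rewrite ltnn uu add0r.
  by rewrite u_orth 1?eq_sym// mulr0 addr0.
have SS N k : rip (S (N + k)%N) (S N) = series (fun i => cabs (c i) ^+ 2) N.
  elim: k => [|k IH].
    rewrite addn0; elim: N => [|N IH]; first by rewrite /S !series0 rip0l.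
    rewrite {2}/S !seriesS -/(S N) ripDr.
    have -> : rip (S N.+1) (S N) = rip (S N) (S N).
      rewrite {1}/S seriesS -/(S N) ripDl /rip hdotZl.
      by rewrite (hdotC (u N)) Su ltnn conj0 mulr0 addr0.
    rewrite IH; congr (_ + _); rewrite /rip hdotZr Su ltnSn mulrC -normCK normC_cabs -rmorphXn.
    by [].
  rewrite addnS /S seriesS -/(S _) ripDl -/(S N) IH /rip hdotZl (hdotC (u _)) Su.
  by rewrite ltnNge leq_addr /= conj0 mulr0 addr0.
have dS N k : nm (S (N + k)%N - S N) ^+ 2 =
    series (fun i => cabs (c i) ^+ 2) (N + k) - series (fun i => cabs (c i) ^+ 2) N.
  have sq M : nm (S M) ^+ 2 = series (fun i => cabs (c i) ^+ 2) M.
    by rewrite -ripxx -{1}(addn0 M) SS.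
  by rewrite nm_sqrB SS !sq; lra.
have sq0 n : 0 <= cabs (c n) ^+ 2 by rewrite sqr_ge0.
have [y Sy] : exists y : K, S @ \oo --> y.
  apply: hcauchy_cvg => e e0.
  have e20 : 0 < e ^+ 2 by rewrite exprn_gt0.
  have [N hN] := series_tail cs e20 sq0.
  have key i j : (N <= i)%N -> (i <= j)%N -> nm (S j - S i) < e.
    move=> Ni ij; rewrite -(ltr_pXn2r (_ : 0 < 2)%N) ?nnegrE ?nm_ge0 ?(ltW e0)//.
    rewrite -(subnKC ij) dS; have /andP[h1 h2] := hN _ Ni.
    by have /andP[h3 h4] := hN (i + (j - i))%N (leq_trans Ni (leq_addr _ _)); lra.
  exists N => i j Ni Nj; have [ij|/ltnW ji] := leqP i j; last exact: key.
  by rewrite nm_sub; exact: key.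
have evt (f : nat -> R) l N : (forall n, (N <= n)%N -> f n = l) -> f @ \oo --> l.
  by move=> h; apply/cvgn_eps => e e0; exists N => n /h ->; rewrite subrr normr0.
exists y; split=> [//|j|].
  apply: complex_eq.
    apply: (cvgr_uniq (cvg_ripl (y := u j) Sy)); apply: (evt _ _ j.+1) => n jn.
    by rewrite /rip Su jn.
  rewrite Im_hdot; apply: (cvgr_uniq (cvg_ripl (y := 'i *: u j) Sy)); apply: (evt _ _ j.+1) => n jn.
  by rewrite -Im_hdot Su jn.
apply: (cvgr_uniq _ cs).
rewrite (_ : series _ = fun n => nm (S n) * nm (S n)); last first.
  by apply/funext => n; rewrite -expr2 -ripxx; have := SS n 0%N; rewrite addn0.
by rewrite expr2; apply: cvgM; exact: cvg_nm.
Qed.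

Hypothesis u_total : forall z, (forall i, '[z, u i] = 0) -> z = 0.

Lemma bessel (y : K) N : series (fun i => cabs '[y, u i] ^+ 2) N <= nm y ^+ 2.
Proof.
pose S N := series (fun i => '[y, u i] *: u i) N.
have uu i : '[y, u i] * '[u i, u i] = '[y, u i].
  by have [->|u1] := u_norm i; [rewrite hdot0r mul0r|rewrite hdotxx u1 expr1n mulr1].
have Su M j : '[S M, u j] = if (j < M)%N then '[y, u j] else 0.
  elim: M => [|M IH]; first by rewrite /S series0 hdot0l.
  rewrite /S seriesS -/(S M) hdotDl IH hdotZl.
  have -> : (j < M.+1)%N = (j == M) || (j < M)%N by rewrite ltnS leq_eqVlt.
  have [->|jM] := eqVneq j M; first by rewrite ltnn uu add0r.
  by rewrite u_orth 1?eq_sym// mulr0 addr0.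
have yS M : rip y (S M) = series (fun i => cabs '[y, u i] ^+ 2) M.
  elim: M => [|M IH]; first by rewrite /S !series0 rip0r.
  rewrite /S !seriesS -/(S M) ripDr IH /rip hdotZr mulrC -normCK normC_cabs -rmorphXn.
  by [].
have SS M : nm (S M) ^+ 2 = series (fun i => cabs '[y, u i] ^+ 2) M.
  elim: M => [|M IH]; first by rewrite /S !series0 nm0 expr0n.
  rewrite {1}/S !seriesS -/(S M) nm_sqrD IH.
  have -> : rip (S M) ('[y, u M] *: u M) = 0 by rewrite /rip hdotZr Su ltnn mulr0.
  have -> : nm ('[y, u M] *: u M) ^+ 2 = cabs '[y, u M] ^+ 2.
    rewrite nmZ exprMn; have [u0|->] := u_norm M; last by rewrite expr1n mulr1.
    by rewrite u0 hdot0r cabs0 expr0n mul0r.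
  by rewrite mulr0 addr0.
by have := sqr_ge0 (nm (y - S N)); rewrite nm_sqrB yS SS; lra.
Qed.

Lemma orthonormal_expansion (y : K) :
  series (fun i => '[y, u i] *: u i) @ \oo --> y /\
  series (fun i => cabs '[y, u i] ^+ 2) @ \oo --> (nm y ^+ 2 : R).
Proof.
have [|s hs _] := series_bounded_cvg _ (bessel y); first by move=> i; rewrite sqr_ge0.
have [|z [zl zc zs]] := riesz_fischer (c := fun i => '[y, u i]) _ hs.
  by move=> i ->; rewrite hdot0r.
have zy : z = y.
  by apply/eqP; rewrite -subr_eq0; apply/eqP/u_total => i; rewrite hdotBl zc subrr.
by rewrite zy in zl zs; rewrite zs.
Qed.

End RieszFischer.

(** * Amplification of operators along a decomposition of the norm *)

Section Dilation.
Variables (R : realType) (N H : hilbertType R) (U : nat -> bop H N).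
Hypothesis U_iso : forall x, series (fun n => nm (U n x) ^+ 2) @ \oo --> (nm x ^+ 2 : R).
Arguments U_iso : clear implicits.
Implicit Types (A B : bop N N) (x y : H).

Lemma U_sqsum x : square_summable (fun n => U n x).
Proof. by apply/sqsumP; exists (nm x ^+ 2). Qed.

Arguments U_sqsum : clear implicits.

Definition fiber_pair x y : wpair N N :=
  exist _ (fun n => U n x, fun n => U n y) (conj (U_sqsum x) (U_sqsum y)).

Lemma fiber_dominated A x y :
  let z n := '[A (U n x), U n y] in
  [/\ (series z : nat -> R[i]^o) @ \oo --> (csum z : R[i]^o),
      series (fun n => rip (A (U n x)) (U n y)) @ \oo --> Re (csum z) &
      series (fun n => Im (z n)) @ \oo --> Im (csum z)].
Proof.
have [M M0 hM] := bop_bound A.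
have [n|? ? ? _] := @dominated_csum _ (fun n => '[A (U n x), U n y]) _ _ _
  (seriesZc (c := M) (seriesDc (U_iso x) (U_iso y))); first exact: hdot_bop_le.
by split.
Qed.

(** If V maps x to the sequence (U n x)_n then V is an isometry into the l^2-sum
    of copies of N, and this is the compression V^* (A (+) A (+) ...) V. *)
Definition compress_ampl A : bop H H :=
  xget (0 : bop H H) [set B | forall x y, '[B x, y] = csum (fun n => '[A (U n x), U n y])].

Lemma compress_amplE A x y :
  '[compress_ampl A x, y] = csum (fun n => '[A (U n x), U n y]).
Proof.
suff h : exists C, [set C : bop H H | forall x y, '[C x, y] = csum (fun n => '[A (U n x), U n y])] C.
  exact: (xgetPex _ h).
have [M M0 hM] := bop_bound A.
apply: (@sesquilinear_bop _ _ _ _ (2 * M)).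
- move=> c x1 x2 y1; apply: csum_eq.
  have [h1 _ _] := fiber_dominated A x1 y1; have [h2 _ _] := fiber_dominated A x2 y1.
  rewrite [X in X @ _](_ : _ = fun k => c * series (fun n => '[A (U n x1), U n y1]) k + series (fun n => '[A (U n x2), U n y1]) k).
    by apply: cvgc_lin.
  apply/funext => k; rewrite /series /= mulr_sumr -big_split /=; apply: eq_bigr => n _.
  by rewrite !linearP hdotDl hdotZl.
- move=> c x1 y1 y2; apply: csum_eq.
  have [h1 _ _] := fiber_dominated A x1 y1; have [h2 _ _] := fiber_dominated A x1 y2.
  rewrite [X in X @ _](_ : _ = fun k => Num.conj c * series (fun n => '[A (U n x1), U n y1]) k + series (fun n => '[A (U n x1), U n y2]) k).
    by apply: cvgc_lin.
  apply/funext => k; rewrite /series /= mulr_sumr -big_split /=; apply: eq_bigr => n _.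
  by rewrite (linearP (U n)) hdotDr hdotZr.
- move=> x1 y1; have [n|_ _ _ h] := @dominated_csum _ (fun n => '[A (U n x1), U n y1]) _ _ _
    (seriesZc (c := M) (seriesDc (U_iso x1) (U_iso y1))); first exact: hdot_bop_le.
  by rewrite -mulrA.
Qed.

Lemma compress_ampl_eval A x y : '[compress_ampl A x, y] = wstar_eval A (fiber_pair x y).
Proof. exact: compress_amplE. Qed.

Lemma compress_ampl_rip A x y :
  series (fun n => rip (A (U n x)) (U n y)) @ \oo --> rip (compress_ampl A x) y.
Proof. by rewrite /(rip _ y) compress_amplE; have [] := fiber_dominated A x y. Qed.

Arguments compress_ampl_rip : clear implicits.

Lemma compress_ampl_linear c A B :
  compress_ampl (c *: A + B) = c *: compress_ampl A + compress_ampl B.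
Proof.
apply: bop_eq_rip => x y; rewrite /rip bopD bopZ hdotDl hdotZl !compress_amplE.
congr Re; apply: csum_eq.
have [h1 _ _] := fiber_dominated A x y; have [h2 _ _] := fiber_dominated B x y.
rewrite [X in X @ _](_ : _ = fun k => c * series (fun n => '[A (U n x), U n y]) k + series (fun n => '[B (U n x), U n y]) k).
  by apply: cvgc_lin.
apply/funext => k; rewrite /series /= mulr_sumr -big_split /=; apply: eq_bigr => n _.
transitivity ('[c *: A (U n x) + B (U n x), U n y]); first by [].
by rewrite hdotDl hdotZl.
Qed.

Lemma compress_ampl1 : compress_ampl (bop_id N) = bop_id H.
Proof.
apply: herm_eq => // [x y|x].
  apply: (cvgr_uniq (compress_ampl_rip _ x y)); rewrite ripC.
  by have := compress_ampl_rip (bop_id N) y x; under eq_fun do rewrite ripC.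
rewrite quad1; apply: (cvgr_uniq (compress_ampl_rip _ x x)).
by under eq_fun do rewrite bop1 ripxx; exact: U_iso.
Qed.

(** The positivity of a matrix of operators is inherited by each term of the sum. *)
Lemma compress_ampl_cp : completely_positive setT compress_ampl.
Proof.
move=> d A _ pA x.
pose z n := \sum_i \sum_j '[A i j (U n (x j)), U n (x i)].
have z0 n : 0 <= z n by exact: (pA (fun i => U n (x i))).
have h1 : series (fun n => Re (z n)) @ \oo --> Re (\sum_i \sum_j '[compress_ampl (A i j) (x j), x i]).
  rewrite Re_sum [X in X @ _](_ : _ = fun k => \sum_i series (fun n => Re (\sum_j '[A i j (U n (x j)), U n (x i)])) k).
    apply: cvgr_sum => i; rewrite Re_sum.
    rewrite [X in X @ _](_ : _ = fun k => \sum_j series (fun n => rip (A i j (U n (x j))) (U n (x i))) k).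
      by apply: cvgr_sum => j; exact: compress_ampl_rip.
    apply/funext => k; rewrite /series /= exchange_big /=; apply: eq_bigr => n _.
    by rewrite Re_sum.
  apply/funext => k; rewrite /series /= exchange_big /=; apply: eq_bigr => n _.
  by rewrite Re_sum.
have h2 : series (fun n => Im (z n)) @ \oo --> Im (\sum_i \sum_j '[compress_ampl (A i j) (x j), x i]).
  rewrite Im_sum [X in X @ _](_ : _ = fun k => \sum_i series (fun n => Im (\sum_j '[A i j (U n (x j)), U n (x i)])) k).
    apply: cvgr_sum => i; rewrite Im_sum.
    rewrite [X in X @ _](_ : _ = fun k => \sum_j series (fun n => Im '[A i j (U n (x j)), U n (x i)]) k).
      by apply: cvgr_sum => j; rewrite compress_amplE; have [] := fiber_dominated (A i j) (x j) (x i).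
    apply/funext => k; rewrite /series /= exchange_big /=; apply: eq_bigr => n _.
    by rewrite Im_sum.
  apply/funext => k; rewrite /series /= exchange_big /=; apply: eq_bigr => n _.
  by rewrite Im_sum.
rewrite complex_ge0; apply/andP; split.
  apply/eqP; apply: (cvgr_uniq h2).
  rewrite [X in X @ _](_ : _ = fun=> 0); first exact: cvg_cst.
  apply/funext => k; rewrite /series /= big1// => n _.
  by have := z0 n; rewrite complex_ge0 => /andP[/eqP].
apply: (cvg_ge h1); apply: filterE => k; apply: sumr_ge0 => n _.
by have := z0 n; rewrite complex_ge0 => /andP[].
Qed.

Lemma compress_ampl_wot T (F : set_system T) (FF : Filter F) (A : T -> bop N N)
    (L : bop N N) (M : R) :
  0 <= M -> (forall t z, nm (A t z) <= M * nm z) -> wot_cvg F A L ->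
  wot_cvg F (compress_ampl \o A) (compress_ampl L).
Proof.
move=> M0 hM h x y; rewrite compress_ampl_eval.
have /wstar_cvgP /(_ (fiber_pair x y)) := bounded_wot_wstar FF M0 hM h.
suff -> : (fun t => '[(compress_ampl \o A) t x, y]) = (fun t => wstar_eval (A t) (fiber_pair x y)) by [].
by apply/funext => t; exact: compress_ampl_eval.
Qed.

(** The norm is that of V^* applied to the sequence (A (U n x))_n, and V^* is a contraction. *)
Lemma compress_ampl_bound A x (s : R) :
  series (fun n => nm (A (U n x)) ^+ 2) @ \oo --> s -> nm (compress_ampl A x) ^+ 2 <= s.
Proof.
move=> hs; set z := compress_ampl A x.
have h := compress_ampl_rip A x z.
have h2 := seriesZc (c := 2^-1) (seriesDc hs (U_iso z)).
suff : rip z z <= 2^-1 * (s + nm z ^+ 2) by rewrite ripxx; lra.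
have h3 := seriesBc h2 h; rewrite -subr_ge0; apply: (cvg_ge h3).
apply: filterE => k; apply: sumr_ge0 => n _.
rewrite subr_ge0; have := sqr_ge0 (nm (A (U n x) - U n z)); rewrite nm_sqrB; lra.
Qed.

(** The w*-continuous functionals of the target pull back to w*-continuous
    functionals: the double series obtained is rearranged into a single one. *)
Lemma compress_ampl_continuous :
  continuous (compress_ampl : wstar N N -> wstar H H).
Proof.
move=> L; apply/(wstar_cvgP (nbhs_filter (L : wstar N N))) => -[[xi eta] [/= sxi seta]].
have /sqsumP[s hs] := sxi; have /sqsumP[t ht] := seta.
pose re W (V : nat -> bop H W) (zeta : nat -> H) l : W :=
  if @pickle_inv (nat * nat)%type l is Some p then V p.2 (zeta p.1) else 0.
have sq zeta : square_summable zeta -> square_summable (re _ U zeta).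
  move=> /sqsumP[r hr]; apply/sqsumP; exists r.
  have := double_series_nneg (w := fun j n => nm (U n (zeta j)) ^+ 2) _ (fun j => U_iso (zeta j)) hr.
  rewrite (_ : (fun l => nm (re _ U zeta l) ^+ 2) = fun l => if @pickle_inv (nat * nat)%type l is Some p then nm (U p.2 (zeta p.1)) ^+ 2 else 0).
    by apply=> *; rewrite sqr_ge0.
  by apply/funext => l; rewrite /re; case: pickle_inv => //; rewrite nm0 expr0n.
pose p : wpair N N := exist _ (re _ U xi, re _ U eta) (conj (sq _ sxi) (sq _ seta)).
have E A : wstar_eval (compress_ampl A) (exist _ (xi, eta) (conj sxi seta)) = wstar_eval A p.
  rewrite !wstar_evalE /=.
  have [M M0 hM] := bop_bound A.
  have hw j := seriesZc (c := M) (seriesDc (U_iso (xi j)) (U_iso (eta j))).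
  have hW := seriesZc (c := M) (seriesDc hs ht).
  have hb j n : cabs '[A (U n (xi j)), U n (eta j)] <= M * (nm (U n (xi j)) ^+ 2 + nm (U n (eta j)) ^+ 2).
    exact: hdot_bop_le.
  have [r1 h1 h1'] := double_series (a := fun j n => Re '[A (U n (xi j)), U n (eta j)])
    (fun j n => le_trans (Re_le_cabs _) (hb j n)) hw hW (fun j => compress_ampl_rip A (xi j) (eta j)).
  have [|r2 h2 h2'] := double_series (a := fun j n => Im '[A (U n (xi j)), U n (eta j)])
    (A := fun j => Im '[compress_ampl A (xi j), eta j])
    (fun j n => le_trans (Im_le_cabs _) (hb j n)) hw hW.
    by move=> j; rewrite compress_amplE; have [] := fiber_dominated A (xi j) (eta j).
  rewrite (@csum_eq _ _ (r1 +i* r2)%C).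
    symmetry; apply: csum_eq; apply/cvgcP; split => /=.
      rewrite [X in X @ _](_ : _ = series (fun l => if @pickle_inv (nat * nat)%type l is Some p then Re '[A (U p.2 (xi p.1)), U p.2 (eta p.1)] else 0)) //.
      apply/funext => k; rewrite Re_series; congr (series _ k); apply/funext => l.
      by rewrite /re; case: pickle_inv => //; rewrite hdot0r.
    rewrite [X in X @ _](_ : _ = series (fun l => if @pickle_inv (nat * nat)%type l is Some p then Im '[A (U p.2 (xi p.1)), U p.2 (eta p.1)] else 0)) //.
    apply/funext => k; rewrite Im_series; congr (series _ k); apply/funext => l.
    by rewrite /re; case: pickle_inv => //; rewrite hdot0r.
  by apply/cvgcP; split; [under eq_fun do rewrite Re_series|under eq_fun do rewrite Im_series].
rewrite E.
have /(wstar_cvgP (nbhs_filter (L : wstar N N))) /(_ p) hp := @cvg_id (wstar N N) (nbhs (L : wstar N N)).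
apply: cvg_trans hp; apply: near_eq_cvg; apply: filterE => A.
by rewrite E.
Qed.

(** The components of (A s - L) x along the U p are dominated by those of x. The bound is
    only asked for near the limit; elsewhere A s is replaced by L. *)
Lemma compress_ampl_strong (T : Type) (G : set_system T) (FG : Filter G) (A : T -> bop N N) (L : bop N N) (M : R) x :
  0 <= M -> (\forall s \near G, forall y : N, nm (A s y) <= M * nm y) ->
  (forall y : N, (fun s => A s y) @ G --> L y) ->
  (fun s => compress_ampl (A s) x) @ G --> compress_ampl L x.
Proof.
move=> M0 hM hA; have [M' M'0 hM'] := bop_bound L.
pose good s := `[< forall y : N, nm (A s y) <= M * nm y >].
pose B s := (if good s then A s else L) - L.
have B_le s (y : N) : nm (B s y) <= (M + M' + M') * nm y.
  rewrite /B bopB (le_trans (nmD _ _))// nmN 2!mulrDl lerD//.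
  case: ifP => [/asboolP h|_].
    by rewrite (le_trans (h y))// lerDl mulr_ge0// nm_ge0.
  by rewrite (le_trans (hM' y))// lerDr mulr_ge0// nm_ge0.
have B0 (y : N) : (fun s => nm (B s y)) @ G --> (0 : R).
  apply/cvgr_eps => eps eps0; have /hcvg_eps /(_ eps eps0) := hA y.
  apply: filterS => s; rewrite sub0r normrN ger0_norm ?nm_ge0// /B bopB.
  by case: ifP => _; rewrite ?subrr ?nm0// nm_sub.
pose C := M + M' + M'.
have C0 : 0 <= C by rewrite !addr_ge0.
have hw := seriesZc (c := C ^+ 2) (U_iso x).
have sq s p : nm (B s (U p x)) ^+ 2 <= C ^+ 2 * nm (U p x) ^+ 2.
  by rewrite -exprMn ler_pXn2r ?nnegrE ?mulr_ge0 ?nm_ge0//; exact: B_le.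
have ex s : exists S : R, series (fun p => nm (B s (U p x)) ^+ 2) @ \oo --> S.
  have [|N0|S hS _] := @series_bounded_cvg R (fun p => nm (B s (U p x)) ^+ 2) (C ^+ 2 * nm x ^+ 2).
  - by move=> p; exact: sqr_ge0.
  - apply: le_trans (series_le_lim _ hw N0); first by apply: ler_sum => p _; exact: sq.
    by move=> p; rewrite mulr_ge0 ?sqr_ge0.
  - by exists S.
pose S s := sval (cid (ex s)).
have hS s : series (fun p => nm (B s (U p x)) ^+ 2) @ \oo --> S s by exact: svalP (cid (ex s)).
have S0 : S @ G --> (0 : R).
  apply: (dominated_series_cvg0 (a := fun s p => nm (B s (U p x)) ^+ 2) (w := fun p => C ^+ 2 * nm (U p x) ^+ 2) _ hw) => //.
    by move=> s p; rewrite ger0_norm ?sqr_ge0.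
  by move=> p; rewrite -[X in _ --> X](expr0n R 2); apply: cvg_exprn.
apply/hcvg_eps => eps eps0; have /cvgr_eps /(_ (eps ^+ 2)) := S0.
move=> /(_ (exprn_gt0 _ eps0)); apply: filterS2 hM => s hs; rewrite sub0r normrN => Ss.
have Bs : B s = A s - L by rewrite /B /good; case: asboolP.
have E : compress_ampl (A s) x - compress_ampl L x = compress_ampl (B s) x.
  have := compress_ampl_linear (-1) L (A s).
  by rewrite !scaleN1r ![- _ + _]addrC Bs => ->; rewrite bopB.
rewrite nm_sub E -(ltr_pXn2r (_ : 0 < 2)%N) ?nnegrE ?nm_ge0 ?(ltW eps0)//.
apply: le_lt_trans (compress_ampl_bound (hS s)) _.
exact: le_lt_trans (ler_norm _) Ss.
Qed.

End Dilation.

(** * The weights as power series coefficients *)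

Section Words.
Variables (R : realType) (d : nat) (f : seq 'I_d -> R).
Implicit Types (b : seq 'I_d) (g h : seq 'I_d -> R).

(** The product of power series in noncommuting variables. *)
Definition conv g h b : R := \sum_(s < (size b).+1) g (take s b) * h (drop s b).

(** The coefficients of the p-th power of the series f. *)
Fixpoint fpow p : seq 'I_d -> R :=
  if p is q.+1 then conv f (fpow q) else fun b => (b == [::])%:R.

(** The coefficients of (1 - f)^(-m), for every m >= 0. *)
Definition wt m b : R := \sum_(p < (size b).+1) 'C(p + m - 1, p)%:R * fpow p b.

Hypothesis f_nil : f [::] = 0.

Fixpoint factorizations p b : seq (seq (seq 'I_d)) :=
  if p is q.+1 then
    flatten [seq [seq take s.+1 b :: u | u <- factorizations q (drop s.+1 b)] |
              s <- iota 0 (size b)]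
  else if b is [::] then [:: [::]] else [::].

Lemma mem_factorizations p b (g : seq (seq 'I_d)) :
  g \in factorizations p b <-> [/\ size g = p, [::] \notin g & flatten g = b].
Proof.
elim: p b g => [|p IH] b g.
  case: b => [|j b] /=; first by rewrite inE; split=> [/eqP ->//|[/size0nil ->]].
  by split=> [//|[/size0nil ->]].
split=> [/allpairsPdep[s [u [sb /IH[su nu fu] ->]]]|].
  rewrite mem_iota add0n /= in sb; split.
  - by rewrite /= su.
  - rewrite inE negb_or nu andbT eq_sym -size_eq0 size_take.
    by case: ifP => // _; rewrite -lt0n (leq_ltn_trans _ sb).
  - by rewrite /= fu cat_take_drop.
case: g => [[]//|w g] [/= [sg]]; rewrite inE negb_or => /andP[w0 ng] fb.
have sw : (size w).-1.+1 = size w by case: w w0 {fb}.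
apply/allpairsPdep; exists (size w).-1, g; rewrite sw -fb take_size_cat// drop_size_cat//; split=> //.
  by rewrite mem_iota add0n /= size_cat sw leq_addr.
exact/IH.
Qed.

Lemma uniq_factorizations p b : uniq (factorizations p b).
Proof.
elim: p b => [|p IH] b /=; first by case: b.
apply: (@allpairs_uniq_dep nat (fun=> seq (seq 'I_d)) _ (fun s u => take s.+1 b :: u) (iota 0 (size b))
  (fun s => factorizations p (drop s.+1 b))).
- exact: iota_uniq.
- by move=> s _; exact: IH.
- move=> [s g] [s' g'] /allpairsPdep[s1 [g1 [hs1 _ E1]]] /allpairsPdep[s2 [g2 [hs2 _ E2]]].
  move: hs1 hs2; rewrite !mem_iota !add0n /=.
  have -> : s1 = s by have := congr1 tag E1.
  have -> : s2 = s' by have := congr1 tag E2.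
  move=> sb sb' [E ->]; have : size (take s.+1 b) = size (take s'.+1 b) by rewrite E.
  by rewrite !size_takel// => -[->].
Qed.

Lemma fpow_factorizations p b :
  fpow p b = \sum_(g <- factorizations p b) \prod_(w <- g) f w.
Proof.
elim: p b => [|p IH] b /=.
  by case: b => [|j b] /=; rewrite ?big_nil// big_seq1 big_nil.
rewrite big_flatten big_map /conv big_ord_recl take0 f_nil mul0r add0r.
rewrite -[X in iota 0 X]subn0 -/(index_iota 0 _) big_mkord; apply: eq_bigr => s _.
rewrite big_map IH mulr_sumr; apply: eq_bigr => g _.
by rewrite big_cons.
Qed.

Lemma fpow_short p b : (size b < p)%N -> fpow p b = 0.
Proof.
elim: p b => [//|p IH] b bp /=; rewrite /conv big1// => -[[|s] hs] _ /=.
  by rewrite take0 f_nil mul0r.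
rewrite IH ?mulr0// size_drop; lia.
Qed.

Lemma wt_widen m b k : (size b < k)%N ->
  wt m b = \sum_(p < k) 'C(p + m - 1, p)%:R * fpow p b.
Proof.
move=> bk; rewrite /wt -!(big_mkord predT (fun p => 'C(p + m - 1, p)%:R * fpow p b)).
rewrite [RHS](big_cat_nat (leq0n _) bk)//= [X in _ + X]big_nat_cond.
rewrite [X in _ + X]big1 ?addr0// => p; rewrite andbT => /andP[bp _].
by rewrite fpow_short ?mulr0.
Qed.

(** The factorizations of b into nonempty words, grouped by their number of factors, are
    what the powers of f count. *)
Lemma weightE m b : (0 < m)%N -> weight f m b = wt m b.
Proof.
move=> m0; rewrite /weight; case: b => [|j b].
  by rewrite /wt big_ord1 /= mulr1 bin0.
rewrite /wt -(big_mkord predT (fun p => 'C(p + m - 1, p)%:R * fpow p (j :: b))).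
rewrite [RHS]big_nat_recl//= mulr0 add0r.
rewrite [LHS]big_add1/=; apply: eq_bigr => p _.
have -> : [set u : seq (seq 'I_d) | [/\ size u = p.+1, [::] \notin u & flatten u = j :: b]] =
    [set` factorizations p.+1 (j :: b)].
  by apply/seteqP; split=> u; have [h1 h2] := mem_factorizations p.+1 (j :: b) u; [exact: h2|exact: h1].
rewrite -fsbig_seq ?uniq_factorizations// -mulr_suml -fpow_factorizations mulrC.
congr (_%:R * _); rewrite -[in RHS]bin_sub; last by lia.
by congr 'C(_, _); lia.
Qed.

Lemma wt0 b : wt 0 b = (b == [::])%:R.
Proof.
rewrite /wt big_ord_recl bin0 mul1r big1 ?addr0// => p _.
by rewrite lift0 addn0 subn1 /= bin_small// mul0r.
Qed.

Lemma wt_nil m : wt m [::] = 1.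
Proof. by rewrite /wt big_ord1 /= bin0 mulr1. Qed.

(** The identity (1 - f) (1 - f)^(-m-1) = (1 - f)^(-m). *)
Lemma wt_recur m b : wt m.+1 b = wt m b + conv f (wt m.+1) b.
Proof.
have -> : conv f (wt m.+1) b =
    \sum_(p < (size b).+1) 'C(p + m, p)%:R * fpow p.+1 b.
  rewrite /conv; transitivity (\sum_(s < (size b).+1) \sum_(p < (size b).+1)
      'C(p + m, p)%:R * (f (take s b) * fpow p (drop s b))).
    apply: eq_bigr => s _; rewrite (@wt_widen _ _ (size b).+1); last first.
      by rewrite size_drop ltnS leq_subr.
    rewrite mulr_sumr; apply: eq_bigr => p _.
    by rewrite addnS subn1 /= mulrCA.
  by rewrite exchange_big /=; apply: eq_bigr => p _; rewrite -mulr_sumr.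
rewrite big_ord_recr /= -/(fpow (size b).+1) (@fpow_short (size b).+1)// mulr0 addr0.
rewrite /wt !big_ord_recl !bin0 -addrA; congr (_ + _); rewrite -big_split /=.
apply: eq_bigr => p _; rewrite /bump leq0n !add1n /= add0n -mulrDl -natrD; congr (_%:R * _).
by rewrite !addSn !subn1 /= addnS binS.
Qed.

Hypothesis f_ge0 : forall b, 0 <= f b.

Lemma fpow_ge0 p b : 0 <= fpow p b.
Proof.
elim: p b => [|p IH] b /=; first by rewrite ler0n.
by apply: sumr_ge0 => s _; rewrite mulr_ge0.
Qed.

Lemma wt_ge0 m b : 0 <= wt m b.
Proof. by apply: sumr_ge0 => p _; rewrite mulr_ge0// fpow_ge0. Qed.

Hypothesis f_letter : forall j, 0 < f [:: j].

Lemma wt_gt0 m b : (0 < m)%N -> 0 < wt m b.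
Proof.
case: m => [//|m] _; elim: b => [|j b IH]; first by rewrite wt_nil.
rewrite wt_recur ltr_wpDl ?wt_ge0//.
have h1 : (1 < (size (j :: b)).+1)%N by [].
rewrite /conv (bigD1 (Ordinal h1))//= take0 drop0 ltr_wpDr//.
  by apply: sumr_ge0 => s _; rewrite mulr_ge0// wt_ge0.
by rewrite mulr_gt0.
Qed.

End Words.

(** * Sums over words and the maps Phi *)

Section Esum.
Variable R : realType.

Lemma esumZ (C : countType) (c : R) (a : C -> R) : 0 <= c -> (forall i, 0 <= a i) ->
  (\esum_(i in [set: C]) (c * a i)%:E = c%:E * \esum_(i in [set: C]) (a i)%:E)%E.
Proof.
move=> c0 a0; rewrite -(esum_pickle (fun i => (c * a i)%:E)) -(esum_pickle (fun i => (a i)%:E)).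
rewrite -nneseries_esumT; last by move=> n; case: pickle_inv => // i; rewrite lee_fin mulr_ge0.
rewrite -nneseries_esumT; last by move=> n; case: pickle_inv => // i; rewrite lee_fin.
rewrite -nneseriesZl//; last by move=> n _; case: pickle_inv => // i; rewrite lee_fin.
by apply: eq_eseriesr => n _; case: pickle_inv => [i|]; rewrite ?EFinM ?mule0.
Qed.

Lemma esum_finType (T : finType) (a : T -> R) : (forall i, 0 <= a i) ->
  (\esum_(i in [set: T]) (a i)%:E = (\sum_i a i)%:E)%E.
Proof.
move=> a0; rewrite esum_fset; [|exact: finite_finset|by move=> i _; rewrite lee_fin].
have -> : [set: T] = [set` enum T] by apply/seteqP; split=> i //= _; rewrite mem_enum.
by rewrite -fsbig_seq ?enum_uniq// big_enum /= sumEFin.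
Qed.

Lemma esum_tuples d (a : seq 'I_d -> R) p : (forall w, 0 <= a w) ->
  (\esum_(w in [set w : seq 'I_d | size w = p]) (a w)%:E = (\sum_(w : p.-tuple 'I_d) a w)%:E)%E.
Proof.
move=> a0; rewrite -esum_finType//; apply: (@reindex_esum _ _ _ _ _ (@tval p 'I_d)).
split.
- by move=> w _ /=; rewrite size_tuple.
- by move=> w w' _ _; exact: val_inj.
- by move=> w /= /eqP sw; exists (Tuple sw).
Qed.

Lemma esum_words_by_length d (a : seq 'I_d -> R) : (forall w, 0 <= a w) ->
  (\esum_(w in [set: seq 'I_d]) (a w)%:E =
   \esum_(p in [set: nat]) (\sum_(w : p.-tuple 'I_d) a w)%:E)%E.
Proof.
move=> a0; rewrite [RHS](eq_esum (b := fun p =>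
    \esum_(w in [set w : seq 'I_d | size w = p]) (a w)%:E)%E); last first.
  by move=> p _; rewrite esum_tuples.
rewrite esum_esum; last by move=> *; rewrite lee_fin.
have B : set_bij [set: seq 'I_d] ([set: nat] `*`` (fun p => [set w : seq 'I_d | size w = p]))
    (fun w => (size w, w)).
  split=> [w _ //|w w' _ _ [] //|[p w] [_ /= <-]]; by exists w.
by rewrite (reindex_esum _ _ _ _ B).
Qed.

(** Every way of writing w as u ++ v is a choice of a place where w is cut. *)
Lemma esum_conv d (f g q : seq 'I_d -> R) :
  (forall w, 0 <= f w) -> (forall w, 0 <= g w) -> (forall w, 0 <= q w) ->
  (\esum_(u in [set: seq 'I_d]) \esum_(v in [set: seq 'I_d]) (f u * g v * q (u ++ v))%:E =
   \esum_(w in [set: seq 'I_d]) (conv f g w * q w)%:E)%E.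
Proof.
move=> f0 g0 q0.
rewrite esum_esum; last by move=> *; rewrite lee_fin !mulr_ge0.
rewrite [RHS](eq_esum (b := fun w => \esum_(s in [set s | (s < (size w).+1)%N])
    (f (take s w) * g (drop s w) * q w)%:E)%E); last first.
  move=> w _; rewrite /conv mulr_suml -(@esum_finType 'I_(size w).+1); last by move=> s; rewrite !mulr_ge0.
  have B : set_bij [set: 'I_(size w).+1] [set s | (s < (size w).+1)%N] (@nat_of_ord (size w).+1).
    by split=> [s _ /=|s s' _ _ /val_inj|s /= hs]; [exact: ltn_ord| |exists (Ordinal hs)].
  by rewrite (reindex_esum _ _ _ _ B).
rewrite esum_esum; last by move=> *; rewrite lee_fin !mulr_ge0.
have B : set_bij ([set: seq 'I_d] `*`` (fun=> [set: seq 'I_d]))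
    ([set: seq 'I_d] `*`` (fun w => [set s | (s < (size w).+1)%N]))
    (fun k => (k.1 ++ k.2, size k.1)).
  split=> [[u v] _|[u v] [u' v'] _ _ /= []|[w s] [_ /= hs]].
  - by split=> //=; rewrite size_cat ltnS leq_addr.
  - move=> E S; have : take (size u) (u ++ v) = take (size u') (u' ++ v') by rewrite E S.
    have : drop (size u) (u ++ v) = drop (size u') (u' ++ v') by rewrite E S.
    by rewrite !take_size_cat// !drop_size_cat// => -> ->.
  - by exists (take s w, drop s w); rewrite //= cat_take_drop size_takel.
rewrite (reindex_esum _ _ _ _ B); apply: eq_esum => -[u v] _ /=.
by rewrite take_size_cat// drop_size_cat.
Qed.

Lemma esum_exchange (C D : choiceType) (a : C -> D -> R) : (forall c d, 0 <= a c d) ->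
  (\esum_(c in [set: C]) \esum_(d in [set: D]) (a c d)%:E =
   \esum_(d in [set: D]) \esum_(c in [set: C]) (a c d)%:E)%E.
Proof.
move=> a0; rewrite !esum_esum; try by move=> *; rewrite lee_fin.
have B : set_bij ([set: D] `*`` (fun=> [set: C])) ([set: C] `*`` (fun=> [set: D])) (fun z => (z.2, z.1)).
  by split=> [//|[a' b] [c d] _ _ [-> ->]//|[a' b] _]; exists (b, a').
by rewrite (reindex_esum _ _ _ _ B).
Qed.

End Esum.

Unset Implicit Arguments.

Section PhiTheory.
Variables (R : realType) (k : nat) (n : 'I_k -> nat) (f : forall i, seq 'I_(n i) -> R).
Variables (H : hilbertType R) (X : forall i, 'I_(n i) -> bop H H).
Implicit Types (Y Z : bop H H) (i : 'I_k) (x y : H).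

Lemma word_op_cat d (Q : 'I_d -> bop H H) u v :
  word_op Q (u ++ v) = word_op Q u \*b word_op Q v.
Proof. by elim: u => [|j u IH] /=; rewrite ?bop1M// IH bopMA. Qed.

(* The p-th homogeneous component of the series defining Phi, starting at p = 0. *)
Definition Phi_comp i Y p : bop H H := \sum_(w : p.-tuple 'I_(n i))
    (f i w)%:C *: (word_op (X i) w \*b Y \*b adj (word_op (X i) w)).

Lemma hdot_Phi_comp i Y p x y : '[Phi_comp i Y p x, y] = \sum_(w : p.-tuple 'I_(n i))
  (f i w)%:C * '[Y (adj (word_op (X i) w) x), adj (word_op (X i) w) y].
Proof.
rewrite bop_sum hdot_suml; apply: eq_bigr => w _.
by rewrite bopZ hdotZl !bopM adjP.
Qed.

Lemma quad_Phi_comp i Y p x : quad (Phi_comp i Y p) x = \sum_(w : p.-tuple 'I_(n i))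
  f i w * quad Y (adj (word_op (X i) w) x).
Proof.
rewrite /quad /rip hdot_Phi_comp Re_sum; apply: eq_bigr => w _.
by rewrite cReM /= mul0r subr0.
Qed.

Lemma Phi_sumE i Y N : Phi_sum f X i Y N = series (fun p => Phi_comp i Y p.+1) N.
Proof. by rewrite /Phi_sum big_add1. Qed.

Lemma hdot_series x y (A : nat -> bop H H) N :
  '[series A N x, y] = series (fun p => '[A p x, y]) N.
Proof. by rewrite /series /= bop_sum hdot_suml. Qed.

Lemma rip_series x y (A : nat -> bop H H) N :
  rip (series A N x) y = series (fun p => rip (A p x) y) N.
Proof. by rewrite /rip hdot_series Re_series. Qed.

Hypothesis f_ge0 : forall i w, 0 <= f i w.

Lemma Phi_comp_psd i Y p : psd Y -> psd (Phi_comp i Y p).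
Proof.
move=> pY; rewrite /Phi_comp; elim/big_ind : _ => [|A B|w _]; [exact: psd0|exact: psdD|].
by apply: psdZ => //; exact: psd_conj.
Qed.

(** Boundedness of the partial sums at the identity makes the defining series of
    Phi converge weakly at every operator, by domination. *)
Lemma Phi_definedP i (C : R) :
  (forall N x, quad (Phi_sum f X i (bop_id H) N) x <= C * nm x ^+ 2) ->
  Phi_defined f X i.
Proof.
move=> hC Y; have [M M0 hM] := bop_bound Y.
pose h x p := quad (Phi_comp i (bop_id H) p.+1) x.
have h0 x p : 0 <= h x p by apply: psd_quad; apply: Phi_comp_psd; exact: psd1.
have hs x : exists2 s : R, series (h x) @ \oo --> s & s <= C * nm x ^+ 2.
  apply: series_bounded_cvg => // N; rewrite -rip_series -Phi_sumE; exact: hC.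
pose z x y p := '[Phi_comp i Y p.+1 x, y].
have zh x y p : cabs (z x y p) <= M * (h x p + h y p).
  rewrite /z hdot_Phi_comp /h !quad_Phi_comp -big_split /= mulr_sumr.
  rewrite (@le_trans _ _ (\sum_(w : p.+1.-tuple 'I_(n i)) cabs ((f i w)%:C * '[Y (adj (word_op (X i) w) x), adj (word_op (X i) w) y])))//.
    elim/big_ind2 : _ => [|a a' b b' h1 h2|//]; first by rewrite cabs0.
    by rewrite (le_trans (ler_cabsD _ _))// lerD.
  apply: ler_sum => w _; rewrite cabsM cabs_real ger0_norm// -mulrDr mulrCA ler_wpM2l//.
  by rewrite !quad1; exact: hdot_bop_le.
have zc x y : (series (z x y) : nat -> R[i]^o) @ \oo --> (csum (z x y) : R[i]^o) /\
    cabs (csum (z x y)) <= 2 * M * C * (nm x ^+ 2 + nm y ^+ 2).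
  have [s hs1 hs2] := hs x; have [t ht1 ht2] := hs y.
  have [h1 _ _ h2] := dominated_csum (zh x y) (seriesZc (c := M) (seriesDc hs1 ht1)).
  split=> //; rewrite (le_trans h2)// -!mulrA ler_wpM2l// ler_wpM2l// mulrDr lerD//.
have [Z hZ] : exists Z : bop H H, forall x y, '[Z x, y] = csum (z x y).
  apply: (@sesquilinear_bop _ _ _ _ (2 * M * C)).
  - move=> c x1 x2 y; apply: csum_eq; rewrite [X in X @ _](_ : _ = fun N => c * series (z x1 y) N + series (z x2 y) N).
      by apply: cvgc_lin; [exact: (zc x1 y).1|exact: (zc x2 y).1].
    apply/funext => N; rewrite /series /= mulr_sumr -big_split /=; apply: eq_bigr => p _.
    by rewrite /z linearP hdotDl hdotZl.
  - move=> c x y1 y2; apply: csum_eq; rewrite [X in X @ _](_ : _ = fun N => Num.conj c * series (z x y1) N + series (z x y2) N).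
      by apply: cvgc_lin; [exact: (zc x y1).1|exact: (zc x y2).1].
    apply/funext => N; rewrite /series /= mulr_sumr -big_split /=; apply: eq_bigr => p _.
    by rewrite /z hdotDr hdotZr.
  - by move=> x y; exact: (zc x y).2.
exists Z => x y; rewrite hZ; under eq_fun do rewrite Phi_sumE hdot_series.
exact: (zc x y).1.
Qed.

Hypothesis Phi_def : forall i, Phi_defined f X i.

Lemma Phi_cvg i Y : wot_cvg \oo (Phi_sum f X i Y) (Phi f X i Y).
Proof. by have [Z hZ] := Phi_def i Y; apply: (xgetPex _ (ex_intro _ Z hZ)). Qed.

Lemma Phi_uniq i Y Z : wot_cvg \oo (Phi_sum f X i Y) Z -> Phi f X i Y = Z.
Proof. by move=> h; exact: wot_uniq (Phi_cvg i Y) h. Qed.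

Lemma Phi_sumD i Y Z N : Phi_sum f X i (Y + Z) N = Phi_sum f X i Y N + Phi_sum f X i Z N.
Proof.
rewrite /Phi_sum -big_split /=; apply: eq_bigr => p _; rewrite -big_split /=.
apply: eq_bigr => w _; apply: bop_eq => x.
by rewrite bopD !bopZ !bopM bopD linearD scalerDr.
Qed.

Lemma Phi_sumN i Y N : Phi_sum f X i (- Y) N = - Phi_sum f X i Y N.
Proof.
rewrite /Phi_sum -sumrN; apply: eq_bigr => p _; rewrite -sumrN.
apply: eq_bigr => w _; apply: bop_eq => x.
by rewrite bopN !bopZ !bopM bopN linearN scalerN.
Qed.

Lemma PhiB i Y Z : Phi f X i (Y - Z) = Phi f X i Y - Phi f X i Z.
Proof.
apply: Phi_uniq.
rewrite (_ : Phi_sum f X i (Y - Z) = fun t => Phi_sum f X i Y t - Phi_sum f X i Z t).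
  by apply: wotB; exact: Phi_cvg.
by apply/funext => N; rewrite Phi_sumD Phi_sumN.
Qed.

Lemma Phi0 i : Phi f X i 0 = 0.
Proof. by have := PhiB i 0 0; rewrite !subrr. Qed.

Lemma PhiZ i (r : R) Y : Phi f X i (r%:C *: Y) = r%:C *: Phi f X i Y.
Proof.
have E N : Phi_sum f X i (r%:C *: Y) N = r%:C *: Phi_sum f X i Y N.
  rewrite /Phi_sum [RHS]scaler_sumr; apply: eq_bigr => p _; rewrite [RHS]scaler_sumr.
  apply: eq_bigr => w _; apply: bop_eq => z.
  by rewrite !bopZ !bopM bopZ linearZ scalerA mulrC -scalerA.
apply: Phi_uniq; apply/wotP => x y; rewrite bopZ ripZl.
rewrite (_ : (fun _ => _) = fun N => r * rip (Phi_sum f X i Y N x) y).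
  by apply: cvgM; [exact: cvg_cst|have /wotP := Phi_cvg i Y].
by apply/funext => N; rewrite -ripZl -bopZ E.
Qed.

Lemma iter_PhiZ i (r : R) Y q :
  iter q (Phi f X i) (r%:C *: Y) = r%:C *: iter q (Phi f X i) Y.
Proof. by elim: q => [//|q IH] /=; rewrite IH PhiZ. Qed.

Lemma Phi_psd i Y : psd Y -> psd (Phi f X i Y).
Proof.
move=> pY; apply: wot_psd (Phi_cvg i Y) => N.
rewrite Phi_sumE /series /=; elim/big_ind : _ => [|A B|p _]; [exact: psd0|exact: psdD|].
exact: Phi_comp_psd.
Qed.

Lemma iter_Phi_psd i Y q : psd Y -> psd (iter q (Phi f X i) Y).
Proof. by move=> pY; elim: q => [//|q IH]; apply: Phi_psd. Qed.

Lemma iter_PhiB i Y Z q :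
  iter q (Phi f X i) (Y - Z) = iter q (Phi f X i) Y - iter q (Phi f X i) Z.
Proof. by elim: q => [//|q IH] /=; rewrite IH PhiB. Qed.

Hypothesis f_nil : forall i, f i [::] = 0.

(** Positivity turns the weakly convergent series into an unconditional sum over words. *)
Lemma quad_Phi i Y x : psd Y ->
  ((quad (Phi f X i Y) x)%:E =
   \esum_(w in [set: seq 'I_(n i)]) (f i w * quad Y (adj (word_op (X i) w) x))%:E)%E.
Proof.
move=> pY; have q0 w : 0 <= f i w * quad Y (adj (word_op (X i) w) x).
  by rewrite mulr_ge0// psd_quad.
rewrite esum_words_by_length//; symmetry; apply/series_esum.
  by move=> p; apply: sumr_ge0.
rewrite -cvg_shiftS; have /wotP /(_ x x) := Phi_cvg i Y.
suff -> : (fun N => rip (Phi_sum f X i Y N x) x) = [sequence series (fun p =>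
   \sum_(w : p.-tuple 'I_(n i)) f i w * quad Y (adj (word_op (X i) w) x)) N.+1]_N by [].
apply/funext => N; rewrite Phi_sumE rip_series /series /= big_nat_recl//=.
rewrite [X in X + _]big1 ?add0r; last by move=> w _; rewrite tuple0 f_nil mul0r.
by apply: eq_bigr => p _; rewrite -quad_Phi_comp.
Qed.

Lemma quad_iter_Phi i Y x q : psd Y ->
  ((quad (iter q (Phi f X i) Y) x)%:E =
   \esum_(w in [set: seq 'I_(n i)]) (fpow (f i) q w * quad Y (adj (word_op (X i) w) x))%:E)%E.
Proof.
move=> pY; have fp0 p w : 0 <= fpow (f i) p w by exact: fpow_ge0.
elim: q x => [|q IH] x.
  rewrite /= (esumID [set [::]])// ?setTI; last by move=> w _; rewrite lee_fin mulr_ge0 ?ler0n ?psd_quad.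
  rewrite esum_set1 ?lee_fin ?mulr_ge0 ?psd_quad// eqxx mul1r /= adj1 bop1.
  by rewrite esum1 ?adde0// => w /= /eqP/negbTE ->; rewrite mul0r.
rewrite iterS quad_Phi; last exact: iter_Phi_psd.
rewrite -(@esum_conv _ _ (f i) (fpow (f i) q) (fun w => quad Y (adj (word_op (X i) w) x)))//; last first.
  by move=> w; exact: psd_quad.
apply: eq_esum => u _; rewrite EFinM IH -esumZ//; last by move=> w; rewrite mulr_ge0// psd_quad.
apply: eq_esum => v _; rewrite mulrA; congr ((_ * _)%:E).
by rewrite word_op_cat adjM.
Qed.

End PhiTheory.

Set Implicit Arguments.

Set Implicit Arguments.

(** * Positivity and purity in the polydomain *)

Section CommutingMaps.
Variables (V : zmodType) (C : V -> Prop).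
Implicit Types F G : V -> V.

Definition preserves G := forall x, C x -> C (G x).
Definition additive_map G := forall x y, G (x - y) = G x - G y.
Definition commutes F G := forall x, C x -> F (G x) = G (F x).

Lemma commutes_sym F G : commutes F G -> commutes G F.
Proof. by move=> h x Cx; rewrite h. Qed.

Lemma commutes_sub F G G' : additive_map F -> commutes F G -> commutes F G' ->
  commutes F (fun x => G x - G' x).
Proof. by move=> aF h h' x Cx; rewrite aF h// h'. Qed.

Lemma additive_mapD F : additive_map F -> forall x y, F (x + y) = F x + F y.
Proof.
move=> aF; have F0 : F 0 = 0 by have := aF 0 0; rewrite !subrr.
have FN x : F (- x) = - F x by rewrite -[- x]sub0r aF F0 sub0r.
by move=> x y; rewrite -[in LHS](opprK y) aF FN opprK.
Qed.

Lemma commutes_iter F G q : preserves G -> commutes F G -> commutes F (iter q G).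
Proof.
move=> pG h; have pq p : preserves (iter p G).
  by elim: p => [//|p IH] x Cx /=; apply: pG; exact: IH.
by elim: q => [//|q IH] x Cx /=; rewrite h ?IH//; exact: pq.
Qed.

Lemma foldr_rem (I : eqType) (G : I -> V -> V) (s : seq I) i x :
  (forall j, preserves (G j)) -> (forall j l, commutes (G j) (G l)) ->
  C x -> i \in s -> foldr G x s = G i (foldr G x (rem i s)).
Proof.
move=> pG cG Cx; elim: s => [//|j s IH]; rewrite inE /=.
have [->//|ji] := eqVneq i j.
rewrite /= => si; rewrite IH//; apply: cG.
by elim: (rem i s) => [//|l r IHr] /=; apply: pG.
Qed.

Lemma foldr_perm (I : eqType) (G : I -> V -> V) (s1 s2 : seq I) x :
  (forall j, preserves (G j)) -> (forall j l, commutes (G j) (G l)) ->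
  C x -> perm_eq s1 s2 -> foldr G x s1 = foldr G x s2.
Proof.
move=> pG cG Cx; elim: s1 s2 => [|i s1 IH] s2.
  by move=> /perm_size /esym /size0nil ->.
move=> p12; have i2 : i \in s2 by rewrite -(perm_mem p12) mem_head.
rewrite (@foldr_rem _ _ s2 i)//=; congr (G i _); apply: IH.
by rewrite -(perm_cons i) (perm_trans p12)// perm_to_rem.
Qed.

End CommutingMaps.

(** The limit of the purity condition is along a proper filter, so that it is unique. *)
Lemma multi_index_filter k : ProperFilter (filter_from setT
  (fun q0 => [set q : 'I_k -> nat | forall i, (q0 i <= q i)%N])).
Proof.
apply: filter_from_proper => [|q0 _]; last by exists q0 => /=.
apply: filter_from_filter; first by exists (fun=> 0%N).
move=> p q _ _; exists (fun i => maxn (p i) (q i)) => // r /= hr; split=> i /=.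
  by rewrite (leq_trans _ (hr i))// leq_maxl.
by rewrite (leq_trans _ (hr i))// leq_maxr.
Qed.

Section IteratedDifferences.
Variable R : realType.

Lemma sum_bin p s : (\sum_(j < s.+1) 'C(j + p - 1, j) = 'C(s + p, s))%N.
Proof.
elim: s => [|s IH]; first by rewrite big_ord1 !bin0.
by rewrite big_ord_recr /= IH !addSn subn1 /= binS addnC.
Qed.

(** If a (p+1) is the sequence of decrements of a p, all terms are nonnegative and
    a 0 tends to 0, then a 0 0 is recovered from a m by m summations, which gather
    into one sum with binomial weights. *)
Lemma esum_iterated_differences (a : nat -> nat -> R) m :
  (forall p j, (p <= m)%N -> 0 <= a p j) ->
  (forall p j, (p < m)%N -> a p j - a p j.+1 = a p.+1 j) ->
  a 0%N @ \oo --> (0 : R) ->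
  forall p, (p <= m)%N ->
  (\esum_(j in [set: nat]) ('C(j + p - 1, j)%:R * a p j)%:E = (a 0%N 0%N)%:E)%E.
Proof.
move=> a0 da a00.
have tele p j N : (p < m)%N -> series (fun l => a p.+1 (j + l)%N) N = a p j - a p (j + N)%N.
  move=> pm; elim: N => [|N IH]; first by rewrite series0 addn0 subrr.
  by rewrite seriesS IH -da// addnS addrA subrK.
have ap0 p : (p < m)%N -> a p @ \oo --> (0 : R).
  case: p => [//|p] pm; have pm' := ltnW pm.
  apply: (@cvg_series_cvg_0 _ R).
  have [|N|s hs _] := @series_bounded_cvg _ (a p.+1) (a p 0%N).
  - by move=> j; apply: a0; exact: ltnW.
  - have := tele p 0%N N pm'; rewrite (_ : (fun l => a p.+1 (0 + l)%N) = a p.+1)// => ->.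
    by rewrite gerBl a0// ltnW.
  - exact: cvgP hs.
have sum_tail p j : (p < m)%N -> (\esum_(l in [set: nat]) (a p.+1 (j + l)%N)%:E = (a p j)%:E)%E.
  move=> pm; apply/series_esum; first by move=> l; exact: a0.
  rewrite (_ : series _ = fun N => a p j - a p (j + N)%N); last by apply/funext => N; exact: tele.
  rewrite -[X in _ --> X]subr0; apply: cvgB; first exact: cvg_cst.
  have := ap0 p pm; rewrite -(cvg_shiftn j) => h.
  rewrite (_ : (fun N => a p (j + N)%N) = (fun N => a p (N + j)%N)) //.
  by apply/funext => N; rewrite addnC.
elim=> [|p IH] pm.
  rewrite (esumID [set 0%N])// ?setTI; last first.
    by move=> j _; rewrite lee_fin mulr_ge0// a0.
  rewrite esum_set1 ?lee_fin ?mulr_ge0 ?a0// bin0 mul1r esum1 ?adde0// => -[|j] j0; first by have := j0 erefl.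
  by rewrite addn0 subn1 /= bin_small// mul0r.
rewrite -IH ?(ltnW pm)//.
rewrite [RHS](eq_esum (b := fun j => \esum_(l in [set: nat])
    ('C(j + p - 1, j)%:R * a p.+1 (j + l)%N)%:E)%E); last first.
  by move=> j _; rewrite esumZ ?EFinM ?sum_tail// => l; exact: a0.
rewrite esum_esum; last by move=> *; rewrite lee_fin mulr_ge0// a0.
rewrite [LHS](eq_esum (b := fun s => \esum_(j in [set j | (j < s.+1)%N])
    ('C(j + p - 1, j)%:R * a p.+1 s)%:E)%E); last first.
  move=> s _; have B : set_bij [set: 'I_s.+1] [set j | (j < s.+1)%N] (@nat_of_ord s.+1).
    by split=> [j _ /=|j j' _ _ /val_inj|j /= hj]; [exact: ltn_ord| |exists (Ordinal hj)].
  rewrite (reindex_esum _ _ _ _ B) (@esum_finType _ 'I_s.+1 (fun j => 'C(j + p - 1, j)%:R * a p.+1 s)).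
    rewrite -mulr_suml -natr_sum sum_bin; congr ((_%:R * _)%:E); congr 'C(_, _); lia.
  by move=> j; rewrite mulr_ge0// a0.
rewrite esum_esum; last by move=> *; rewrite lee_fin mulr_ge0// a0.
have B : set_bij ([set: nat] `*`` (fun=> [set: nat]))
    ([set: nat] `*`` (fun s => [set j | (j < s.+1)%N])) (fun u => ((u.1 + u.2)%N, u.1)).
  split=> [[j l] _|[j l] [j' l'] _ _ /= [] + E|[s j] [_ /= hj]].
  - by split=> //=; rewrite ltnS leq_addr.
  - by rewrite E => /addnI ->.
  - by exists (j, (s - j)%N) => //=; rewrite subnKC.
rewrite (reindex_esum _ _ _ _ B); exact: eq_esum.
Qed.

End IteratedDifferences.

(** The multi-indices are given as a countable type so that sums over them can be taken
    along its enumeration. *)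
Definition multiword k (n : 'I_k -> nat) : countType := {dffun forall i : 'I_k, seq 'I_(n i)}.

Unset Implicit Arguments.

Section Polydomain.
Variables (R : realType) (k : nat) (n m : 'I_k -> nat) (f : forall i, seq 'I_(n i) -> R).
Hypothesis f_ge0 : forall i w, 0 <= f i w.
Hypothesis f_nil : forall i, f i [::] = 0.
Hypothesis m_gt0 : forall i, (0 < m i)%N.
Variables (H : hilbertType R) (X : forall i, 'I_(n i) -> bop H H).
Implicit Types (Y Z : bop H H) (i : 'I_k) (x y : H).

Definition entries_commute :=
  forall s t j l, s != t -> X s j \*b X t l = X t l \*b X s j.

Lemma word_op_commute s t u v : entries_commute -> s != t ->
  word_op (X s) u \*b word_op (X t) v = word_op (X t) v \*b word_op (X s) u.
Proof.
move=> XC st; have h j v' : X s j \*b word_op (X t) v' = word_op (X t) v' \*b X s j.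
  elim: v' => [|l v' IH] /=; first by rewrite bopM1 bop1M.
  by rewrite bopMA XC// -bopMA IH bopMA.
elim: u => [|j u IH] /=; first by rewrite bopM1 bop1M.
by rewrite -bopMA IH bopMA h bopMA.
Qed.

(** The monomial truncated to the coordinates in s, for inductions over the coordinates. *)
Definition word_prod s (b : forall i, seq 'I_(n i)) : bop H H :=
  foldr (fun i A => word_op (X i) (b i) \*b A) (bop_id H) s.

Lemma word_prod_commute s b i w : entries_commute -> i \notin s ->
  word_prod s b \*b word_op (X i) w = word_op (X i) w \*b word_prod s b.
Proof.
move=> XC; elim: s => [|j s IH] /=; first by rewrite bopM1 bop1M.
rewrite inE negb_or => /andP[ij si]; rewrite -bopMA IH// !bopMA.
by rewrite (word_op_commute j i)// eq_sym.
Qed.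

Lemma eq_word_prod s (b b' : forall i, seq 'I_(n i)) :
  (forall i, i \in s -> b i = b' i) -> word_prod s b = word_prod s b'.
Proof.
elim: s => [//|j s IH] h /=; rewrite h ?mem_head// IH// => l ls.
by rewrite h// inE ls orbT.
Qed.

Lemma mword_op_cat a b : entries_commute ->
  mword_op X (fun i => a i ++ b i) = mword_op X a \*b mword_op X b.
Proof.
move=> XC; rewrite /mword_op -!/(word_prod _ _); have := enum_uniq 'I_k.
elim: (enum _) => [|i s IH] /=; first by rewrite bop1M.
move=> /andP[si us]; rewrite IH// word_op_cat -!bopMA; congr (_ \*b _).
by rewrite !bopMA word_prod_commute.
Qed.

Definition single i w : forall j, seq 'I_(n j) := dfwith (fun=> [::]) i w.

Lemma mword_op_single i w : mword_op X (single i w) = word_op (X i) w.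
Proof.
have nil0 s : i \notin s -> word_prod s (single i w) = bop_id H.
  elim: s => [//|j s IH]; rewrite inE negb_or => /andP[ij si] /=.
  by rewrite IH// /single dfwithout// bop1M.
rewrite /mword_op -/(word_prod _ _); have := enum_uniq 'I_k; have := mem_enum 'I_k i.
elim: (enum _) => [//|j s IH] /=; rewrite inE.
have [<- _ /andP[js _]|ij /= hs /andP[_ us]] := eqVneq i j.
  by rewrite nil0// bopM1 /single dfwithin.
by rewrite IH// /single dfwithout// bop1M.
Qed.

Hypothesis X_pd : polydomain f m X.

Let XC : entries_commute. Proof. by case: X_pd. Qed.
Let Phi_def i : Phi_defined f X i. Proof. by case: X_pd. Qed.

(** The commutation of the maps Phi is proved at positive operators, by Fubini, and then
    holds at their differences, which these maps preserve. *)
Definition psd_difference Y := exists A B, [/\ psd A, psd B & Y = A - B].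

Lemma psd_psd_difference Y : psd Y -> psd_difference Y.
Proof. by move=> pY; exists Y, 0; split=> //; [exact: psd0|rewrite subr0]. Qed.

Lemma psd_differenceB Y Z : psd_difference Y -> psd_difference Z -> psd_difference (Y - Z).
Proof.
move=> [A [B [pA pB ->]]] [A' [B' [pA' pB' ->]]]; exists (A + B'), (B + A').
by split; [exact: psdD|exact: psdD|rewrite opprB opprD addrACA].
Qed.

Lemma Phi_preserves i : preserves psd_difference (Phi f X i).
Proof.
move=> _ [A [B [pA pB ->]]]; exists (Phi f X i A), (Phi f X i B).
by split; [apply: Phi_psd|apply: Phi_psd|apply: PhiB].
Qed.

(** Fubini for the double sums over words representing Phi_i Phi_j and Phi_j Phi_i. *)
Lemma Phi_commutes i j : commutes psd_difference (Phi f X i) (Phi f X j).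
Proof.
have [->//|ij] := eqVneq i j.
have key Y : psd Y -> Phi f X i (Phi f X j Y) = Phi f X j (Phi f X i Y).
  move=> pY; apply: herm_eq; try by apply: psd_herm; do 2 apply: Phi_psd => //.
  move=> x; apply: EFin_inj.
  have E i' j' : ((quad (Phi f X i' (Phi f X j' Y)) x)%:E = \esum_(w in [set: seq 'I_(n i')])
     \esum_(v in [set: seq 'I_(n j')]) (f i' w * (f j' v * quad Y (adj (word_op (X j') v) (adj (word_op (X i') w) x))))%:E)%E.
    rewrite quad_Phi//; last exact: Phi_psd.
    apply: eq_esum => w _; rewrite EFinM quad_Phi// -esumZ// => v; by rewrite mulr_ge0// psd_quad.
  rewrite !E esum_esum; last by move=> *; rewrite lee_fin !mulr_ge0// psd_quad.
  rewrite esum_esum; last by move=> *; rewrite lee_fin !mulr_ge0// psd_quad.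
  have B : set_bij ([set: seq 'I_(n j)] `*`` (fun=> [set: seq 'I_(n i)]))
      ([set: seq 'I_(n i)] `*`` (fun=> [set: seq 'I_(n j)])) (fun u => (u.2, u.1)).
    by split=> [//|[a b] [c d] _ _ [-> ->]//|[a b] _]; exists (b, a).
  rewrite (reindex_esum _ _ _ _ B); apply: eq_esum => -[v w] _ /=.
  by rewrite mulrCA -!bopM -!adjM word_op_commute.
by move=> _ [A [B [pA pB ->]]]; rewrite !PhiB// !key.
Qed.

Definition defect i Y := Y - Phi f X i Y.
Definition powdefect (q : 'I_k -> nat) i Y := Y - iter (q i) (Phi f X i) Y.
Fixpoint geom i q Y : bop H H :=
  if q is p.+1 then geom i p Y + iter p (Phi f X i) Y else 0.

Lemma Phi_additive i : additive_map (Phi f X i).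
Proof. by move=> Y Z; apply: PhiB. Qed.

Lemma iter_Phi_preserves i q : preserves psd_difference (iter q (Phi f X i)).
Proof. by elim: q => [//|q IH] Y CY; apply: Phi_preserves; exact: IH. Qed.

Lemma defect_preserves i : preserves psd_difference (defect i).
Proof. by move=> Y CY; apply: psd_differenceB => //; exact: Phi_preserves. Qed.

Lemma powdefect_preserves q i : preserves psd_difference (powdefect q i).
Proof. by move=> Y CY; apply: psd_differenceB => //; exact: iter_Phi_preserves. Qed.

Lemma geom_psd i q Y : psd Y -> psd (geom i q Y).
Proof.
move=> pY; elim: q => [|q IH] /=; first exact: psd0.
by apply: psdD => //; apply: iter_Phi_psd.
Qed.

Lemma defect_additive i : additive_map (defect i).
Proof. by move=> Y Z; rewrite /defect Phi_additive !opprD addrACA opprK. Qed.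

Lemma powdefect_additive q i : additive_map (powdefect q i).
Proof. by move=> Y Z; rewrite /powdefect iter_PhiB// !opprD addrACA opprK. Qed.

Lemma powdefect_commutes q i j : commutes psd_difference (powdefect q i) (powdefect q j).
Proof.
have h i' j' : commutes psd_difference (Phi f X i') (powdefect q j').
  apply: commutes_sub => //; first exact: Phi_additive.
  apply: commutes_iter; [exact: Phi_preserves|exact: Phi_commutes].
apply: commutes_sub => //; first exact: powdefect_additive.
apply: commutes_iter; [exact: Phi_preserves|apply: commutes_sym; exact: h].
Qed.

Lemma defect_commutes i j : commutes psd_difference (defect i) (defect j).
Proof. exact: (powdefect_commutes (fun=> 1%N) i j). Qed.

Lemma geom_commutes i j q : commutes psd_difference (defect i) (geom j q).
Proof.
have h p : commutes psd_difference (defect i) (iter p (Phi f X j)).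
  apply: commutes_sym; apply: commutes_sub => //.
    by move=> Y Z; rewrite iter_PhiB.
  by apply: commutes_sym; apply: commutes_iter; [exact: Phi_preserves|exact: Phi_commutes].
elim: q => [|q IH] Y CY /=.
  by rewrite /defect (Phi0 _ _ n f H X Phi_def) subrr.
by rewrite (additive_mapD (defect_additive i)) IH// h.
Qed.

Lemma defect_geom i q Y : defect i (geom i q Y) = Y - iter q (Phi f X i) Y.
Proof.
elim: q => [|q IH] /=; first by rewrite /defect (Phi0 _ _ n f H X Phi_def) !subrr.
by rewrite (additive_mapD (defect_additive i)) IH /defect addrA subrK.
Qed.

Lemma foldr_preserves (G : 'I_k -> bop H H -> bop H H) s Y :
  (forall j, preserves psd_difference (G j)) -> psd_difference Y ->
  psd_difference (foldr G Y s).
Proof. by move=> pG CY; elim: s => [//|j s IH]; exact: pG. Qed.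

Lemma psd_difference1 : psd_difference (bop_id H).
Proof. by apply: psd_psd_difference; exact: psd1. Qed.

Lemma geom_preserves i q : preserves psd_difference (geom i q).
Proof.
move=> Y CY; elim: q => [|q IH] /=; first by apply: psd_psd_difference; exact: psd0.
rewrite -[iter _ _ _]opprK; apply: psd_differenceB => //.
rewrite -[- _]sub0r; apply: psd_differenceB; first by apply: psd_psd_difference; exact: psd0.
exact: iter_Phi_preserves.
Qed.

Lemma foldr_defect_psd s : uniq s -> psd (foldr defect (bop_id H) s).
Proof.
move=> us; have [_ _ /(_ (fun i => (i \in s) : nat))] := X_pd.
move=> /(_ (fun i => leq_trans (leq_b1 _) (m_gt0 i))).
rewrite /Delta.
have -> : foldr (fun i => iter (i \in s) (fun Z => Z - Phi f X i Z)) (bop_id H) (enum 'I_k) =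
    foldr defect (bop_id H) [seq i <- enum 'I_k | i \in s].
  by elim: (enum 'I_k) => [//|i r IH] /=; rewrite IH; case: ifP => _.
congr psd; apply: (foldr_perm (C := psd_difference)).
- exact: defect_preserves.
- exact: defect_commutes.
- exact: psd_difference1.
- apply: uniq_perm => //; first by rewrite filter_uniq// enum_uniq.
  by move=> i; rewrite mem_filter mem_enum andbT.
Qed.

(** As 1 - Phi^q is the composition of 1 - Phi with a geometric sum, which preserves
    positivity, the product of the factors 1 - Phi_i^q is positive as soon as the product
    of the 1 - Phi_i is. *)
Lemma foldr_powdefect_psd q s : uniq s -> psd (foldr (powdefect q) (bop_id H) s).
Proof.
move=> us; have gC i r Y : psd_difference Y ->
    defect i (foldr (fun j => geom j (q j)) Y r) = foldr (fun j => geom j (q j)) (defect i Y) r.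
  move=> CY; elim: r => [//|j r IH] /=; rewrite geom_commutes ?IH//.
  apply: foldr_preserves => // l; exact: geom_preserves.
have -> : foldr (powdefect q) (bop_id H) s =
    foldr (fun j => geom j (q j)) (foldr defect (bop_id H) s) s.
  elim: s {us} => [//|i s IH] /=; rewrite IH /powdefect -defect_geom geom_commutes.
    by rewrite gC//; apply: foldr_preserves; [exact: defect_preserves|exact: psd_difference1].
  apply: foldr_preserves => [l|]; first exact: geom_preserves.
  by apply: foldr_preserves; [exact: defect_preserves|exact: psd_difference1].
have := foldr_defect_psd s us; move: (foldr defect _ s) => Y.
by elim: {us} s => [//|i s IH] pY /=; apply: geom_psd; exact: IH.
Qed.

(** The other factors of the product only decrease 1 - Phi_i^q. *)
Lemma foldr_powdefect_le q s i x : uniq s -> i \in s ->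
  quad (foldr (powdefect q) (bop_id H) s) x <= nm x ^+ 2 - quad (iter (q i) (Phi f X i) (bop_id H)) x.
Proof.
move=> us si; have -> : foldr (powdefect q) (bop_id H) s = foldr (powdefect q) (bop_id H) (rcons (rem i s) i).
  apply: (foldr_perm (C := psd_difference)).
  - exact: powdefect_preserves.
  - exact: powdefect_commutes.
  - exact: psd_difference1.
  - by rewrite perm_sym perm_rcons perm_sym perm_to_rem.
have : uniq (rcons (rem i s) i) by rewrite rcons_uniq mem_rem_uniqF// rem_uniq.
elim: (rem i s) => [_|j r IH] /=; first by rewrite /powdefect quadB quad1.
move=> /andP[_ ur]; rewrite {1}/powdefect quadB (le_trans _ (IH ur))// gerBl.
by apply: psd_quad; apply: iter_Phi_psd => //; exact: foldr_powdefect_psd.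
Qed.

(** The products of the purity condition tend to 1 and are at most 1 - Phi_i^q. *)
Lemma pure_iter_Phi_cvg0 i x : pure f X ->
  (fun N => quad (iter N (Phi f X i) (bop_id H)) x) @ \oo --> (0 : R).
Proof.
move=> pX; apply/cvgn_eps => e e0.
have FF := multi_index_filter k.
have /cvgcP[/cvgr_eps /(_ _ e0) [q0 _ hq] _] := pX x x.
exists (q0 i) => N qN; pose q j := if j == i then N else q0 j.
have := hq q; rewrite /= => /(_ _)/wrap[j|].
  by rewrite /q; case: eqP => [->|].
rewrite -[Re '[x, x]]/(rip x x) ripxx => h.
have := foldr_powdefect_le q (rev (enum 'I_k)) i x; rewrite rev_uniq enum_uniq mem_rev mem_enum.
have qi : q i = N by rewrite /q eqxx.
have := foldl_rev (fun Z j => powdefect q j Z) (bop_id H) (rev (enum 'I_k)); rewrite revK => <-.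
move=> /(_ isT isT); rewrite qi => h2.
rewrite sub0r normrN ger0_norm; last by apply: psd_quad; apply: iter_Phi_psd => //; exact: psd1.
move: h; rewrite ltr_norml => /andP[_]; apply: le_lt_trans.
by rewrite lerBrDl -lerBrDr; exact: h2.
Qed.

Hypothesis X_pure : pure f X.

(** The power series (1 - z)^(-m) applied to Phi_i inverts (1 - Phi_i)^m. No convergence
    beyond that of the powers Phi_i^q(1) to 0 is needed, since all terms are nonnegative. *)
Lemma quad_resum i Y x : (forall p, (p <= m i)%N -> psd (iter p (defect i) Y)) ->
  ((quad Y x)%:E = \esum_(w in [set: seq 'I_(n i)])
    (wt (f i) (m i) w * quad (iter (m i) (defect i) Y) (adj (word_op (X i) w) x))%:E)%E.
Proof.
move=> pY; pose a p j := quad (iter j (Phi f X i) (iter p (defect i) Y)) x.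
have Em : (\esum_(j in [set: nat]) ('C(j + m i - 1, j)%:R * a (m i) j)%:E = (quad Y x)%:E)%E.
  apply: (@esum_iterated_differences _ a (m i)) => // [p j pm|p j pm|].
  - by apply: psd_quad; apply: iter_Phi_psd => //; exact: pY.
  - by rewrite /a -quadB iterSr -iter_PhiB.
  - have [c c0 hc] := psd_le_id (pY 0%N (leq0n _)).
    have := pure_iter_Phi_cvg0 i x X_pure.
    move=> h; have h0 : (fun N => quad (iter N (Phi f X i) (bop_id H)) x * c) @ \oo --> (0 : R).
      by rewrite -[X in _ --> X](mul0r c); apply: cvgM => //; exact: cvg_cst.
    apply: (squeeze0 _ h0); apply: filterE => j; rewrite ger0_norm; last first.
      by apply: psd_quad; apply: iter_Phi_psd => //; exact: (pY 0%N (leq0n _)).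
    rewrite -subr_ge0 mulrC -quadZ.
    rewrite -iter_PhiZ// -quadB -iter_PhiB//; apply: psd_quad; apply: iter_Phi_psd => //; exact: hc.
rewrite -Em.
have q0 w : 0 <= quad (iter (m i) (defect i) Y) (adj (word_op (X i) w) x).
  by apply: psd_quad; exact: pY.
rewrite (eq_esum (b := fun j => \esum_(w in [set: seq 'I_(n i)])
   ('C(j + m i - 1, j)%:R * (fpow (f i) j w * quad (iter (m i) (defect i) Y) (adj (word_op (X i) w) x)))%:E)%E); last first.
  move=> j _; rewrite esumZ//; last by move=> w; rewrite mulr_ge0// fpow_ge0.
  by rewrite EFinM /a quad_iter_Phi//; exact: pY.
have pos j w : 0 <= 'C(j + m i - 1, j)%:R * (fpow (f i) j w * quad (iter (m i) (defect i) Y) (adj (word_op (X i) w) x)).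
  by rewrite !mulr_ge0// fpow_ge0.
rewrite esum_esum; last by move=> *; rewrite lee_fin.
have B : set_bij ([set: seq 'I_(n i)] `*`` (fun=> [set: nat]))
    ([set: nat] `*`` (fun=> [set: seq 'I_(n i)])) (fun u => (u.2, u.1)).
  by split=> [//|[a' b] [c d] _ _ [-> ->]//|[a' b] _]; exists (b, a').
rewrite (reindex_esum _ _ _ _ B).
rewrite -(@esum_esum _ _ _ _ _ (fun w j => ('C(j + m i - 1, j)%:R * (fpow (f i) j w * quad (iter (m i) (defect i) Y) (adj (word_op (X i) w) x)))%:E)); last first.
  by move=> *; rewrite lee_fin.
apply: eq_esum => w _; apply/series_esum => //.
apply/cvgn_eps => e e0; exists (size w).+1 => N sN.
rewrite (@wt_widen _ _ _ (f_nil i) _ _ _ sN) /series /= big_mkord mulr_suml.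
have eq_lt (u v : R) : u = v -> `|u - v| < e by move=> ->; rewrite subrr normr0.
by apply: eq_lt; apply: eq_bigr => j _; rewrite mulrA.
Qed.

Lemma foldr_defect_pow_psd s (p : 'I_k -> nat) : uniq s -> (forall i, (p i <= m i)%N) ->
  psd (foldr (fun i => iter (p i) (defect i)) (bop_id H) s).
Proof.
move=> us pm; have [_ _ /(_ (fun i => if i \in s then p i else 0%N))] := X_pd.
move=> /(_ _)/wrap[i|]; first by case: ifP.
rewrite /Delta.
have -> : foldr (fun i => iter (if i \in s then p i else 0) (fun Z => Z - Phi f X i Z)) (bop_id H) (enum 'I_k) =
    foldr (fun i => iter (p i) (defect i)) (bop_id H) [seq i <- enum 'I_k | i \in s].
  by elim: (enum 'I_k) => [//|i r IH] /=; rewrite IH; case: ifP.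
have pres i q : preserves (psd_difference) (iter q (defect i)).
  by elim: q => [//|q IH] Y CY; apply: defect_preserves; exact: IH.
congr psd; apply: (foldr_perm (C := psd_difference)).
- by move=> i; exact: pres.
- move=> i j; apply: commutes_iter; first exact: defect_preserves.
  apply: commutes_sym; apply: commutes_iter; first exact: defect_preserves.
  exact: defect_commutes.
- exact: psd_difference1.
- apply: uniq_perm => //; first by rewrite filter_uniq// enum_uniq.
  by move=> i; rewrite mem_filter mem_enum andbT.
Qed.

Lemma quad_resum_list s x : uniq s ->
  ((nm x ^+ 2)%:E = \esum_(b in [set b : multiword n | forall i, i \notin s -> b i = [::]])
    ((\prod_(i <- s) wt (f i) (m i) (b i)) *
     quad (foldr (fun i => iter (m i) (defect i)) (bop_id H) s) (adj (word_prod s b) x))%:E)%E.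
Proof.
elim: s => [_|i s IH].
  rewrite (_ : [set b | _] = [set ([ffun=> [::]] : multiword n)]).
    rewrite esum_set1 /= big_nil mul1r quad1 ?lee_fin ?sqr_ge0// adj1 //.
  apply/seteqP; split=> b /= h; last by rewrite h => j _; rewrite ffunE.
  by apply/ffunP => j; rewrite h// ffunE.
rewrite cons_uniq => /andP[si us]; rewrite IH// => {IH}.
set D := foldr _ _ s; set A := [set b | _].
have D0 z : 0 <= quad (iter (m i) (defect i) D) z.
  have := foldr_defect_pow_psd (i :: s) m; rewrite /= si us => /(_ isT (fun=> leqnn _)).
  by move=> h; apply: psd_quad h.
have wt0 (j : 'I_k) w : 0 <= wt (f j) (m j) w by exact: wt_ge0.
have pw0 (b : multiword n) : 0 <= \prod_(j <- s) wt (f j) (m j) (b j) by apply: prodr_ge0.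
rewrite (eq_esum (b := fun b : multiword n => \esum_(w in [set: seq 'I_(n i)])
   ((\prod_(j <- s) wt (f j) (m j) (b j)) * (wt (f i) (m i) w *
     quad (iter (m i) (defect i) D) (adj (word_op (X i) w) (adj (word_prod s b) x))))%:E)%E); last first.
  move=> b _; rewrite esumZ//; last by move=> w; rewrite mulr_ge0.
  rewrite EFinM -quad_resum// => p pm.
  have := foldr_defect_pow_psd (i :: s) (fun j => if j == i then p else m j).
  rewrite /= si us eqxx => /(_ isT) h.
  have -> : D = foldr (fun j => iter (if j == i then p else m j) (defect j)) (bop_id H) s.
    rewrite /D; elim: s si {us D A D0 pw0 h} => [//|j s IH] /=; rewrite inE negb_or => /andP[ij si].
    by rewrite IH// eq_sym (negbTE ij).
  by apply: h => j; case: eqP => [->|].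
rewrite esum_esum; last by move=> *; rewrite lee_fin !mulr_ge0.
pose e (u : multiword n * seq 'I_(n i)) : multiword n := [ffun j => dfwith u.1 i u.2 j].
have B : set_bij (A `*`` (fun=> [set: seq 'I_(n i)]))
    [set b : multiword n | forall j, j \notin i :: s -> b j = [::]] e.
  split=> [[b w] [/= Ab _] j|[b w] [b' w'] /set_mem[/= Ab _] /set_mem[/= Ab' _] E|b /= hb].
  - rewrite inE negb_or => /andP[ji js]; rewrite /e ffunE dfwithout 1?eq_sym//=.
    exact: Ab.
  - have /ffunP E' := E; congr pair.
      apply/ffunP => j; have [->|ji] := eqVneq j i; first by rewrite Ab ?Ab'.
      by have := E' j; rewrite !ffunE !dfwithout 1?eq_sym.
    by have := E' i; rewrite !ffunE !dfwithin.
  - exists ([ffun j => dfwith b i [::] j] : multiword n, b i).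
      split=> //= j js; rewrite ffunE; have [<-|ij] := eqVneq i j; first by rewrite dfwithin.
      by rewrite dfwithout// hb// inE negb_or eq_sym ij.
    apply/ffunP => j; rewrite /e ffunE /=; have [<-|ij] := eqVneq i j; first by rewrite dfwithin.
    by rewrite dfwithout// ffunE dfwithout.
rewrite (reindex_esum _ _ _ _ B); apply: eq_esum => -[b w] [/= Ab _].
have Ei : e (b, w) i = w by rewrite /e ffunE dfwithin.
have Es j : j \in s -> e (b, w) j = b j.
  by move=> js; rewrite /e ffunE dfwithout//; apply: contraNneq si => ->.
have Ew : word_prod s (e (b, w)) = word_prod s b.
  exact: (eq_word_prod).
rewrite big_cons Ei Ew mulrCA mulrA.
have -> : \prod_(j <- s) wt (f j) (m j) (e (b, w) j) = \prod_(j <- s) wt (f j) (m j) (b j).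
  by rewrite !big_seq; apply: eq_bigr => j js; rewrite Es.
congr ((_ * quad _ _)%:E).
by rewrite -bopM -adjM (word_prod_commute _ _ _ _ XC).
Qed.

(** The resummation above, in all coordinates successively. It is what makes the Berezin
    kernel of a pure element isometric. *)
Lemma pure_resolution x :
  ((nm x ^+ 2)%:E = \esum_(b in [set: multiword n])
    ((\prod_i wt (f i) (m i) (b i)) *
     quad (Delta f X m (bop_id H)) (adj (mword_op X b) x))%:E)%E.
Proof.
have := quad_resum_list (enum 'I_k) x (enum_uniq _).
rewrite (_ : [set b | _] = setT); last first.
  by apply/seteqP; split=> // b _ j; rewrite mem_enum.
move=> ->; apply: eq_esum => b _; rewrite -big_enum /=.
by [].
Qed.

Lemma Delta_psd : psd (Delta f X m (bop_id H)).
Proof. by have [_ _ h] := X_pd; exact: h. Qed.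

End Polydomain.

Set Implicit Arguments.

(** * Closed spans *)

Section Density.
Variable R : realType.
Implicit Types H K : hilbertType R.

Lemma lin_span_ind (V : lmodType R[i]) (A P : set V) :
  is_subspace P -> A `<=` P -> lin_span A `<=` P.
Proof. by move=> sP AP x; apply. Qed.

Lemma lin_span_subspace (V : lmodType R[i]) (A : set V) : is_subspace (lin_span A).
Proof.
split; first by move=> B [[B0 _] _].
by move=> c x y hx hy B [sB AB]; apply: sB.2; [exact: hx|exact: hy].
Qed.

Lemma lin_span_sub (V : lmodType R[i]) (A : set V) : A `<=` lin_span A.
Proof. by move=> x Ax B [_]; apply. Qed.

Lemma orth_is_subspace H (z : H) : is_subspace [set y | '[y, z] = 0].
Proof.
split=> [|c x y /= hx hy] /=; first exact: hdot0l.
by rewrite hdotDl hdotZl hx hy mulr0 addr0.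
Qed.

Lemma orth_closure H (A : set H) z : (forall a, A a -> '[a, z] = 0) ->
  forall y, closure (lin_span A) y -> '[y, z] = 0.
Proof.
move=> hA y /closure_eps hy.
have hz a : lin_span A a -> '[a, z] = 0.
  by move=> ha; exact: (lin_span_ind (orth_is_subspace z) hA ha).
apply/eqP; rewrite -normr_eq0 normC_cabs; apply/eqP; congr (_%:C).
apply/eqP; rewrite eq_le cabs_ge0 andbT leNgt; apply/negP => h.
have zp : 0 < nm z + 1 by rewrite ltr_wpDl ?nm_ge0.
have [a ha] := hy (cabs '[y, z] / (nm z + 1)) (divr_gt0 h zp).
have -> : '[y, z] = '[y - a, z] by rewrite hdotBl (hz _ ha) subr0.
have := hdot_le (y - a) z; have := nm_ge0 (y - a).
rewrite ltr_pdivlMr//; nra.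
Qed.

Lemma total_of_dense H (A : set H) z : closure (lin_span A) = setT ->
  (forall a, A a -> '[a, z] = 0) -> z = 0.
Proof.
move=> cA hA; have h : '[z, z] = 0 by apply: (orth_closure hA); rewrite cA.
by apply: nm_eq0; apply/eqP; rewrite -sqrf_eq0 -ripxx /rip h.
Qed.

(** Cauchy-Schwarz for the form of A. *)
Lemma bop_of_quad H (A : bop H H) (c : R) : psd A -> (forall x, quad A x <= c * nm x ^+ 2) ->
  forall x, nm (A x) <= c * nm x.
Proof.
move=> pA hc x; have [->|a0] := eqVneq (nm (A x)) 0.
  have [/nm_eq0 ->|x0] := eqVneq (nm x) 0; first by rewrite nm0 mulr0.
  have xp : 0 < nm x by rewrite lt0r x0 nm_ge0.
  have := le_trans (psd_quad x pA) (hc x); rewrite pmulr_lge0 ?exprn_gt0// => c0.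
  by rewrite mulr_ge0// ltW.
have ap : 0 < nm (A x) by rewrite lt0r a0 nm_ge0.
have := psd_CS x (A x) pA; rewrite hdotxx cabs_real ger0_norm ?sqr_ge0// => h.
have h1 := hc x; have h2 := hc (A x); have q1 := psd_quad x pA; have q2 := psd_quad (A x) pA.
have h3 : (nm (A x) ^+ 2) ^+ 2 <= (c * nm x) ^+ 2 * nm (A x) ^+ 2.
  rewrite (le_trans h)// (le_trans (ler_pM q1 q2 h1 h2))//.
  by rewrite le_eqVlt; apply/orP; left; apply/eqP; ring.
have c0 : 0 <= c.
  by have := le_trans q2 h2; rewrite pmulr_lge0 ?exprn_gt0.
rewrite -(ler_pXn2r (_ : 0 < 2)%N) ?nnegrE ?nm_ge0 ?mulr_ge0 ?nm_ge0//.
by move: h3; rewrite [(nm (A x) ^+ 2) ^+ 2]expr2 ler_pM2r ?exprn_gt0.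
Qed.

End Density.

Unset Implicit Arguments.

Section HomogeneousParts.
Variables (R : realType) (k : nat) (n : 'I_k -> nat) (H : hilbertType R).
Variable X : forall i, 'I_(n i) -> bop H H.
Local Notation mw := (forall i, seq 'I_(n i)).

Definition homop (c : mw -> R[i]) (q : nat) : bop H H :=
  \sum_(b : {dffun forall i, q.-bseq 'I_(n i)} | (\sum_i size (b i))%N == q)
    c (fun i => b i) *: mword_op X (fun i => b i).

Lemma homopE c q x : homop c q x = hom_part X c q x.
Proof. by rewrite /homop bop_sum; apply: eq_bigr => b _; rewrite bopZ. Qed.

End HomogeneousParts.

Section WeakStarClosure.
Variables (R : realType) (N : hilbertType R).
Implicit Types A B : bop N N.

Lemma wstar_eval_linear c A B (p : wpair N N) :
  wstar_eval (c *: A + B) p = c * wstar_eval A p + wstar_eval B p.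
Proof.
have [s hs _] := wpair_bound p.
have cv A' : (series (fun l => '[A' ((sval p).1 l), (sval p).2 l]) : nat -> R[i]^o) @ \oo --> (wstar_eval A' p : R[i]^o).
  have [M M0 hM] := bop_bound A'.
  have [|h _ _ _] := @dominated_csum R (fun l => '[A' ((sval p).1 l), (sval p).2 l]) _ _ _ (seriesZc (c := M) hs).
    by move=> l; exact: hdot_bop_le.
  exact: h.
rewrite [LHS]wstar_evalE; apply: csum_eq.
rewrite (_ : series _ = fun L => c * series (fun l => '[A ((sval p).1 l), (sval p).2 l]) L
    + series (fun l => '[B ((sval p).1 l), (sval p).2 l]) L); first by apply: cvgc_lin; exact: cv.
apply/funext => L; rewrite /series /= mulr_sumr -big_split; apply: eq_bigr => l _.
transitivity ('[c *: A ((sval p).1 l) + B ((sval p).1 l), (sval p).2 l]); first by [].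
by rewrite hdotDl hdotZl.
Qed.

Lemma wstar_affine_continuous c B : continuous ((fun A => c *: A + B) : wstar N N -> wstar N N).
Proof.
move=> L; apply/(wstar_cvgP (nbhs_filter (L : wstar N N))) => p.
have /(wstar_cvgP (nbhs_filter (L : wstar N N))) /(_ p) h : (fun A : wstar N N => A) @ nbhs (L : wstar N N) --> (L : wstar N N).
  exact: cvg_id.
rewrite wstar_eval_linear.
rewrite (_ : (fun A : wstar N N => wstar_eval (c *: (A : bop N N) + B) p) = fun A => c * wstar_eval A p + wstar_eval B p); last first.
  by apply/funext => A; rewrite wstar_eval_linear.
apply: (@cvgc_lin R _ _ (nbhs_filter (L : wstar N N)) _ _ c _ _ h).
exact: cvg_cst.
Qed.

(** Linear combinations are separately w*-continuous, so the closure is taken in one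
    argument after the other. *)
Lemma wstar_closure_subspace (D : set (bop N N)) : is_subspace D ->
  is_subspace (closure (D : set (wstar N N)) : set (bop N N)).
Proof.
move=> [D0 Dlin]; split; first exact: subset_closure.
have pull c B (D1 D2 : set (wstar N N)) : closed D2 -> (forall A, D1 A -> D2 (c *: (A : bop N N) + B)) ->
    forall A, closure D1 A -> D2 (c *: (A : bop N N) + B).
  move=> cD h A hA.
  have cl : closed ((fun A : wstar N N => (c *: (A : bop N N) + B : wstar N N)) @^-1` D2).
    by apply: closed_comp => // L _; exact: wstar_affine_continuous.
  apply: (cl A); apply: (closure_subset _ hA) => A' /h; exact.
move=> c A B hA hB.
have half A' : D A' -> closure (D : set (wstar N N)) (c *: A' + B).
  move=> DA'; have := pull 1 (c *: A') D _ (@closed_closure _ _) _ B hB.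
  rewrite scale1r addrC; apply=> B' DB'; apply: subset_closure.
  by rewrite scale1r addrC; exact: Dlin.
exact: (pull c B D _ (@closed_closure _ _) half A hA).
Qed.

End WeakStarClosure.

(** * The basis of the tensor product and diagonal operators *)

Section TensorBasis.
Variables (R : realType) (k : nat) (n : 'I_k -> nat).
Variables (F : 'I_k -> hilbertType R) (e : forall i, seq 'I_(n i) -> F i).
Hypothesis he : forall i, orthonormal_basis (e i).
Variables (K : hilbertType R) (t : (forall i, F i) -> K).
Hypothesis ht : hilbert_tensor t.
Local Notation mw := (forall i, seq 'I_(n i)).
Implicit Types (a b : mw) (i : 'I_k).

Lemma dfwith_same (T : 'I_k -> Type) (x : forall i, T i) i : dfwith x i (x i) = x.
Proof.
apply: functional_extensionality_dep => j; have [<-|ij] := eqVneq i j.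
  by rewrite dfwithin.
by rewrite dfwithout.
Qed.

Lemma dfwith_dfwith (T : 'I_k -> Type) (x : forall i, T i) i y z :
  dfwith (dfwith x i y) i z = dfwith x i z.
Proof.
apply: functional_extensionality_dep => j; have [<-|ij] := eqVneq i j.
  by rewrite !dfwithin.
by rewrite !dfwithout.
Qed.

Lemma dfwith_map (T U : 'I_k -> Type) (g : forall i, T i -> U i) (x : forall i, T i) i y :
  dfwith (fun j => g j (x j)) i (g i y) = fun j => g j (dfwith x i y j).
Proof.
apply: functional_extensionality_dep => j; have [<-|ij] := eqVneq i j.
  by rewrite !dfwithin.
by rewrite !dfwithout.
Qed.

Lemma tensor0 x i : t (dfwith x i 0) = 0.
Proof.
have [_ ht2 _] := ht; apply: nm_eq0; apply/eqP; rewrite -sqrf_eq0 -ripxx /rip ht2.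
by rewrite (bigD1 i)//= dfwithin hdot0l mul0r.
Qed.

Lemma tensorZ x i c u : t (dfwith x i (c *: u)) = c *: t (dfwith x i u).
Proof. by have [h _ _] := ht; rewrite -[c *: u]addr0 h tensor0 addr0. Qed.

Lemma tensor_nm x : nm (t x) = \prod_i nm (x i).
Proof.
have [_ ht2 _] := ht; apply: (pexpIrn (n := 2)); rewrite ?nnegrE ?nm_ge0//.
  by apply: prodr_ge0 => i _; exact: nm_ge0.
apply: complexI; rewrite -hdotxx ht2 -prodrXl rmorph_prod; apply: eq_bigr => i _.
by rewrite hdotxx.
Qed.

Definition tbasis a : K := t (fun i => e i (a i)).

Lemma tbasis_dot a b : '[tbasis a, tbasis b] = ([forall i, a i == b i])%:R.
Proof.
have [_ ht2 _] := ht; rewrite ht2.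
rewrite (eq_bigr (fun i => (a i == b i)%:R)); last by move=> i _; have [-> _] := he i.
have [/forallP h|/forallPn[i hi]] := boolP [forall i, a i == b i].
  by rewrite big1// => i _; rewrite h.
by rewrite (bigD1 i)//= (negbTE hi) mul0r.
Qed.

Lemma mw_eqP a b : reflect (a = b) [forall i, a i == b i].
Proof.
apply: (iffP forallP) => [h|-> //].
by apply: functional_extensionality_dep => i; apply/eqP.
Qed.

Lemma tbasis_nm a : nm (tbasis a) = 1.
Proof.
apply: (pexpIrn (n := 2)); rewrite ?nnegrE ?nm_ge0// -ripxx /rip tbasis_dot expr1n.
by rewrite (introT (mw_eqP a a) erefl).
Qed.

(** A vector orthogonal to the basis is orthogonal to all elementary tensors, as is seen by
    freeing one coordinate at a time: the inner product is a bounded functional of the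
    freed coordinate, which Riesz represents by a vector orthogonal to a basis. *)
Lemma tbasis_total z : (forall a, '[z, tbasis a] = 0) -> z = 0.
Proof.
move=> hz; have [tlin ht2 tdense] := ht.
apply: (total_of_dense tdense) => _ [x _ <-].
have main : forall (s : seq 'I_k) (x : forall i, F i), (forall i, i \notin s -> exists w, x i = e i w) -> '[t x, z] = 0.
  elim=> [|i s IH] {}x hx.
    pose b i := sval (cid (hx i isT)); have hb i : x i = e i (b i) := svalP (cid (hx i isT)).
    rewrite hdotC (_ : x = fun i => e i (b i)) ?hz ?conj0//.
    exact: functional_extensionality_dep.
  pose phi y := '[t (dfwith x i y), z].
  have [c y y'|y|v hv] := @riesz _ (F i) phi (\prod_(j | j != i) nm (x j) * nm z).
  - by rewrite /phi tlin hdotDl hdotZl.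
  - rewrite (le_trans (hdot_le _ _))// tensor_nm (bigD1 i)//= dfwithin.
    rewrite (eq_bigr (fun j => nm (x j))) => [|j ji]; last by rewrite dfwithout// eq_sym.
    by rewrite le_eqVlt; apply/orP; left; apply/eqP; ring.
  have v0 : v = 0.
    have [_ hdense] := he i.
    apply: (total_of_dense hdense) => _ [w _ <-].
    rewrite -hv /phi; apply: IH => j js; have [<-|ij] := eqVneq i j.
      by exists w; rewrite dfwithin.
    rewrite dfwithout//; apply: hx; by rewrite inE negb_or eq_sym ij.
  by have := hv (x i); rewrite v0 hdot0r /phi dfwith_same.
by apply: (main (enum 'I_k)) => i; rewrite mem_enum.
Qed.

(** The basis as a sequence, with zeros at the numbers that encode no multi-index. *)
Definition tseq l : K := if @pickle_inv (multiword n) l is Some b then tbasis b else 0.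

Lemma tseq_orth p q : p != q -> '[tseq p, tseq q] = 0.
Proof.
rewrite /tseq => pq; case Ep : pickle_inv => [b|]; last by rewrite hdot0l.
case Eq : pickle_inv => [c|]; last by rewrite hdot0r.
rewrite tbasis_dot; case: (mw_eqP b c) => // bc; case/eqP: pq.
have := @pickle_invK (multiword n) p; have := @pickle_invK (multiword n) q.
by rewrite Ep Eq /= => <- <-; congr pickle; apply/ffunP => i; rewrite bc.
Qed.

Lemma tseq_norm p : tseq p = 0 \/ nm (tseq p) = 1.
Proof. by rewrite /tseq; case: pickle_inv => [b|]; [right; exact: tbasis_nm|left]. Qed.

Lemma tseq_pickle a : tseq (pickle ([ffun i => a i] : multiword n)) = tbasis a.
Proof.
rewrite /tseq pickleK_inv; congr tbasis.
by apply: functional_extensionality_dep => i; rewrite ffunE.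
Qed.

Lemma tseq_total z : (forall p, '[z, tseq p] = 0) -> z = 0.
Proof. by move=> h; apply: tbasis_total => a; rewrite -tseq_pickle. Qed.

Lemma eq_tbasis (x y : K) : (forall a, '[x, tbasis a] = '[y, tbasis a]) -> x = y.
Proof.
move=> h; apply/eqP; rewrite -subr_eq0; apply/eqP/tbasis_total => a.
by rewrite hdotBl h subrr.
Qed.

Definition diagonal (A : bop K K) (d : mw -> R) := forall a, A (tbasis a) = (d a)%:C *: tbasis a.

Definition dseq (d : mw -> R) l : R := if @pickle_inv (multiword n) l is Some b then d b else 0.

Lemma diagonal_dot A d x a : diagonal A d -> '[A x, tbasis a] = (d a)%:C * '[x, tbasis a].
Proof.
move=> hA; have -> : '[A x, tbasis a] = '[x, adj A (tbasis a)] by rewrite adjP.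
suff -> : adj A (tbasis a) = (d a)%:C *: tbasis a by rewrite hdotZr conj_real.
apply: eq_tbasis => b; rewrite -adjPr hA hdotZr conj_real hdotZl tbasis_dot.
by case: (mw_eqP a b) => [->|]; rewrite ?mulr0.
Qed.

Lemma diagonal_herm A d : diagonal A d -> herm A.
Proof.
move=> hA; suff E : adj A = A by move=> x y; rewrite rip_adj E.
apply: bop_eq => x; apply: eq_tbasis => a; rewrite -adjPr hA hdotZr conj_real.
by rewrite (diagonal_dot _ d).
Qed.

Lemma diagonal_dseq A d l y : diagonal A d -> '[A y, tseq l] = (dseq d l)%:C * '[y, tseq l].
Proof.
move=> hA; rewrite /tseq /dseq; case: pickle_inv => [b|]; first exact: diagonal_dot.
by rewrite hdot0r mul0r.
Qed.

Lemma tseq_expansion y : series (fun l => '[y, tseq l] *: tseq l) @ \oo --> y /\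
  series (fun l => cabs '[y, tseq l] ^+ 2) @ \oo --> (nm y ^+ 2 : R).
Proof. exact: (orthonormal_expansion tseq_orth tseq_norm tseq_total). Qed.

Lemma diagonal_quad A d y : diagonal A d ->
  series (fun l => dseq d l * cabs '[y, tseq l] ^+ 2) @ \oo --> quad A y.
Proof.
move=> hA; have [h _] := tseq_expansion y.
rewrite /quad ripC.
rewrite (_ : series _ = fun N => rip (series (fun l => '[y, tseq l] *: tseq l) N) (A y)).
  by apply: cvg_ripl.
apply/funext => N; rewrite /series /= rip_suml; apply: eq_bigr => l _.
rewrite ripC /rip hdotZr (diagonal_dseq _ d)//.
have E (z : R[i]) (r : R) : z^* * (r%:C * z) = r%:C * (z * z^*) by ring.
by rewrite E -normCK normC_cabs -rmorphXn -rmorphM.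
Qed.

Lemma dseq_ge0 d l : (forall a, 0 <= d a) -> 0 <= dseq d l.
Proof. by move=> d0; rewrite /dseq; case: pickle_inv. Qed.

Lemma diagonal_psd A d : diagonal A d -> (forall a, 0 <= d a) -> psd A.
Proof.
move=> hA d0; apply: psd_mk; first exact: diagonal_herm hA.
move=> y; apply: (cvg_ge (diagonal_quad A d y hA)); apply: filterE => N.
by apply: sumr_ge0 => l _; rewrite mulr_ge0 ?sqr_ge0// dseq_ge0.
Qed.

Lemma diagonal_quad_le A d y : diagonal A d -> (forall a, d a <= 1) -> quad A y <= nm y ^+ 2.
Proof.
move=> hA d1; have [_ h2] := tseq_expansion y.
rewrite -subr_ge0; apply: (cvg_ge (seriesBc h2 (diagonal_quad A d y hA))).
apply: filterE => N; apply: sumr_ge0 => l _; rewrite subr_ge0.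
rewrite ler_piMl ?sqr_ge0// /dseq; case: pickle_inv => // b; exact: d1.
Qed.

(** By dominated convergence in the expansion of the quadratic forms along the basis. *)
Lemma diagonal_wot1 T (G : set_system T) (FG : Filter G) (A : T -> bop K K) (d : T -> mw -> R) :
  (forall s, diagonal (A s) (d s)) -> (forall s a, 0 <= d s a <= 1) ->
  (forall a, (fun s => d s a) @ G --> (1 : R)) -> wot_cvg G A (bop_id K).
Proof.
move=> hA d01 d1; apply: wot_herm => [s| |y]; [exact: diagonal_herm (hA s)|by []|].
have [_ h2] := tseq_expansion y; rewrite quad1.
have h := @dominated_series_cvg0 R T G _ (fun s l => (1 - dseq (d s) l) * cabs '[y, tseq l] ^+ 2)
  (fun l => cabs '[y, tseq l] ^+ 2) _ (fun s => nm y ^+ 2 - quad (A s) y) _ h2.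
suff : (fun s => nm y ^+ 2 - quad (A s) y) @ G --> (0 : R).
  move=> /cvgr_eps h0; apply/cvgr_eps => eps /h0; apply: filterS => s.
  by rewrite sub0r normrN.
apply: h => [s l|l|s].
- rewrite normrM [`|_ ^+ 2|]ger0_norm ?sqr_ge0// ler_piMl ?sqr_ge0//.
  rewrite /dseq; case: pickle_inv => [b|]; last by rewrite subr0 normr1.
  by rewrite ler_norml; have /andP[] := d01 s b; lra.
- rewrite /tseq /dseq; case: pickle_inv => [b|]; last first.
    by under eq_fun do rewrite hdot0r cabs0 expr0n mulr0; exact: cvg_cst.
  rewrite -[X in _ --> X](mul0r (cabs '[y, tbasis b] ^+ 2)); apply: cvgM; last exact: cvg_cst.
  by rewrite -[X in _ --> X](subrr 1); apply: cvgB => //; exact: cvg_cst.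
- rewrite (_ : (fun l => _) = fun l => cabs '[y, tseq l] ^+ 2 - dseq (d s) l * cabs '[y, tseq l] ^+ 2).
    by apply: seriesBc => //; exact: diagonal_quad.
  by apply/funext => l; rewrite mulrBl mul1r.
Qed.

Local Notation u := tbasis.
Local Notation diag := diagonal.

Lemma bop_eq_tbasis (V : hilbertType R) (A B : bop K V) : (forall a, A (u a) = B (u a)) -> A = B.
Proof.
move=> h; suff E : adj A = adj B by rewrite -[A]adjK E adjK.
by apply: bop_eq => x; apply: (eq_tbasis) => a; rewrite -!adjPr h.
Qed.

Lemma bop_eq_coef (A B : bop K K) : (forall a b, '[A (u b), u a] = '[B (u b), u a]) -> A = B.
Proof. by move=> h; apply: bop_eq_tbasis => b; apply: (eq_tbasis) => a. Qed.

Lemma dseq_sqr_le1 (d : mw -> R) l : (forall a, 0 <= d a <= 1) -> dseq d l ^+ 2 <= 1.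
Proof.
move=> d01; rewrite /dseq; case: pickle_inv => [b|]; last by rewrite expr0n.
by have /andP[d0 d1] := d01 b; rewrite expr_le1.
Qed.

Lemma diagonal_exists (d : mw -> R) : (forall a, 0 <= d a <= 1) -> exists A, diag A d.
Proof.
move=> d01; pose c x l := (dseq d l)%:C * '[x, tseq l].
have cx x N : series (fun l => cabs (c x l) ^+ 2) N <= nm x ^+ 2.
  have [_ h] := tseq_expansion x.
  apply: le_trans (series_le_lim _ h N); last by move=> l; exact: sqr_ge0.
  apply: ler_sum => l _; rewrite cabsM exprMn cabs_real real_normK ?num_real//.
  by rewrite ler_piMl ?sqr_ge0// dseq_sqr_le1.
have ex x : exists y, (forall l, '[y, tseq l] = c x l) /\ nm y ^+ 2 <= nm x ^+ 2.
  have [|s hs sx] := series_bounded_cvg _ (cx x); first by move=> l; exact: sqr_ge0.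
  have c0 l : tseq l = 0 -> c x l = 0 by move=> E; rewrite /c E hdot0r mulr0.
  have [y [_ hy ys]] := riesz_fischer (tseq_orth) (tseq_norm) c0 hs.
  by exists y; rewrite ys.
pose A0 x := sval (cid (ex x)).
have hA x : (forall l, '[A0 x, tseq l] = c x l) /\ nm (A0 x) ^+ 2 <= nm x ^+ 2 by exact: svalP (cid (ex x)).
have lin : linear A0.
  move=> z x y; apply/eqP; rewrite -subr_eq0; apply/eqP; apply: (tseq_total) => l.
  by rewrite hdotBl hdotDl hdotZl !(hA _).1 /c hdotDl hdotZl; ring.
have bnd x : nm (A0 x) <= 1 * nm x.
  by rewrite mul1r -(ler_pXn2r (_ : 0 < 2)%N) ?nnegrE ?nm_ge0//; exact: (hA x).2.
exists (sval (mk_bop lin bnd)) => a; rewrite (svalP (mk_bop lin bnd)).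
apply: (eq_tbasis) => b; rewrite -(tseq_pickle b) (hA _).1 /c hdotZl.
rewrite (tseq_pickle b) tbasis_dot//; case: (mw_eqP a b) => [<-|]; last by rewrite !mulr0.
rewrite /dseq pickleK_inv; congr (_%:C * _); congr d.
by apply: functional_extensionality_dep => i; rewrite ffunE.
Qed.

Definition diagop (d : mw -> R) : bop K K := xget (0 : bop K K) [set A | diag A d].

Lemma diagopP d : (forall a, 0 <= d a <= 1) -> diag (diagop d) d.
Proof. by move=> /diagonal_exists h; exact: (xgetPex _ h). Qed.

Lemma diagonal_nm A d y : diag A d ->
  series (fun l => dseq d l ^+ 2 * cabs '[y, tseq l] ^+ 2) @ \oo --> (nm (A y) ^+ 2 : R).
Proof.
move=> hA; have [_] := tseq_expansion (A y).
rewrite (_ : (fun l => cabs '[A y, tseq l] ^+ 2) = fun l => dseq d l ^+ 2 * cabs '[y, tseq l] ^+ 2)//.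
apply/funext => l; rewrite (diagonal_dseq _ d)// cabsM exprMn cabs_real.
by rewrite real_normK ?num_real.
Qed.

Lemma diagonal_le A d y : diag A d -> (forall a, 0 <= d a <= 1) -> nm (A y) <= nm y.
Proof.
move=> hA d01; rewrite -(ler_pXn2r (_ : 0 < 2)%N) ?nnegrE ?nm_ge0//.
have [_ h] := tseq_expansion y.
rewrite -subr_ge0; apply: (cvg_ge (seriesBc h (diagonal_nm _ _ y hA))); apply: filterE => N.
apply: sumr_ge0 => l _; rewrite subr_ge0 ler_piMl ?sqr_ge0//; exact: dseq_sqr_le1.
Qed.

(** Evaluated on the basis, the hypothesis says that the operators form an isometric
    column; the two summations over nonnegative terms are exchanged. *)
Lemma diagonal_partition (A : nat -> bop K K) (d : nat -> mw -> R) :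
  (forall c, diag (A c) (d c)) -> (forall a, series (fun c => d c a ^+ 2) @ \oo --> (1 : R)) ->
  forall x, series (fun c => nm (A c x) ^+ 2) @ \oo --> (nm x ^+ 2 : R).
Proof.
move=> hA d1 x; have [_ hx] := tseq_expansion x.
apply/series_esum => [c|]; first exact: sqr_ge0.
move: hx => /series_esum <-; last by move=> l; exact: sqr_ge0.
have pos c l : 0 <= dseq (d c) l ^+ 2 * cabs '[x, tseq l] ^+ 2 by rewrite mulr_ge0 ?sqr_ge0.
transitivity (\esum_(c in [set: nat]) \esum_(l in [set: nat]) (dseq (d c) l ^+ 2 * cabs '[x, tseq l] ^+ 2)%:E)%E.
  by apply: eq_esum => c _; apply/esym/series_esum => //; exact: diagonal_nm.
rewrite esum_exchange//; apply: eq_esum => l _; apply/series_esum => //.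
rewrite /tseq /dseq; case: pickle_inv => [b|]; last first.
  rewrite hdot0r cabs0 expr0n /= (_ : series _ = fun=> 0); first exact: cvg_cst.
  by apply/funext => N; rewrite /series /= big1// => c _; rewrite mulr0.
have := seriesZc (c := cabs '[x, u b] ^+ 2) (d1 b); rewrite mulr1.
by rewrite (_ : (fun c => cabs '[x, u b] ^+ 2 * d c b ^+ 2) = fun c => d c b ^+ 2 * cabs '[x, u b] ^+ 2)//; apply/funext => c; rewrite mulrC.
Qed.

(** * The grading and the Abel means of an operator *)

Definition deg a : nat := \sum_i size (a i).

Lemma sum_indicator (j N : nat) : \sum_(0 <= c < N) (j == c)%:R = (j < N)%:R :> R.
Proof.
rewrite big_mkord; have [h|h] := ltnP j N; last first.
  by rewrite big1// => c _; rewrite gtn_eqF// (leq_trans (ltn_ord c)).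
by rewrite (bigD1 (Ordinal h))//= eqxx big1 ?addr0// => c; rewrite -val_eqE eq_sym /= => /negbTE ->.
Qed.

Definition degproj c : bop K K := diagop (fun a => (deg a == c)%:R).

Lemma degprojP c : diag (degproj c) (fun a => (deg a == c)%:R).
Proof. by apply: diagopP => a; rewrite ler0n lern1 leq_b1. Qed.

Lemma degproj_coef c x a : '[degproj c x, u a] = (deg a == c)%:R * '[x, u a].
Proof.
rewrite (diagonal_dot _ _ _ _ (degprojP c)).
by case: eqP.
Qed.

Lemma degproj_partition x : series (fun c => nm (degproj c x) ^+ 2) @ \oo --> (nm x ^+ 2 : R).
Proof.
apply: (diagonal_partition _ _ degprojP) => a.
apply/cvgn_eps => eps eps0; exists (deg a).+1 => N aN.
rewrite /series /= (eq_bigr (fun c => (deg a == c)%:R)); last by move=> c _; case: eqP; rewrite ?expr1n ?expr0n.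
by rewrite sum_indicator aN subrr normr0.
Qed.

Lemma degproj_series x : series (fun c => degproj c x) @ \oo --> x.
Proof.
have dS N : diag (series degproj N) (fun a => (deg a < N)%:R).
  move=> a; rewrite /series /= bop_sum (eq_bigr (fun c => (deg a == c)%:R *: u a)); last first.
    by move=> c _; rewrite degprojP; case: eqP.
  by rewrite -scaler_suml -(sum_indicator (deg a) N) rmorph_sum; congr (_ *: _); apply: eq_bigr => c _; case: eqP.
have dS01 N a : 0 <= ((deg a < N)%:R : R) <= 1 by rewrite ler0n lern1 leq_b1.
have wot := diagonal_wot1 _ \oo _ _ _ dS dS01.
have /wotP hw : wot_cvg \oo (series degproj) (bop_id K).
  apply: wot => a; apply/cvgn_eps => eps eps0; exists (deg a).+1 => N aN.
  by rewrite aN subrr normr0.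
apply/hcvg_eps => eps eps0.
have /cvgn_eps /(_ (eps ^+ 2)) [|N0 hN] := hw x x; first by rewrite exprn_gt0.
exists N0 => // N /= /hN; rewrite bop1 ripxx => h.
rewrite -(ltr_pXn2r (_ : 0 < 2)%N) ?nnegrE ?nm_ge0 ?(ltW eps0)//.
have E : series (fun c => degproj c x) N = series degproj N x by rewrite /series /= bop_sum.
rewrite E nm_sqrB; apply: le_lt_trans h; apply: le_trans (ler_norm _).
have := diagonal_le _ _ x (dS N) (dS01 N).
have h2 : nm (series degproj N x) ^+ 2 = rip (series degproj N x) x.
  rewrite -ripxx rip_adj (_ : adj _ = series degproj N); last first.
    by apply: adj_uniq; exact: (diagonal_herm _ _ (dS N)).
  rewrite ripC; congr (rip _ x); rewrite -bopM; congr (bop_fun _ x).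
  by apply: bop_eq_tbasis => a; rewrite bopM dS linearZ /= dS scalerA -rmorphM; case: (_ < _)%N; rewrite ?mulr1 ?mulr0.
by rewrite h2 (ripC x) => _; lra.
Qed.

(** The column with entries spread r c is an isometry, and it conjugates the amplification
    of an operator that raises degrees by q to r ^+ q times that operator: the overlap of
    the coefficients at the degrees j and j + q is r ^+ q. *)
Definition spread_coef r c j : R :=
  if (j <= c)%N then Num.sqrt (1 - r ^+ 2) * r ^+ (c - j) else 0.
Definition spread r c : bop K K := diagop (fun a => spread_coef r c (deg a)).

Lemma spreadP r c : 0 <= r < 1 ->
  diag (spread r c) (fun a => spread_coef r c (deg a)).
Proof.
move=> /andP[r0 r1]; apply: diagopP => a; rewrite /spread_coef; case: ifP => _; last by rewrite lexx ler01.
rewrite mulr_ge0 ?sqrtr_ge0 ?exprn_ge0//= mulr_ile1 ?sqrtr_ge0 ?exprn_ge0//.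
  by rewrite -[leRHS]sqrtr1 ler_wsqrtr// gerBl sqr_ge0.
by rewrite exprn_ile1// ltW.
Qed.

Lemma spread_sum r j : 0 <= r < 1 -> series (fun c => spread_coef r c j ^+ 2) @ \oo --> (1 : R).
Proof.
move=> /andP[r0 r1]; have s1 : 0 <= 1 - r ^+ 2 by rewrite subr_ge0 expr_le1// ltW.
have E N : series (fun c => spread_coef r c j ^+ 2) N = 1 - (r ^+ 2) ^+ (N - j).
  rewrite /spread_coef.
  elim: N => [|N IH]; first by rewrite series0 sub0n expr0 subrr.
  rewrite seriesS IH; have [h|h] := leqP (j) N.
    rewrite [X in _ + X]exprMn sqr_sqrtr// subSn// [in RHS]exprS -(exprM r (N - j)) mulnC exprM.
    by move: (r ^+ 2) ((r ^+ 2) ^+ (N - j)) => p q; ring.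
  by rewrite expr0n addr0; congr (1 - _ ^+ _); move: h; lia.
apply/cvgn_eps => eps eps0.
have /cvgn_eps /(_ _ eps0) [N0 hN] : (fun N => (r ^+ 2) ^+ N) @ \oo --> (0 : R).
  by apply: cvg_expr; rewrite ger0_norm ?sqr_ge0// expr_lt1.
exists (N0 + j)%N => N aN; rewrite E; have := hN (N - j)%N.
rewrite sub0r normrN opprB addrC subrK; apply.
by move: aN; lia.
Qed.

Lemma spread_partition r x : 0 <= r < 1 ->
  series (fun c => nm (spread r c x) ^+ 2) @ \oo --> (nm x ^+ 2 : R).
Proof.
by move=> r01; apply: (diagonal_partition _ _ (fun c => spreadP r c r01)) => a; exact: spread_sum.
Qed.

Section AbelMeans.
Variables (g : bop K K) (M : R).
Hypothesis M_ge0 : 0 <= M.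
Hypothesis g_bound : forall y, nm (g y) <= M * nm y.
Hypothesis g_lower : forall a b, (deg a < deg b)%N -> '[g (u b), u a] = 0.
Variable Q : nat -> bop K K.
Hypothesis Q_coef : forall q a b, '[Q q (u b), u a] = (deg a == deg b + q)%N%:R * '[g (u b), u a].

(** The mean of the homogeneous parts of g with the weights r ^+ q, defined by the isometry
    above, so that it obeys the same norm bound as g. *)
Definition abel r : bop K K := compress_ampl (spread r) g.

Lemma abel_coef r a b : 0 <= r < 1 ->
  '[abel r (u b), u a] = (r ^+ (deg a - deg b))%:C * '[g (u b), u a].
Proof.
move=> r01; rewrite compress_amplE; last by move=> x; exact: spread_partition.
have [ab|ba] := ltnP (deg a) (deg b).
  rewrite g_lower// mulr0; apply: csum_eq; rewrite (_ : series _ = fun=> 0); first exact: cvg_cst.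
  apply/funext => N; rewrite /series /= big1// => c _.
  by rewrite !(spreadP r c r01) hdotZr linearZ /= hdotZl g_lower// !mulr0.
have S := seriesZc (c := r ^+ (deg a - deg b)) (spread_sum r (deg a) r01).
rewrite mulr1 in S.
apply: csum_eq; set z := '[g (u b), u a].
have E N : series (fun c => '[g (spread r c (u b)), spread r c (u a)]) N =
    (series (fun c => r ^+ (deg a - deg b) * spread_coef r c (deg a) ^+ 2) N)%:C * z.
  rewrite /series /= rmorph_sum mulr_suml; apply: eq_bigr => c _.
  rewrite !(spreadP r c r01) hdotZr linearZ /= hdotZl conj_real mulrA -rmorphM.
  congr (_%:C * _); rewrite /spread_coef; case: ifP => ac; case: ifP => bc.
  - have -> : (c - deg b = (c - deg a) + (deg a - deg b))%N by move: ba ac; lia.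
    by rewrite exprD; ring.
  - by move: bc ac ba; lia.
  - by rewrite mul0r expr0n mulr0.
  - by rewrite mul0r expr0n mulr0.
rewrite (_ : series _ = fun N => (series (fun c => r ^+ (deg a - deg b) * spread_coef r c (deg a) ^+ 2) N)%:C * z); last first.
  by apply/funext.
have Re_realM (s : R) : Re (s%:C * z) = s * Re z by rewrite cReM /=; ring.
have Im_realM (s : R) : Im (s%:C * z) = s * Im z by rewrite cImM /=; ring.
apply/cvgcP; rewrite Re_realM Im_realM; split.
  by under eq_fun do rewrite Re_realM; apply: cvgM; [exact: S|exact: cvg_cst].
by under eq_fun do rewrite Im_realM; apply: cvgM; [exact: S|exact: cvg_cst].
Qed.

Lemma abel_bound r y : 0 <= r < 1 -> nm (abel r y) <= M * nm y.
Proof.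
move=> r01; have iso x := spread_partition r x r01.
have hS := seriesZc (c := M ^+ 2) (iso y).
have le c : nm (g (spread r c y)) ^+ 2 <= M ^+ 2 * nm (spread r c y) ^+ 2.
  by rewrite -exprMn ler_pXn2r ?nnegrE ?mulr_ge0 ?nm_ge0.
have [|N|s hs sM] := @series_bounded_cvg R (fun c => nm (g (spread r c y)) ^+ 2) (M ^+ 2 * nm y ^+ 2).
- by move=> c; exact: sqr_ge0.
- apply: le_trans (series_le_lim _ hS N); first by apply: ler_sum => c _; exact: le.
  by move=> c; rewrite mulr_ge0 ?sqr_ge0.
- rewrite -(ler_pXn2r (_ : 0 < 2)%N) ?nnegrE ?mulr_ge0 ?nm_ge0// exprMn.
  exact: le_trans (compress_ampl_bound iso hs) sM.
Qed.

(** The homogeneous parts of g consist of blocks of g. *)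
Lemma degproj_Q (q c : nat) y : degproj c (Q q y) = if (q <= c)%N then degproj c (g (degproj (c - q)%N y)) else 0.
Proof.
have coef a x := degproj_coef c x a.
have [qc|cq] := leqP q c.
  suff /(congr1 (fun A : bop K K => A y)) : degproj c \*b Q q = degproj c \*b g \*b degproj (c - q)%N by rewrite !bopM.
  apply: (bop_eq_coef) => a b.
  rewrite !bopM !coef degprojP linearZ /= hdotZl Q_coef.
  have [E|ac] := eqVneq (deg a) c; last by rewrite !mul0r.
  rewrite -E !mul1r; move: qc; rewrite -E => qc; congr (_ * _); have -> : (deg a == deg b + q)%N = (deg b == deg a - q)%N.
    by apply/eqP/eqP; move: qc; lia.
  by case: (_ == _).
suff /(congr1 (fun A : bop K K => A y)) : degproj c \*b Q q = 0 by rewrite bopM.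
apply: (bop_eq_coef) => a b.
rewrite bopM coef Q_coef bop0 hdot0l; have [ac|ac] := eqVneq (deg a) c; last by rewrite mul0r.
by rewrite (_ : (deg a == _) = false) ?mul0r ?mulr0//; apply/eqP; move: cq; rewrite ac; lia.
Qed.

(** The blocks of Q q have orthogonal ranges and orthogonal supports. *)
Lemma Q_bound q y : nm (Q q y) <= M * nm y.
Proof.
have hp x := degproj_partition x.
have hS := seriesZc (c := M ^+ 2) (hp y).
have pos c : 0 <= M ^+ 2 * nm (degproj c y) ^+ 2 by rewrite mulr_ge0 ?sqr_ge0.
rewrite -(ler_pXn2r (_ : 0 < 2)%N) ?nnegrE ?mulr_ge0 ?nm_ge0// exprMn.
apply: (cvg_le (hp (Q q y))); apply: filterE => N.
apply: (@le_trans _ _ (series (fun c => nm (degproj (c + q)%N (Q q y)) ^+ 2) N)).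
  have z c : (c < q)%N -> nm (degproj c (Q q y)) ^+ 2 = 0.
    by move=> cq; rewrite degproj_Q leqNgt cq nm0 expr0n.
  elim: N => [|N IH]; first by rewrite !series0.
  have [Nq|qN] := ltnP N q.
    rewrite /series /= big_nat big1; last by move=> c /andP[_ cN]; rewrite z//; move: cN Nq; lia.
    by apply: sumr_ge0 => c _; exact: sqr_ge0.
  have [j ->] : exists j, N = (j + q)%N by exists (N - q)%N; rewrite subnK.
  have E : series (fun c => nm (degproj c (Q q y)) ^+ 2) (j + q).+1 = series (fun c => nm (degproj (c + q)%N (Q q y)) ^+ 2) j.+1.
    elim: j => [|j IHj].
      rewrite add0n [LHS]seriesS [RHS]seriesS series0; congr (_ + _); rewrite /series /= big_nat; apply: big1 => c /andP[_ cq]; by rewrite z.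
    by rewrite addSn seriesS IHj [RHS]seriesS.
  by rewrite E; apply: series_mono => [c|]; [exact: sqr_ge0|lia].
apply: le_trans (series_le_lim pos hS N); apply: ler_sum => c _.
rewrite degproj_Q leq_addl addnK -exprMn ler_pXn2r ?nnegrE ?mulr_ge0 ?nm_ge0//.
apply: le_trans (g_bound _); apply: (diagonal_le _ _ _ (degprojP _)).
by move=> a; rewrite ler0n lern1 leq_b1.
Qed.

Definition abel_sum r N : bop K K := series (fun q => (r ^+ q)%:C *: Q q) N.

Lemma abel_sum_diff r N N' y : 0 <= r < 1 -> (N <= N')%N ->
  nm ((abel_sum r N' - abel_sum r N) y) <= M * nm y * (r ^+ N / (1 - r)).
Proof.
move=> /andP[r0 r1] NN'; have r1' : 0 < 1 - r by rewrite subr_gt0.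
suff : nm ((abel_sum r N' - abel_sum r N) y) <= M * nm y * ((r ^+ N - r ^+ N') / (1 - r)).
  move=> /le_trans; apply; rewrite ler_wpM2l ?mulr_ge0 ?nm_ge0// ler_pM2r ?invr_gt0//.
  by rewrite gerBl exprn_ge0.
move: NN' => /subnK <-; elim: (N' - N)%N => [|j IH].
  by rewrite add0n !subrr bop0 nm0 mul0r mulr0.
rewrite addSn /abel_sum seriesS -/(abel_sum r _) addrAC bopD bopZ.
rewrite (le_trans (nmD _ _))// (le_trans (lerD IH _) (_ : _ + (r ^+ (j + N)) * (M * nm y) <= _))//.
  by rewrite nmZ cabs_real ger0_norm ?exprn_ge0// ler_wpM2l ?exprn_ge0// Q_bound.
rewrite le_eqVlt; apply/orP; left; apply/eqP; rewrite exprS; field.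
by rewrite gt_eqF.
Qed.

Lemma abel_sum_bound r N y : 0 <= r < 1 -> nm (abel_sum r N y) <= M / (1 - r) * nm y.
Proof.
move=> r01; have := abel_sum_diff r 0 N y r01 (leq0n _).
rewrite /abel_sum series0 subr0 expr0 => /le_trans; apply.
by rewrite mul1r mulrAC.
Qed.

(** The partial sums converge in norm by the bound on the homogeneous parts; the limit is
    identified by its matrix coefficients. *)
Lemma abel_sum_cvg r y : 0 <= r < 1 -> (fun N => abel_sum r N y) @ \oo --> abel r y.
Proof.
move=> r01; have /andP[r0 r1] := r01; have r1' : 0 < 1 - r by rewrite subr_gt0.
have small x (eps : R) : 0 < eps -> exists N, forall N', (N <= N')%N -> nm ((abel_sum r N' - abel_sum r N) x) < eps.
  move=> eps0; pose C := M * nm x / (1 - r) + 1.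
  have C0 : 0 < C by rewrite ltr_wpDl// divr_ge0 ?mulr_ge0 ?nm_ge0// ltW.
  have /cvgn_eps /(_ (eps / C)) [|N hN] : (fun N => r ^+ N) @ \oo --> (0 : R).
    by apply: cvg_expr; rewrite ger0_norm.
    by rewrite divr_gt0.
  exists N => N' NN'; apply: le_lt_trans (abel_sum_diff r N N' x r01 NN') _.
  have := hN N (leqnn _); rewrite sub0r normrN ger0_norm ?exprn_ge0// ltr_pdivlMr// => h.
  apply: le_lt_trans h; rewrite /C mulrDr mulr1 -[leLHS]addr0 lerD ?exprn_ge0//.
  by rewrite le_eqVlt; apply/orP; left; apply/eqP; field; rewrite gt_eqF.
have ex x : exists l : K, (fun N => abel_sum r N x) @ \oo --> l.
  apply: hcauchy_cvg => eps eps0; have [|N hN] := small x (eps / 2); first by rewrite divr_gt0.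
  exists N => i j /hN hi /hN hj.
  have -> : abel_sum r i x - abel_sum r j x = (abel_sum r i - abel_sum r N) x - (abel_sum r j - abel_sum r N) x.
    by rewrite !bopB opprB addrA subrK.
  by rewrite (le_lt_trans (nmD _ _))// nmN; move: hi hj; lra.
pose S x := sval (cid (ex x)).
have hS x : (fun N => abel_sum r N x) @ \oo --> S x by exact: svalP (cid (ex x)).
have lin : linear S.
  move=> c x y'; apply: eq_rip => z.
  apply: (cvgr_uniq (cvg_ripl (y := z) (hS (c *: x + y')))).
  rewrite (_ : (fun N => rip (abel_sum r N (c *: x + y')) z) =
     fun N => rip (abel_sum r N x) (Num.conj c *: z) + rip (abel_sum r N y') z); last first.
    by apply/funext => N; rewrite linearP ripDl; congr (_ + _); rewrite /rip hdotZl hdotZr conjCK.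
  rewrite ripDl (_ : rip (c *: S x) z = rip (S x) (Num.conj c *: z)); last by rewrite /rip hdotZl hdotZr conjCK.
  by apply: cvgD; apply: cvg_ripl.
have bnd x : nm (S x) <= M / (1 - r) * nm x.
  by apply: (cvg_le (cvg_nm (hS x))); apply: filterE => N; exact: abel_sum_bound.
suff -> : abel r = sval (mk_bop lin bnd) by rewrite (svalP (mk_bop lin bnd)).
apply: (bop_eq_coef) => a b; rewrite (svalP (mk_bop lin bnd)) abel_coef//.
apply/esym/eqP; rewrite -subr_eq0; apply/eqP.
have E N : (deg a < N)%N -> '[abel_sum r N (u b), u a] = (r ^+ (deg a - deg b))%:C * '[g (u b), u a].
  move=> aN; have sc : '[abel_sum r N (u b), u a] = \sum_(q < N) (r ^+ q)%:C * '[Q q (u b), u a].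
    rewrite /abel_sum hdot_series /series /= big_mkord; apply: eq_bigr => q _.
    exact: (hdotZl _ (Q q (u b)) (u a)).
  rewrite sc; have [ab|ba] := ltnP (deg a) (deg b).
    by rewrite g_lower// mulr0; apply: big1 => q _; rewrite Q_coef g_lower// !mulr0.
  have hq : (deg a - deg b < N)%N by move: ba aN; lia.
  rewrite (bigD1 (Ordinal hq))//= Q_coef /= (subnKC ba) eqxx mul1r big1 ?addr0// => q.
  rewrite -val_eqE /= => qn; rewrite Q_coef (_ : (deg a == _) = false) ?mul0r ?mulr0//.
  by apply/eqP => h; case/eqP: qn; rewrite h addKn.
have h c : rip (S (u b)) (c *: u a) = rip (abel_sum r (deg a).+1 (u b)) (c *: u a).
  apply: (cvgr_uniq (cvg_ripl (y := c *: u a) (hS (u b)))); apply/cvgn_eps => eps eps0.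
  exists (deg a).+1 => N aN; rewrite /rip !hdotZr !E//; by rewrite subrr normr0.
rewrite -(E (deg a).+1)// -hdotBl; set z := S _ - _.
have hz c : rip z (c *: u a) = 0 by rewrite ripBl h subrr.
by apply: complex_eq; [have := hz 1; rewrite scale1r|rewrite Im_hdot hz].
Qed.

Definition degpow r : bop K K := diagop (fun a => r ^+ deg a).

Lemma degpowP r : 0 <= r <= 1 -> diag (degpow r) (fun a => r ^+ deg a).
Proof.
by move=> /andP[r0 r1]; apply: diagopP => // a; rewrite exprn_ge0//= exprn_ile1.
Qed.

(** The diagonal operator r ^+ deg conjugates g to its mean. As it tends strongly to the
    identity, this and the uniform bound on the means give their strong convergence to g. *)
Lemma abel_degpow r y : 0 <= r < 1 -> abel r (degpow r y) = degpow r (g y).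
Proof.
move=> r01; have r01' : 0 <= r <= 1 by case/andP: r01 => -> /ltW.
suff E : abel r \*b degpow r = degpow r \*b g by rewrite -bopM E.
apply: (bop_eq_coef) => a b; rewrite !bopM (degpowP r r01').
rewrite linearZ /= hdotZl abel_coef// (diagonal_dot _ _ _ _ (degpowP r r01')).
have [ab|ba] := ltnP (deg a) (deg b); first by rewrite g_lower// !mulr0.
by rewrite mulrA -rmorphM -exprD subnKC.
Qed.

Lemma degpow_cvg y : (fun r => degpow r y) @ 1^'- --> y.
Proof.
have [_ hy] := tseq_expansion y.
pose d (r : R) (a : mw) : R := 1 - (if 0 <= r <= 1 then r else 1) ^+ deg a.
have d01 r a : 0 <= d r a <= 1.
  rewrite /d; set r' := if _ then _ else _.
  have /andP[h0 h1] : 0 <= r' <= 1 by rewrite /r'; case: ifP => //; rewrite ler01 lexx.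
  by rewrite subr_ge0 exprn_ile1//= gerBl exprn_ge0.
pose A r := diagop (d r).
have AP r : diag (A r) (d r) by exact: diagopP.
suff : (fun r => nm (A r y) ^+ 2) @ 1^'- --> (0 : R).
  move=> /cvgr_eps h; apply/hcvg_eps => eps eps0.
  near=> r.
  have r01 : 0 <= r <= 1.
    apply/andP; split; last by near: r; exact: nbhs_left_le.
    by near: r; apply: nbhs_left_ge; exact: ltr01.
  have -> : y - degpow r y = A r y.
    rewrite -[in LHS](bop1 y) -bopB.
    suff -> : bop_id K - degpow r = A r by [].
    apply: (bop_eq_tbasis) => a.
    by rewrite bopB bop1 (degpowP r r01) AP /d r01 rmorphB scalerBl scale1r.
  rewrite -(ltr_pXn2r (_ : 0 < 2)%N) ?nnegrE ?nm_ge0 ?(ltW eps0)//.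
  have : `|0 - nm (A r y) ^+ 2| < eps ^+ 2 by near: r; apply: h; rewrite exprn_gt0.
  by rewrite sub0r normrN ger0_norm// sqr_ge0.
apply: (dominated_series_cvg0 (a := fun r l => dseq (d r) l ^+ 2 * cabs '[y, tseq l] ^+ 2)
  (w := fun l => cabs '[y, tseq l] ^+ 2) _ hy).
- move=> r l; rewrite normrM !ger0_norm ?sqr_ge0// ler_piMl ?sqr_ge0//.
  by apply: dseq_sqr_le1 => a; exact: d01.
- move=> l; rewrite /dseq; case: pickle_inv => [b|]; last first.
    by under eq_fun do rewrite expr0n mul0r; exact: cvg_cst.
  rewrite -[X in _ --> X](mul0r (cabs '[y, tseq l] ^+ 2)); apply: cvgM; last exact: cvg_cst.
  rewrite -[X in _ --> X](expr0n R 2).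
  apply: cvg_exprn.
  rewrite -[X in _ --> X](subrr 1); apply: cvgB; first exact: cvg_cst.
  rewrite -[X in _ --> X](expr1n R (deg b)); apply: cvg_exprn.
  apply/cvgr_eps => eps eps0; near=> r.
  case: ifP => _; last by rewrite subrr normr0.
  near: r; have : (fun r : R => r) @ 1^'- --> (1 : R) by apply: cvg_at_left_filter; exact: cvg_id.
  by move=> /cvgr_eps; apply.
- by move=> r; exact: diagonal_nm.
Unshelve. all: by end_near. Qed.

Lemma abel_cvg y : (fun r => abel r y) @ 1^'- --> g y.
Proof.
apply/hcvg_eps => eps eps0.
have C0 : 0 < M + 1 by rewrite ltr_wpDl.
have /hcvg_eps /(_ (eps / 2 / (M + 1))) h1 := degpow_cvg y.
have /hcvg_eps /(_ (eps / 2)) h2 := degpow_cvg (g y).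
near=> r.
have r01 : 0 <= r < 1.
  apply/andP; split; last by near: r; exact: nbhs_left_lt.
  by near: r; apply: nbhs_left_ge; exact: ltr01.
have e1 : nm (y - degpow r y) < eps / 2 / (M + 1) by near: r; apply: h1; rewrite !divr_gt0.
have e2 : nm (g y - degpow r (g y)) < eps / 2 by near: r; apply: h2; rewrite divr_gt0.
have -> : g y - abel r y = (g y - degpow r (g y)) - abel r (y - degpow r y).
  by rewrite linearB /= abel_degpow// opprB addrA subrK.
have e3 := abel_bound r (y - degpow r y) r01.
rewrite (le_lt_trans (nmD _ _))// nmN.
move: e1; rewrite ltr_pdivlMr//; have := nm_ge0 (y - degpow r y); nra.
Unshelve. all: by end_near. Qed.

End AbelMeans.

(** * The universal model *)

Section WeightedShifts.
Variables (m : 'I_k -> nat) (f : forall i, seq 'I_(n i) -> R).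
Hypothesis f_ge0 : forall i w, 0 <= f i w.
Hypothesis f_nil : forall i, f i [::] = 0.
Hypothesis f_letter : forall i j, 0 < f i [:: j].
Hypothesis m_gt0 : forall i, (0 < m i)%N.
Variable w : forall i, 'I_(n i) -> bop (F i) (F i).
Hypothesis hw : weighted_shifts f m e w.
Variable W : forall i, 'I_(n i) -> bop K K.
Hypothesis hW : ampliation t W w.

Definition bw i (x : seq 'I_(n i)) : R := wt (f i) (m i) x.
Definition mweight a : R := \prod_i bw i (a i).

Lemma bw_gt0 i x : 0 < bw i x. Proof. exact: wt_gt0. Qed.
Lemma mweight_gt0 a : 0 < mweight a.
Proof. by apply: prodr_gt0 => i _; exact: bw_gt0. Qed.

Lemma mweight_dfwith a i x : mweight (dfwith a i x) = mweight a * (bw i x / bw i (a i)).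
Proof.
have E b : mweight b = bw i (b i) * \prod_(j | j != i) bw j (b j) by rewrite /mweight (bigD1 i).
rewrite !E dfwithin.
rewrite (eq_bigr (fun j => bw j (a j))) => [|j ji]; last by rewrite dfwithout// eq_sym.
by field; rewrite gt_eqF// bw_gt0.
Qed.

(** In this rescaled basis the weighted shifts act without weights. The body is locked so
    that rewriting does not see the scalar. *)
Definition zvec a : K := locked ((Num.sqrt (mweight a))^-1%:C *: u a).

Lemma zvecE a : zvec a = (Num.sqrt (mweight a))^-1%:C *: u a.
Proof. by rewrite /zvec -lock. Qed.

Lemma sqrt_mweight_neq0 a : Num.sqrt (mweight a) != 0.
Proof. by rewrite gt_eqF// sqrtr_gt0 mweight_gt0. Qed.

Lemma tbasis_zvec a : u a = (Num.sqrt (mweight a))%:C *: zvec a.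
Proof. by rewrite zvecE scalerA -rmorphM mulfV ?sqrt_mweight_neq0// scale1r. Qed.

Lemma zvec_dot a b : '[zvec a, zvec b] = ([forall i, a i == b i])%:R * (mweight a)^-1%:C.
Proof.
rewrite !zvecE hdotZl hdotZr conj_real tbasis_dot//; case: (mw_eqP a b) => [<-|]; last first.
  by rewrite !mulr0 mul0r.
by rewrite mulr1 mul1r -rmorphM -invfM -expr2 sqr_sqrtr// ltW// mweight_gt0.
Qed.

Lemma eq_zvec (x y : K) : (forall a, '[x, zvec a] = '[y, zvec a]) -> x = y.
Proof.
move=> h; apply: (eq_tbasis) => a.
by rewrite tbasis_zvec !hdotZr h.
Qed.

Lemma bop_eq_zvec (V : hilbertType R) (A B : bop K V) : (forall a, A (zvec a) = B (zvec a)) -> A = B.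
Proof.
move=> h; suff E : adj A = adj B by rewrite -[A]adjK E adjK.
by apply: bop_eq => x; apply: eq_zvec => a; rewrite -!adjPr h.
Qed.

Lemma W_zvec i j a : W i j (zvec a) = zvec (dfwith a i (j :: a i)).
Proof.
rewrite !zvecE linearZ /= {1}/tbasis hW hw tensorZ// (dfwith_map _ _ e a) scalerA -rmorphM.
congr (_%:C *: _); rewrite !weightE// mweight_dfwith -!/(bw i _).
have s1 x y : Num.sqrt (bw i x / bw i y) = Num.sqrt (bw i x) / Num.sqrt (bw i y).
  by rewrite sqrtrM ?sqrtrV// ltW// bw_gt0.
rewrite s1 sqrtrM ?s1; last by rewrite ltW// mweight_gt0.
have s0 x : Num.sqrt (bw i x) != 0 by rewrite gt_eqF// sqrtr_gt0 bw_gt0.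
by field; rewrite !s0 sqrt_mweight_neq0.
Qed.

Lemma word_op_zvec i x a : word_op (W i) x (zvec a) = zvec (dfwith a i (x ++ a i)).
Proof.
elim: x => [|j x IH] /=; first by rewrite dfwith_same.
by rewrite IH W_zvec dfwithin dfwith_dfwith.
Qed.

Lemma mword_op_zvec v a : mword_op W v (zvec a) = zvec (fun i => v i ++ a i).
Proof.
rewrite /mword_op; have : uniq (enum 'I_k) by exact: enum_uniq.
rewrite (_ : (fun i => v i ++ a i) = fun i => if i \in enum 'I_k then v i ++ a i else a i); last first.
  by apply: functional_extensionality_dep => i; rewrite mem_enum.
elim: (enum 'I_k) => [|i s IH] //= /andP[si us].
rewrite IH// word_op_zvec; congr zvec.
apply: functional_extensionality_dep => j; rewrite inE; have [->|ij] := eqVneq j i.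
  by rewrite dfwithin (negbTE si).
by rewrite dfwithout// eq_sym.
Qed.

Lemma W_commute : entries_commute R k n K W.
Proof.
move=> s q j l sq; apply: bop_eq_zvec => a; rewrite !bopM !W_zvec; congr zvec.
have qs : q != s by rewrite eq_sym.
rewrite (dfwithout a (l :: a q) qs) (dfwithout a (j :: a s) sq).
apply: functional_extensionality_dep => i.
have [<-|si] := eqVneq s i.
  by rewrite dfwithin (dfwithout _ (l :: a q) qs) dfwithin.
rewrite (dfwithout _ (j :: a s) si); have [<-|qi] := eqVneq q i; first by rewrite !dfwithin.
by rewrite (dfwithout _ (l :: a q) qi) (dfwithout _ (l :: a q) qi) (dfwithout _ (j :: a s) si).
Qed.

Lemma adj_word_op_zvec i x a : adj (word_op (W i) x) (zvec a) =
  if prefix x (a i) then (bw i (drop (size x) (a i)) / bw i (a i))%:C *: zvec (dfwith a i (drop (size x) (a i)))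
  else 0.
Proof.
apply: eq_zvec => b; rewrite -adjPr word_op_zvec zvec_dot.
case: (mw_eqP) => [->|ab]; last first.
  rewrite mul0r; case: ifPn => [xa|_]; last by rewrite hdot0l.
  rewrite hdotZl zvec_dot; case: (mw_eqP) => [h|_]; last by rewrite mul0r mulr0.
  case: ab; rewrite -h dfwithin dfwith_dfwith.
  have -> : x ++ drop (size x) (a i) = a i by move: xa => /prefixP[s ->]; rewrite drop_size_cat.
  by rewrite dfwith_same.
rewrite dfwithin prefix_prefix drop_size_cat// dfwith_dfwith dfwith_same mul1r hdotZl zvec_dot.
rewrite (introT (mw_eqP _ _) erefl) mul1r -rmorphM; congr _%:C; rewrite mweight_dfwith.
by field; rewrite !gt_eqF ?mweight_gt0 ?bw_gt0.
Qed.

Lemma diagonal_zvec A (d : mw -> R) : diag A d <-> forall a, A (zvec a) = (d a)%:C *: zvec a.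
Proof.
split=> h a; first by rewrite zvecE linearZ /= h !scalerA mulrC.
by rewrite tbasis_zvec linearZ /= h !scalerA mulrC.
Qed.

Lemma diagonal1 : diag (bop_id K) (fun=> 1).
Proof. by move=> a; rewrite bop1 scale1r. Qed.

Lemma diagonalB A B d d' : diag A d -> diag B d' -> diag (A - B) (fun a => d a - d' a).
Proof. by move=> hA hB a; rewrite bopB hA hB rmorphB scalerBl. Qed.

(** Of all words of length p, only the prefix of the i-th word contributes. *)
Lemma diagonal_Phi_comp i A d p : diag A d -> diag (Phi_comp R k n f K W i A p)
  (fun a => if (p <= size (a i))%N then
     f i (take p (a i)) * bw i (drop p (a i)) / bw i (a i) * d (dfwith a i (drop p (a i))) else 0).
Proof.
move=> /diagonal_zvec hA; apply/diagonal_zvec => a; rewrite /Phi_comp bop_sum.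
have E (x : p.-tuple 'I_(n i)) :
    ((f i x)%:C *: (word_op (W i) x \*b A \*b adj (word_op (W i) x))) (zvec a) =
    if prefix x (a i) then (f i x * bw i (drop p (a i)) / bw i (a i) * d (dfwith a i (drop p (a i))))%:C *: zvec a else 0.
  rewrite bopZ !bopM adj_word_op_zvec size_tuple; case: ifPn => xa; last by rewrite !linear0.
  rewrite !linearZ /= hA !linearZ /= word_op_zvec dfwithin dfwith_dfwith.
  have -> : x ++ drop p (a i) = a i.
    by move: xa => /prefixP[s ->]; rewrite drop_size_cat// size_tuple.
  by rewrite dfwith_same !scalerA -!rmorphM; congr (_%:C *: _); ring.
rewrite (eq_bigr _ (fun x _ => E x)); case: ifPn => pa; last first.
  rewrite scale0r big1// => x _; case: ifPn => // /size_prefix; rewrite size_tuple => h.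
  by rewrite h in pa.
have sz : size (take p (a i)) == p by rewrite size_takel.
rewrite (bigD1 (Tuple sz))//= prefix_take big1 ?addr0// => x xt.
case: ifPn => // xa; case/eqP: xt; apply: val_inj => /=.
by move: xa => /prefixP[s ->]; rewrite take_size_cat// size_tuple.
Qed.

Lemma diagonal_Phi_sum i A d N : diag A d -> diag (Phi_sum f W i A N)
  (fun a => \sum_(p < N) if (p < size (a i))%N then
     f i (take p.+1 (a i)) * bw i (drop p.+1 (a i)) / bw i (a i) * d (dfwith a i (drop p.+1 (a i))) else 0).
Proof.
move=> hA a; rewrite Phi_sumE /series /= bop_sum rmorph_sum scaler_suml /= big_mkord.
by apply: eq_bigr => p _; rewrite (diagonal_Phi_comp _ _ _ _ hA).
Qed.

(** The action of Phi_i on the diagonal operators whose eigenvalues are functions of the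
    i-th word; the other coordinates go along as a factor. *)
Definition shift_diag i (g : seq 'I_(n i) -> R) x : R := conv (f i) (fun y => bw i y * g y) x / bw i x.

Lemma shift_diag_ge0 i g : (forall x, 0 <= g x) -> forall x, 0 <= shift_diag i g x.
Proof.
move=> g0 x; rewrite divr_ge0 ?(ltW (bw_gt0 _ _))//; apply: sumr_ge0 => s _.
by rewrite !mulr_ge0// ltW// bw_gt0.
Qed.

(** Since b = b' + f * b, where b' are the weights of order m - 1, f * b is at most b. *)
Lemma shift_diag_le1 i g : (forall x, g x <= 1) -> forall x, shift_diag i g x <= 1.
Proof.
move=> g1 x; rewrite /shift_diag ler_pdivrMr ?bw_gt0// mul1r.
apply: (@le_trans _ _ (conv (f i) (wt (f i) (m i)) x)).
  apply: ler_sum => s _; rewrite ler_wpM2l// ler_piMr// ltW//; exact: bw_gt0.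
by rewrite /bw; case: (m i) (m_gt0 i) => [//|q] _ /=; rewrite [leRHS]wt_recur// lerDr wt_ge0.
Qed.

Lemma shift_diagE i g (a : mw) (h : mw -> R) N : (forall a y, h (dfwith a i y) = h a) -> (size (a i) <= N)%N ->
  \sum_(p < N) (if (p < size (a i))%N then f i (take p.+1 (a i)) * bw i (drop p.+1 (a i)) / bw i (a i) *
    (g (dfwith a i (drop p.+1 (a i)) i) * h (dfwith a i (drop p.+1 (a i)))) else 0)
  = shift_diag i g (a i) * h a.
Proof.
move=> hh aN; rewrite /shift_diag /conv big_ord_recl take0 f_nil mul0r add0r -!mulrA.
rewrite (big_ord_widen_cond N predT (fun p => f i (take p.+1 (a i)) * (bw i (drop p.+1 (a i)) * g (drop p.+1 (a i)))))//.
rewrite [in RHS]big_mkcond /= mulr_suml; apply: eq_bigr => p _; case: ifP => _; last by rewrite mul0r.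
by rewrite dfwithin hh !mulrA; ring.
Qed.

Lemma W_Phi_defined i : Phi_defined f W i.
Proof.
apply: (Phi_definedP R k n f K W f_ge0 i 1) => N x; rewrite mul1r.
apply: (diagonal_quad_le); first exact: (diagonal_Phi_sum _ _ _ _ diagonal1).
move=> a; have := @shift_diagE i (fun=> 1) a (fun=> 1) (maxn N (size (a i))) (fun _ _ => erefl) (leq_maxr _ _).
rewrite (mulr1 (1 : R)) => E; apply: (@le_trans _ _ (shift_diag i (fun=> 1) (a i))).
  rewrite -[leRHS]mulr1 -E -!(big_mkord predT (fun p => if (p < size (a i))%N then
     f i (take p.+1 (a i)) * bw i (drop p.+1 (a i)) / bw i (a i) * _ else 0)) /=.
  rewrite [leRHS](@big_cat_nat _ _ _ N)//= ?leq_maxl//.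
  rewrite lerDl; apply: sumr_ge0 => p _; case: ifP => // _.
  by rewrite !mulr_ge0// ?invr_ge0 ltW// bw_gt0.
exact: shift_diag_le1.
Qed.

Lemma diagonal_Phi i A (g : seq 'I_(n i) -> R) (h : mw -> R) : (forall a y, h (dfwith a i y) = h a) ->
  diag A (fun a => g (a i) * h a) -> diag (Phi f W i A) (fun a => shift_diag i g (a i) * h a).
Proof.
move=> hh hA a; apply: (eq_tbasis) => b.
have c := Phi_cvg R k n f K W W_Phi_defined i A (u a) (u b).
apply: (cvgc_uniq c); apply/cvgc_eps => eps eps0.
exists (size (a i)) => // N /= aN; rewrite (diagonal_Phi_sum _ _ _ _ hA) (shift_diagE _ _ _ h)//.
by rewrite subrr cabs0.
Qed.

Lemma prod_dfwith (g : forall i, seq 'I_(n i) -> R) s i a y : i \notin s ->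
  \prod_(j <- s) g j (dfwith a i y j) = \prod_(j <- s) g j (a j).
Proof.
move=> si; apply: eq_big_seq => j js; rewrite dfwithout//.
by apply: contraNneq si => ->.
Qed.

(** On eigenvalues, 1 - Phi_i is multiplication by 1 - f, so each step lowers the exponent
    of the power series (1 - f)^(-m) by one. *)
Lemma diagonal_iter_defect i A (h : mw -> R) p : (p <= m i)%N -> (forall a y, h (dfwith a i y) = h a) ->
  diag A h -> diag (iter p (fun Z => Z - Phi f W i Z) A)
    (fun a => wt (f i) (m i - p) (a i) / bw i (a i) * h a).
Proof.
move=> pm hh hA; elim: p pm => [|p IH] pm.
  by move=> a /=; rewrite hA subn0 divff ?mul1r// gt_eqF// bw_gt0.
have {}IH := IH (ltnW pm) => /=.
have h2 := diagonalB _ _ _ _ IH (diagonal_Phi i _ (fun x => wt (f i) (m i - p) x / bw i x) h hh IH).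
move=> a; rewrite h2; congr (_%:C *: _); rewrite -mulrBl; congr (_ * _).
rewrite /shift_diag -mulrBl; congr (_ / _).
have -> : (fun y => bw i y * (wt (f i) (m i - p) y / bw i y)) = wt (f i) (m i - p).
  by apply/funext => y; rewrite mulrC divfK// gt_eqF// bw_gt0.
have -> : (m i - p = (m i - p.+1).+1)%N by rewrite subnSK.
by rewrite [X in X - _]wt_recur// addrK.
Qed.

Lemma diagonal_Delta p : (forall i, (p i <= m i)%N) -> diag (Delta f W p (bop_id K))
  (fun a => \prod_(i <- enum 'I_k) (wt (f i) (m i - p i) (a i) / bw i (a i))).
Proof.
move=> pm; rewrite /Delta; have : uniq (enum 'I_k) by exact: enum_uniq.
elim: (enum 'I_k) => [|i s IH] /=.
  by move=> _ a; rewrite big_nil diagonal1.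
move=> /andP[si us] a; rewrite big_cons.
apply: (diagonal_iter_defect i _ (fun a => \prod_(j <- s) _) _ (pm i) _ (IH us)) => b y.
exact: (prod_dfwith (fun i x => wt (f i) (m i - p i) x / bw i x)).
Qed.

Theorem W_polydomain : polydomain f m W.
Proof.
split; [exact: W_commute|exact: W_Phi_defined|move=> p pm].
apply: (diagonal_psd _ _ (diagonal_Delta p pm)) => a.
by apply: prodr_ge0 => i _; rewrite divr_ge0 ?wt_ge0// ltW// bw_gt0.
Qed.

Definition shiftpow i q : seq 'I_(n i) -> R := iter q (shift_diag i) (fun=> 1).

Lemma shiftpow_01 i q x : 0 <= shiftpow i q x <= 1.
Proof.
elim: q x => [|q IH] x /=; first by rewrite ler01 lexx.
apply/andP; split; first by apply: shift_diag_ge0 => y; have /andP[] := IH y.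
by apply: shift_diag_le1 => y; have /andP[] := IH y.
Qed.

Lemma shiftpow_short i q x : (size x < q)%N -> shiftpow i q x = 0.
Proof.
elim: q x => [//|q IH] x xq; rewrite /shiftpow /= -/(shiftpow i q) /shift_diag /conv big1 ?mul0r//.
move=> [[|s] hs] _ /=; first by rewrite take0 f_nil mul0r.
rewrite IH ?mulr0// size_drop; move: hs xq; lia.
Qed.

Lemma diagonal_iter_Phi i A (h : mw -> R) q : (forall a y, h (dfwith a i y) = h a) ->
  diag A h -> diag (iter q (Phi f W i) A) (fun a => shiftpow i q (a i) * h a).
Proof.
move=> hh hA; elim: q => [|q IH] /=; first by move=> a; rewrite hA mul1r.
exact: (diagonal_Phi i _ (shiftpow i q) h hh IH).
Qed.

Lemma diagonal_purity (q : 'I_k -> nat) :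
  diag (foldl (fun Z i => Z - iter (q i) (Phi f W i) Z) (bop_id K) (enum 'I_k))
    (fun a => \prod_(i <- rev (enum 'I_k)) (1 - shiftpow i (q i) (a i))).
Proof.
rewrite -[in X in foldl _ _ X](revK (enum 'I_k)) foldl_rev.
have : uniq (rev (enum 'I_k)) by rewrite rev_uniq enum_uniq.
elim: (rev (enum 'I_k)) => [|i s IH] /=.
  by move=> _ a; rewrite big_nil diagonal1.
move=> /andP[si us] a; rewrite big_cons mulrBl mul1r.
apply: (diagonalB _ _ _ _ (IH us) (diagonal_iter_Phi i _ _ (q i) _ (IH us))) => b y.
exact: (prod_dfwith (fun i x => 1 - shiftpow i (q i) x)).
Qed.

(** The eigenvalue of Phi_i^q(1) at a multi-index vanishes as soon as q exceeds the length
    of the i-th word. *)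
Theorem W_pure : pure f W.
Proof.
have FF := @filter_filter _ _ (multi_index_filter k).
apply: (diagonal_wot1 _ _ FF _ _ diagonal_purity).
- move=> q a; elim/big_ind : _ => [|x y /andP[x0 x1] /andP[y0 y1]|i _].
  + by rewrite ler01 lexx.
  + by rewrite mulr_ge0// mulr_ile1.
  + by have /andP[] := shiftpow_01 i (q i) (a i); rewrite subr_ge0 lerBlDr lerDl => -> ->.
- move=> a; apply/cvgr_eps => eps eps0; exists (fun i => (size (a i)).+1) => // q /= hq.
  by rewrite big1 ?subrr ?normr0// => i _; rewrite shiftpow_short ?subr0.
Qed.

(** * Berezin kernels *)

Section BerezinKernels.
Variables (H : hilbertType R) (hH : separable H) (T : forall i, 'I_(n i) -> bop H H).
Hypothesis T_pd : polydomain f m T.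
Hypothesis T_pure : pure f T.

Section Kernel.
Variable eta : nat -> H.
Hypothesis eta_sum : forall x, series (fun p => cabs '[x, eta p] ^+ 2) @ \oo -->
  (quad (Delta f T m (bop_id H)) x : R).

(** The coefficients of the p-th component of the Berezin kernel, obtained from the
    decomposition of the defect operator into the rank one operators of the eta p. *)
Definition kernel_coef p x l : R[i] :=
  if @pickle_inv (multiword n) l is Some b
  then (Num.sqrt (mweight b))%:C * '[x, mword_op T b (eta p)] else 0.

(** Exchanging the sums over p and over the multi-indices leaves the resolution of the norm. *)
Lemma kernel_coef_sum x : exists2 s : nat -> R,
  forall p, series (fun l => cabs (kernel_coef p x l) ^+ 2) @ \oo --> s p &
  series s @ \oo --> (nm x ^+ 2 : R).
Proof.
pose g p (b : multiword n) : R := mweight b * cabs '[x, mword_op T b (eta p)] ^+ 2.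
have g0 p (b : multiword n) : 0 <= g p b by rewrite mulr_ge0 ?sqr_ge0// ltW// mweight_gt0.
have E : (\esum_(p in [set: nat]) \esum_(b in [set: multiword n]) (g p b)%:E = (nm x ^+ 2)%:E)%E.
  rewrite esum_exchange// (pure_resolution R k n m f f_ge0 f_nil m_gt0 H T T_pd T_pure x).
  apply: eq_esum => b _; apply/series_esum => //.
  have := seriesZc (c := mweight b) (eta_sum (adj (mword_op T b) x)).
  rewrite (_ : (fun p => g p b) = fun p => mweight b * cabs '[adj (mword_op T b) x, eta p] ^+ 2)//.
  by apply/funext => p; rewrite /g adjPr.
have fin p : (\esum_(b in [set: multiword n]) (g p b)%:E \is a fin_num)%E.
  have p0 q : (0 <= \esum_(b in [set: multiword n]) (g q b)%:E)%E.
    by apply: esum_ge0 => b _; rewrite lee_fin.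
  rewrite ge0_fin_numE//; apply: (@le_lt_trans _ _ (nm x ^+ 2)%:E); last exact: ltry.
  by rewrite -E; apply: esum_ge; exists [set p]; [split=> //; exact: finite_set1|rewrite fsbig_set1].
exists (fun p => fine (\esum_(b in [set: multiword n]) (g p b)%:E)).
  move=> p; apply/series_esum => [l|]; first exact: sqr_ge0.
  rewrite fineK// -esum_pickle; apply: eq_esum => l _; rewrite /kernel_coef.
  case: pickle_inv => [b|]; last by rewrite cabs0 expr0n.
  by rewrite cabsM cabs_real exprMn ger0_norm ?sqrtr_ge0// sqr_sqrtr// ltW// mweight_gt0.
apply/series_esum => [p|]; first by apply: fine_ge0; apply: esum_ge0 => b _; rewrite lee_fin.
by rewrite -E; apply: eq_esum => p _; rewrite fineK.
Qed.

Lemma kernel_exists : exists V : nat -> bop H K,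
  (forall p x a, '[V p x, zvec a] = '[x, mword_op T a (eta p)]) /\
  (forall x, series (fun p => nm (V p x) ^+ 2) @ \oo --> (nm x ^+ 2 : R)).
Proof.
have tz p x (y : K) : (forall l, '[y, tseq l] = kernel_coef p x l) <->
    (forall a, '[y, zvec a] = '[x, mword_op T a (eta p)]).
  split=> h.
    move=> a; rewrite zvecE hdotZr conj_real -(tseq_pickle) h /kernel_coef pickleK_inv.
    have -> : ([ffun i => a i] : multiword n) = a :> mw.
      by apply: functional_extensionality_dep => i; rewrite ffunE.
    by rewrite mulrA -rmorphM mulVf ?mul1r// sqrt_mweight_neq0.
  move=> l; rewrite /tseq /kernel_coef; case: pickle_inv => [b|]; last by rewrite hdot0r.
  by rewrite (tbasis_zvec)// hdotZr conj_real h.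
have ex p x : exists y : K, (forall a, '[y, zvec a] = '[x, mword_op T a (eta p)]) /\
   series (fun l => cabs (kernel_coef p x l) ^+ 2) @ \oo --> (nm y ^+ 2 : R).
  have [s hs _] := kernel_coef_sum x.
  have c0 l : tseq l = 0 -> kernel_coef p x l = 0.
    rewrite /tseq /kernel_coef; case: pickle_inv => // b ub0.
    have := tbasis_nm b; rewrite ub0 nm0 => /eqP.
    by rewrite eq_sym oner_eq0.
  have [y [_ hy ys]] := riesz_fischer (tseq_orth) (tseq_norm) c0 (hs p).
  by exists y; rewrite ys; split; [apply/tz|exact: hs].
pose V0 p x := sval (cid (ex p x)).
have hV p x : (forall a, '[V0 p x, zvec a] = '[x, mword_op T a (eta p)]) /\
   series (fun l => cabs (kernel_coef p x l) ^+ 2) @ \oo --> (nm (V0 p x) ^+ 2 : R).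
  exact: svalP (cid (ex p x)).
have V_sum x : series (fun p => nm (V0 p x) ^+ 2) @ \oo --> (nm x ^+ 2 : R).
  have [s hs ss] := kernel_coef_sum x.
  rewrite (_ : (fun p => _) = s)//; apply/funext => p; exact: cvgr_uniq (hV p x).2 (hs p).
have lin p : linear (V0 p).
  move=> c x y; apply: (eq_zvec) => a.
  by rewrite (hV _ _).1 !hdotDl !hdotZl !(hV _ _).1.
have bnd p x : nm (V0 p x) <= 1 * nm x.
  rewrite mul1r -(ler_pXn2r (_ : 0 < 2)%N) ?nnegrE ?nm_ge0//.
  apply: le_trans (series_le_lim _ (V_sum x) p.+1); last by move=> q; rewrite sqr_ge0.
  rewrite seriesS lerDr; apply: sumr_ge0 => q _; exact: sqr_ge0.
exists (fun p => sval (mk_bop (lin p) (bnd p))); split=> [p x a|x].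
  by rewrite (svalP (mk_bop (lin p) (bnd p))) (hV p x).1.
under eq_fun do rewrite (svalP (mk_bop (lin _) (bnd _))).
exact: V_sum.
Qed.

End Kernel.

(** The components of the Berezin kernel form an isometry of H into the sum of countably
    many copies of the model space. Intertwining the adjoints amounts, on coefficients, to
    the multiplicativity of the monomials of T. *)
Theorem berezin_kernels : exists V : nat -> bop H K,
  (forall x, series (fun p => nm (V p x) ^+ 2) @ \oo --> (nm x ^+ 2 : R)) /\
  (forall p a x, adj (mword_op W a) (V p x) = V p (adj (mword_op T a) x)).
Proof.
have [eta heta] := psd_rank_one_decomposition hH (Delta_psd R k n m f H T T_pd).
have [V [hV Vs]] := kernel_exists eta heta; exists V; split=> // p a x.
apply: (eq_zvec) => b.
rewrite -adjPr (mword_op_zvec) !hV.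
have [TC _ _] := T_pd.
by rewrite (mword_op_cat R k n H T a b TC) bopM adjPr.
Qed.

End BerezinKernels.

(** * Fourier series in the Hardy algebra *)

Local Notation hom := (homop R k n K W).
Local Notation cat2 v b := (fun i => v i ++ b i).

Lemma cat2_inj v v' b : cat2 v b = cat2 v' b -> v = v'.
Proof.
move=> h; apply: functional_extensionality_dep => i.
have /eqP := congr1 (fun c : mw => c i) h; rewrite eqseq_cat; first by move=> /andP[/eqP].
by have := congr1 (fun c : mw => size (c i)) h; rewrite !size_cat => /addIn.
Qed.

Lemma deg_cat v b : deg (cat2 v b) = (deg v + deg b)%N.
Proof. by rewrite /deg -big_split; apply: eq_bigr => i _; rewrite size_cat. Qed.

Definition e0 : mw := fun=> [::].

(** The column of g at a basis vector is the translate of its column at the vacuum, as for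
    a formal power series in the W. Both conditions are linear and weakly closed. *)
Definition toeplitz (g : bop K K) :=
  (forall v b, '[g (zvec b), (mweight (cat2 v b))%:C *: zvec (cat2 v b)] =
               '[g (zvec e0), (mweight v)%:C *: zvec v]) /\
  (forall a b, (forall v, a <> cat2 v b) -> '[g (zvec b), zvec a] = 0).

Lemma toeplitz_subspace : is_subspace toeplitz.
Proof.
split; first by split=> *; rewrite !hdot0l.
move=> c A B [A1 A2] [B1 B2]; split=> [v b|a b ab].
  by rewrite !bopD !bopZ !hdotDl !hdotZl A1 B1.
by rewrite bopD bopZ hdotDl hdotZl A2// B2// mulr0 addr0.
Qed.

Lemma toeplitz_mword v : toeplitz (mword_op W v).
Proof.
have act b := mword_op_zvec v b.
have dot a b := zvec_dot a b.
have nz a : mweight a != 0 by rewrite gt_eqF// mweight_gt0.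
split=> [v' b|a b ab]; last first.
  by rewrite act dot; case: (mw_eqP) => [h|]; [case: (ab v)|rewrite mul0r].
rewrite !act !hdotZr !conj_real !dot.
have cE : cat2 v e0 = v by apply: functional_extensionality_dep => i; rewrite cats0.
case: (mw_eqP) => [h|vv]; case: (mw_eqP) => [h'|vv'].
- by move: h'; rewrite cE => h'; rewrite h' !mul1r -!rmorphM !mulfV.
- by case: vv'; rewrite cE; exact: (cat2_inj _ _ b).
- by move: h'; rewrite cE => h'; case: vv; rewrite h'.
- by rewrite !mul0r !mulr0.
Qed.

Lemma strong_limit_hdot (p : nat -> bop K K) (g : bop K K) x1 x2 y1 y2 :
  (forall x, (fun q => p q x) @ \oo --> g x) ->
  (forall q, '[p q x1, y1] = '[p q x2, y2]) -> '[g x1, y1] = '[g x2, y2].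
Proof.
move=> hp h.
have lim z1 z2 : (forall q, rip (p q x1) z1 = rip (p q x2) z2) -> rip (g x1) z1 = rip (g x2) z2.
  move=> E; apply: (cvgr_uniq (cvg_ripl (y := z1) (hp x1))).
  under eq_fun do rewrite E; exact: cvg_ripl.
apply: complex_eq; first by apply: lim => q; rewrite /rip h.
by rewrite !Im_hdot; apply: lim => q; rewrite -!Im_hdot h.
Qed.

Lemma Finfty_toeplitz g : Finfty W g -> toeplitz g.
Proof.
move=> [p hp hg]; have tp q : toeplitz (p q).
  apply: (lin_span_ind toeplitz_subspace _ (hp q)) => _ [v _ <-]; exact: toeplitz_mword.
split=> [v b|a b ab]; first by apply: (strong_limit_hdot p) => // q; exact: (tp q).1.
rewrite -(hdot0r (g (zvec b))); apply: (strong_limit_hdot p) => // q.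
by rewrite hdot0r (tp q).2.
Qed.

Section Coefficients.
Variable g : bop K K.
Hypothesis g_toeplitz : toeplitz g.

Definition fourier_coef v : R[i] := (mweight v)%:C * '[g (zvec e0), zvec v].

Lemma fourier_coefE v b : '[g (zvec b), zvec (cat2 v b)] = fourier_coef v / (mweight (cat2 v b))%:C.
Proof.
have := g_toeplitz.1 v b; rewrite !hdotZr !conj_real -/(fourier_coef v) => <-.
by rewrite mulrAC mulfV ?mul1r// fmorph_eq0 gt_eqF// mweight_gt0.
Qed.

(** The homogeneous parts of the Fourier series are the diagonals of the graded matrix of g. *)
Lemma hom_part_coef q a b :
  '[hom fourier_coef q (zvec b), zvec a] = (deg a == deg b + q)%N%:R * '[g (zvec b), zvec a].
Proof.
have act v := mword_op_zvec v b.
have dot a' b' := zvec_dot a' b'.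
rewrite /homop bop_sum hdot_suml.
have E (v : {dffun forall i, q.-bseq 'I_(n i)}) :
    '[(fourier_coef (fun i => v i) *: mword_op W (fun i => v i)) (zvec b), zvec a] =
    fourier_coef (fun i => v i) * ([forall i, cat2 v b i == a i]%:R * (mweight (cat2 v b))^-1%:C).
  by rewrite bopZ hdotZl act dot.
under eq_bigr => v _ do rewrite E.
have [[v av]|nv] := pselect (exists v, a = cat2 v b); last first.
  rewrite g_toeplitz.2 => [|v av]; last by apply: nv; exists v.
  rewrite mulr0 big1// => v _; case: (mw_eqP) => [h|]; last by rewrite mul0r mulr0.
  by case: nv; exists (fun i => v i : seq 'I_(n i)).
rewrite av fourier_coefE deg_cat [in RHS]addnC eqn_add2l.
have [vq|vq] := eqVneq (deg v) q; last first.
  rewrite mul0r big1// => v' /eqP v'q; case: (mw_eqP) => [h|]; last by rewrite mul0r mulr0.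
  have /(cat2_inj _ _ b) vv' : cat2 (fun i => v' i : seq 'I_(n i)) b = cat2 v b by [].
  by case/eqP: vq; rewrite -v'q /deg -vv'.
have sz i : (size (v i) <= q)%N by rewrite -vq /deg (bigD1 i)//= leq_addr.
pose v1 : {dffun forall i, q.-bseq 'I_(n i)} := [ffun i => Bseq (sz i)].
have v1E : (fun i => v1 i : seq 'I_(n i)) = v.
  by apply: functional_extensionality_dep => i; rewrite ffunE.
rewrite (bigD1 v1)/=; last first.
  by rewrite -[X in _ == X]vq /deg; apply/eqP; apply: eq_bigr => i _; rewrite -[in RHS]v1E.
have v1E' : cat2 v1 b = cat2 v b by rewrite -[in RHS]v1E.
have v1T : [forall i, (v1 i : seq 'I_(n i)) ++ b i == v i ++ b i].
  by apply/forallP => i; rewrite ffunE.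
rewrite v1E v1E' v1T !mul1r fmorphV big1 ?addr0// => v' /andP[_ v'v].
case: (mw_eqP) => [h|]; last by rewrite mul0r mulr0.
case/eqP: v'v; apply/ffunP => i; apply: val_inj.
have /(cat2_inj _ _ b) vv' : cat2 (fun i => v' i : seq 'I_(n i)) b = cat2 v b by [].
by rewrite -/(v' i : seq 'I_(n i)) /= ffunE /= -vv'.
Qed.

Lemma hom_part_coef_tbasis q a b :
  '[hom fourier_coef q (u b), u a] = (deg a == deg b + q)%N%:R * '[g (u b), u a].
Proof.
rewrite !(tbasis_zvec) !hdotZr !linearZ /= !hdotZl hom_part_coef.
by rewrite !mulrA; congr (_ * _); ring.
Qed.

Lemma toeplitz_lower a b : (deg a < deg b)%N -> '[g (u b), u a] = 0.
Proof.
move=> ab; rewrite !(tbasis_zvec) hdotZr linearZ /= hdotZl.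
rewrite g_toeplitz.2 ?mulr0// => v av; move: ab; rewrite av deg_cat; lia.
Qed.

(** The q-th term at a basis vector u b is the component of g (u b) of degree deg b + q. *)
Lemma fourier_rep_coef : fourier_rep e t W g fourier_coef.
Proof.
move=> b; have := degproj_series (g (u b)).
have hd q : hom_part W fourier_coef q (u b) = degproj (deg b + q)%N (g (u b)).
  rewrite -homopE; apply: (eq_tbasis) => a.
  by rewrite hom_part_coef_tbasis degproj_coef.
have E N : series (fun q => hom_part W fourier_coef q (u b)) N =
    series (fun c => degproj c (g (u b))) (deg b + N)%N.
  elim: N => [|N IH]; last by rewrite addnS !seriesS IH hd.
  rewrite addn0 series0 /series /= big_nat; apply/esym; apply: big1 => c /andP[_ cb].
  apply: (eq_tbasis) => a; rewrite degproj_coef// hdot0l.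
  by case: eqP => [ac|]; rewrite ?mul0r// toeplitz_lower ?mulr0// ac.
move=> /hcvg_eps h; apply/hcvg_eps => eps /h [N0 _ hN]; exists N0 => // N /= NN.
by rewrite E; apply: hN => /=; rewrite (leq_trans NN)// leq_addl.
Qed.

End Coefficients.

(** * Compression to the model space of the variety *)

Section Variety.
Variable J : set (bop K K).
Hypothesis hJ : wstar_closed_left_ideal W J.
Variables (N : hilbertType R) (iota : bop N K).
Hypothesis hiota : forall x y, '[iota x, iota y] = '[x, y].
Hypothesis hiotaJ : range iota = NJ J.
Variables (H : hilbertType R) (hH : separable H) (T : forall i, 'I_(n i) -> bop H H).
Local Notation S := (compression iota W).

Lemma NJP y : NJ J y <-> forall g, J g -> forall x, '[g x, y] = 0.
Proof.
split=> [hy g Jg x|h z]; last by apply: orth_closure => _ [g Jg [x ->]]; exact: h.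
by apply: hy; apply: subset_closure; apply: lin_span_sub; exists g => //; exists x.
Qed.

Lemma letter_Finfty i j : Finfty W (W i j).
Proof.
exists (fun=> W i j) => [_|x]; last exact: cvg_cst.
apply: lin_span_sub; exists (single k n i [:: j]) => //.
by rewrite mword_op_single /= bopM1.
Qed.

(** The image of J is invariant under W since J is a left ideal. *)
Lemma NJ_adj_letter i j y : NJ J y -> NJ J (adj (W i j) y).
Proof.
move=> /NJP h; apply/NJP => g Jg x; rewrite -adjP -bopM; apply: h.
by have [_ _ ideal _] := hJ; apply: ideal => //; exact: letter_Finfty.
Qed.

Lemma NJ_iota z : NJ J (iota z).
Proof. by rewrite -hiotaJ; exists z. Qed.

Lemma iotaK z : adj iota (iota z) = z.
Proof. by apply: eq_rip => y; rewrite -rip_adjr /rip hiota. Qed.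

Lemma iota_proj y : NJ J y -> iota (adj iota y) = y.
Proof. by rewrite -hiotaJ => -[z _ <-]; rewrite iotaK. Qed.

Lemma iota_adj_letter i j z : iota (adj (S i j) z) = adj (W i j) (iota z).
Proof.
rewrite /compression !adjM adjK !bopM iota_proj//.
by apply: NJ_adj_letter; exact: NJ_iota.
Qed.

Lemma iota_adj_word i v z : iota (adj (word_op (S i) v) z) = adj (word_op (W i) v) (iota z).
Proof.
elim: v z => [|j v IH] z /=; first by rewrite !adj1 !bop1.
by rewrite adjM bopM IH iota_adj_letter [in RHS]adjM bopM.
Qed.

Lemma iota_adj_mword a z : iota (adj (mword_op S a) z) = adj (mword_op W a) (iota z).
Proof.
rewrite /mword_op; elim: (enum 'I_k) z => [|i s IH] z /=; first by rewrite !adj1 !bop1.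
by rewrite adjM bopM IH iota_adj_word [in RHS]adjM bopM.
Qed.

Definition compress (A : bop K K) : bop N N := adj iota \*b A \*b iota.

(** Since the range of iota is invariant under the adjoints of W, compression commutes with
    products of this form. *)
Lemma compress_mword a b : compress (mword_op W a \*b adj (mword_op W b)) =
  mword_op S a \*b adj (mword_op S b).
Proof.
apply: bop_eq_rip => x y; rewrite /compress !bopM.
by rewrite rip_adj adjK rip_adj -!iota_adj_mword [RHS]rip_adj /rip hiota.
Qed.

Lemma compress_linear c A B : compress (c *: A + B) = c *: compress A + compress B.
Proof. by apply: bop_eq => x; rewrite /compress !(bopM, bopD, bopZ) linearP. Qed.

Lemma compress_bound (M : R) (A : bop K K) : 0 <= M -> (forall y, nm (A y) <= M * nm y) ->
  forall z, nm (compress A z) <= M * nm z.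
Proof.
have iota_nm z : nm (iota z) = nm z.
  apply: (pexpIrn (n := 2)); rewrite ?nnegrE ?nm_ge0//.
  by rewrite -!ripxx /rip hiota.
move=> M0 hM z; rewrite /compress !bopM.
have hi y : nm (adj iota y) <= 1 * nm y by apply: adj_bound => // x; rewrite iota_nm mul1r.
by rewrite (le_trans (hi _))// mul1r (le_trans (hM _))// iota_nm.
Qed.

Lemma intertwine_hom_part (V : bop H K) c q y :
  (forall a x, adj (mword_op W a) (V x) = V (adj (mword_op T a) x)) ->
  adj V (hom_part W c q y) = hom_part T c q (adj V y).
Proof.
move=> hV; rewrite /hom_part linear_sum; apply: eq_bigr => b _; rewrite linearZ /=; congr (_ *: _).
by apply: eq_rip => z; rewrite -rip_adjr rip_adj hV rip_adjr -rip_adj.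
Qed.

Lemma bop_cvg (U V : hilbertType R) (A : bop U V) (D : Type) (G : set_system D) (FG : Filter G)
  (x : D -> U) l : x @ G --> l -> (fun s => A (x s)) @ G --> A l.
Proof.
have [M M0 hM] := bop_bound A; move=> /hcvg_eps h; apply/hcvg_eps => eps eps0.
have C0 : 0 < M + 1 by rewrite ltr_wpDl.
apply: filterS (h _ (divr_gt0 eps0 C0)) => s; rewrite ltr_pdivlMr// => hs.
rewrite -linearB (le_lt_trans (hM _))//; have := nm_ge0 (l - x s); nra.
Qed.

(** Applied to a vector, the series of g(T) has the Abel limit 0. It is the image under V^*
    of the Fourier series of g at a basis vector, which converges, so its sum is 0 too. *)
Lemma kernel_NJ (V : bop H K) :
  (forall a x, adj (mword_op W a) (V x) = V (adj (mword_op T a) x)) ->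
  (forall g, J g -> exists2 c, fourier_rep e t W g c & func_calculus T c 0) ->
  forall x, NJ J (V x).
Proof.
move=> hV hJT x; apply/NJP => g Jg y; have [c gc Tc] := hJT g Jg.
suff E : adj V \*b g = 0.
  by rewrite hdotC adjP -bopM E bop0 hdot0r conj0.
apply: (bop_eq_tbasis) => b; rewrite bopM bop0.
have [cv lim0] := Tc (adj V (u b)).
apply: eq_rip => z; rewrite rip0l.
pose a q := rip (hom_part T c q (adj V (u b))) z.
have as_ : series a @ \oo --> rip (adj V (g (u b))) z.
  rewrite (_ : series a = fun L => rip (adj V (series (fun q => hom_part W c q (u b)) L)) z).
    by apply: cvg_ripl; apply: bop_cvg; exact: gc.
  apply/funext => L; rewrite /series /= linear_sum rip_suml; apply: eq_bigr => q _.
  by rewrite /= intertwine_hom_part.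
have ar r : 0 < r < 1 -> series (fun q => r ^+ q * a q) @ \oo -->
    rip (limn (series (fun q => (r ^+ q)%:C *: hom_part T c q (adj V (u b))))) z.
  move=> r01; rewrite (_ : series _ = fun L => rip (series (fun q => (r ^+ q)%:C *: hom_part T c q (adj V (u b))) L) z).
    by apply: cvg_ripl; exact: cv.
  by apply/funext => L; rewrite /series /= rip_suml; apply: eq_bigr => q _; rewrite ripZl.
apply: (cvgr_uniq (abel_theorem as_ ar)).
by have := cvg_ripl (y := z) lim0; rewrite bop0 rip0l; apply.
Qed.

(** The kernels take their values in N_J, and Psi is the compression along them. *)
Lemma pure_variety_map : pure_variety f m e t W J T ->
  exists Psi : bop N N -> bop H H,
    [/\ linear_on (op_space S) Psi, unital Psi, completely_positive (op_space S) Psi,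
        wstar_continuous (op_space S) Psi &
        forall a b : mw, Psi (mword_op S a \*b adj (mword_op S b)) =
          mword_op T a \*b adj (mword_op T b)].
Proof.
move=> [T_pd T_pure hJT].
have [V [V_iso hV]] := berezin_kernels H hH T T_pd T_pure.
have VJ p x := kernel_NJ (V p) (hV p) hJT x.
pose U p := adj iota \*b V p.
have iU p x : iota (U p x) = V p x.
  by rewrite bopM (iota_proj).
have U_iso x : series (fun p => nm (U p x) ^+ 2) @ \oo --> (nm x ^+ 2 : R).
  rewrite (_ : (fun p => nm (U p x) ^+ 2) = fun p => nm (V p x) ^+ 2)//.
  by apply/funext => p; rewrite -!ripxx -iU /rip hiota.
have SU a p x : adj (mword_op S a) (U p x) = U p (adj (mword_op T a) x).
  rewrite -[LHS](iotaK) (iota_adj_mword).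
  by rewrite iU hV.
exists (compress_ampl U); split.
- by move=> c A B _ _; exact: compress_ampl_linear.
- exact: compress_ampl1.
- by move=> d A _ pA; exact: (compress_ampl_cp U_iso).
- by apply: continuous_subspaceT; exact: compress_ampl_continuous.
- move=> a b; apply: bop_eq_rip => x y; rewrite /rip compress_amplE//.
  rewrite bopM adjP -[in RHS](bop1 (adj _ x)) -(compress_ampl1 U_iso) compress_amplE//.
  by congr (Re (csum _)); apply/funext => p; rewrite bopM adjP !SU bop1.
Qed.

(** * From the map Psi to the variety *)

Section Backward.
Local Notation E := (op_space S).
Variable Psi : bop N N -> bop H H.
Hypothesis Psi_lin : linear_on E Psi.
Hypothesis Psi_cp : completely_positive E Psi.
Hypothesis Psi_cont : wstar_continuous E Psi.
Hypothesis Psi_gen : forall a b : mw, Psi (mword_op S a \*b adj (mword_op S b)) =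
  mword_op T a \*b adj (mword_op T b).
Implicit Types (A B Y : bop K K).

(** Psi is pulled back to the model space, where products are those of the weighted shifts.
    Admissible operators are those whose compression lies in the domain of Psi. *)
Definition admissible A := E (compress A).
Definition Theta A : bop H H := Psi (compress A).

Lemma E_subspace : is_subspace (E : set (bop N N)).
Proof. exact: (wstar_closure_subspace R N _ (lin_span_subspace _)). Qed.

Lemma compress_word a b : compress (mword_op W a \*b adj (mword_op W b)) = mword_op S a \*b adj (mword_op S b).
Proof. exact: (compress_mword). Qed.

Lemma admissible_word a b : admissible (mword_op W a \*b adj (mword_op W b)).
Proof.
rewrite /admissible compress_word; apply: subset_closure; apply: lin_span_sub.
by exists a, b.
Qed.

Lemma Theta_word a b : Theta (mword_op W a \*b adj (mword_op W b)) = mword_op T a \*b adj (mword_op T b).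
Proof. by rewrite /Theta compress_word Psi_gen. Qed.

Lemma mword_op_nil (V : hilbertType R) (X : forall i, 'I_(n i) -> bop V V) :
  mword_op X (fun=> [::]) = bop_id V.
Proof. by rewrite /mword_op; elim: (enum 'I_k) => [//|i s IH] /=; rewrite IH bop1M. Qed.

Lemma admissible1 : admissible (bop_id K).
Proof.
by have := admissible_word (fun=> [::]) (fun=> [::]); rewrite !mword_op_nil adj1 bop1M.
Qed.

Lemma Theta1 : Theta (bop_id K) = bop_id H.
Proof. by have := Theta_word (fun=> [::]) (fun=> [::]); rewrite !mword_op_nil !adj1 !bop1M. Qed.

Lemma admissible_mword a : admissible (mword_op W a).
Proof. by have := admissible_word a (fun=> [::]); rewrite mword_op_nil adj1 bopM1. Qed.

Lemma Theta_mword a : Theta (mword_op W a) = mword_op T a.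
Proof. by have := Theta_word a (fun=> [::]); rewrite !mword_op_nil !adj1 !bopM1. Qed.

Lemma admissible_adj a : admissible (adj (mword_op W a)).
Proof. by have := admissible_word (fun=> [::]) a; rewrite mword_op_nil bop1M. Qed.

Lemma Theta_adj a : Theta (adj (mword_op W a)) = adj (mword_op T a).
Proof. by have := Theta_word (fun=> [::]) a; rewrite !mword_op_nil !bop1M. Qed.

Lemma admissible_linear c A B : admissible A -> admissible B -> admissible (c *: A + B).
Proof. by move=> hA hB; rewrite /admissible compress_linear; apply: E_subspace.2. Qed.

Lemma Theta_linear c A B : admissible A -> admissible B -> Theta (c *: A + B) = c *: Theta A + Theta B.
Proof. by move=> hA hB; rewrite /Theta compress_linear Psi_lin. Qed.

Lemma compress0 : compress 0 = 0.
Proof. by apply: bop_eq => x; rewrite /compress !bopM !bop0 linear0. Qed.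

Lemma admissible0 : admissible 0.
Proof. by rewrite /admissible compress0; exact: E_subspace.1. Qed.

Lemma Psi0 : Psi 0 = 0.
Proof.
have := Psi_lin 1 0 0 E_subspace.1 E_subspace.1; rewrite !scale1r addr0 => /eqP.
by rewrite -subr_eq0 opprD addrA subrr sub0r oppr_eq0 => /eqP.
Qed.

Lemma Theta0 : Theta 0 = 0.
Proof. by rewrite /Theta compress0 Psi0. Qed.

Lemma Theta_cp d (A : 'I_d -> 'I_d -> bop K K) : (forall p q, admissible (A p q)) ->
  psd_mx A -> psd_mx (fun p q => Theta (A p q)).
Proof.
move=> hA pA; apply: (Psi_cp d (fun p q => compress (A p q))) => // x.
have := pA (fun p => iota (x p)); congr (_ <= _).
by apply: eq_bigr => p _; apply: eq_bigr => q _; rewrite /compress !bopM [RHS]adjP adjK.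
Qed.

Lemma Theta_psd A : admissible A -> psd A -> psd (Theta A).
Proof.
move=> hA pA x; have := @Theta_cp 1 (fun _ _ => A) (fun _ _ => hA).
move=> /(_ _ (fun=> x)); rewrite !big_ord1; apply=> y.
by rewrite !big_ord1; exact: pA.
Qed.

(** On bounded sets the weak operator topology is the w*-topology, for which the domain of
    Psi is closed and Psi is continuous. *)
Lemma Theta_lim D (G : set_system D) (FG : ProperFilter G) (A : D -> bop K K) L (M : R) :
  0 <= M -> (forall s y, nm (A s y) <= M * nm y) -> (forall s, admissible (A s)) ->
  wot_cvg G A L -> admissible L /\ wot_cvg G (fun s => Theta (A s)) (Theta L).
Proof.
move=> M0 hM hA AL.
have cw : (fun s => compress (A s)) @ G --> (compress L : wstar N N).
  apply: (bounded_wot_wstar _ M0) => [s|]; first exact: (compress_bound M (A s) M0 (hM s)).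
  exact: wot_conj.
have EL : E (compress L).
  apply: (@closed_cvg _ (wstar N N) G _ _ (E : wstar N N -> Prop) (@closed_closure _ _) _ _ cw).
  by apply: filterE => s; exact: hA.
split=> //; apply: wstar_wot.
have /subspace_continuousP /(_ _ EL) := Psi_cont.
move=> hc; apply: (cvg_trans _ hc) => P hP.
have h2 : G (fun s => E (compress (A s)) -> P (Psi (compress (A s)))) := cw _ hP.
suff : G (fun s => P (Theta (A s))) by [].
by apply: filterS h2 => s; apply; exact: hA.
Qed.

(** The adjoint of W_a lies in the multiplicative domain of Theta. Concretely, with A = W_a,
    X = W_b and c large, the matrix with the rows (1, A^*, X), (A, A A^*, A X) and
    (X^*, (A X)^*, c) is positive, hence so is its image under Theta. The upper left block
    of the image is degenerate, which forces Theta (A X) = Theta A Theta X. *)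
Lemma mword_op_cat_T a b : mword_op T (cat2 a b) = mword_op T a \*b mword_op T b.
Proof.
have WC := W_commute.
have Wab := mword_op_cat R k n K W a b WC.
have [M M0 hM] := bop_bound (mword_op W b).
pose c := M ^+ 2.
pose X := mword_op W a; pose Y := mword_op W b.
have [Cc CcD] : exists Cc : bop K K, Cc = c%:C *: bop_id K by exists (c%:C *: bop_id K).
have [Id IdD] : exists Id : bop K K, Id = bop_id K by exists (bop_id K).
have CcE x : Cc x = c%:C *: x by rewrite CcD bopZ.
have IdE x : Id x = x by rewrite IdD.
pose A (p q : 'I_3) : bop K K := nth 0 (nth [::] [::
  [:: Id; adj X; Y];
  [:: X; X \*b adj X; X \*b Y];
  [:: adj Y; adj (X \*b Y); Cc]] p) q.
have adm p q : admissible (A p q).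
  have admc : admissible (c%:C *: bop_id K).
    by rewrite -[_ *: _]addr0; apply: admissible_linear; [exact: admissible1|exact: admissible0].
  case: p => -[|[|[|//]]] hp; case: q => -[|[|[|//]]] hq; rewrite /A /=;
    rewrite /X /Y -?Wab ?IdD ?CcD; by [exact: admissible1|exact: admissible_adj|exact: admissible_mword|exact: admissible_word|exact: admc].
have pos : psd_mx A.
  move=> x; rewrite !big_ord_recl !big_ord0 !addr0 /A /=.
  set x0 := x _; set x1 := x (lift _ _); set x2 := x (lift _ _).
  pose y := x0 + adj X x1 + Y x2.
  have nY : nm (Y x2) ^+ 2 <= c * nm x2 ^+ 2.
    by rewrite /c -exprMn ler_pXn2r ?nnegrE ?mulr_ge0 ?nm_ge0//; exact: hM.
  rewrite [X in 0 <= X](_ : _ = '[y, y] + (c * nm x2 ^+ 2 - nm (Y x2) ^+ 2)%:C).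
    by rewrite hdotxx -rmorphD lecR addr_ge0 ?sqr_ge0// subr_ge0.
  rewrite rmorphB rmorphM /= -!hdotxx /y !hdotDl !hdotDr CcE IdE hdotZl adjM !bopM.
  rewrite -!(adjPr Y) !(adjP X); ring.
have := Theta_cp 3 A adm pos.
set Z := mword_op T (cat2 a b); pose Xa := mword_op T a; pose Yb := mword_op T b.
have Th01 : Theta (adj X) = adj Xa by exact: Theta_adj.
have Th02 : Theta Y = Yb by exact: Theta_mword.
have Th10 : Theta X = Xa by exact: Theta_mword.
have Th11 : Theta (X \*b adj X) = Xa \*b adj Xa by exact: Theta_word.
have Th12 : Theta (X \*b Y) = Z by rewrite -Wab Theta_mword.
have Th20 : Theta (adj Y) = adj Yb by exact: Theta_adj.
have Th21 : Theta (adj (X \*b Y)) = adj Z by rewrite -Wab Theta_adj.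
have ThId : Theta Id = bop_id H by rewrite IdD Theta1.
have Th22 : Theta Cc = c%:C *: bop_id H.
  rewrite CcD.
  rewrite -[c%:C *: bop_id K]addr0 Theta_linear; [|exact: admissible1|exact: admissible0].
  by rewrite Theta1 Theta0 addr0.
move=> h; pose Df : bop H H := Z - Xa \*b Yb.
have key x h' : 0 <= c * nm x ^+ 2 + 2 * rip (Df x) h'.
  pose p := adj Xa h'.
  have D1 : rip (Df x) h' = rip (Z x) h' - rip (Yb x) p by rewrite /Df bopB bopM ripBl (rip_adj Xa).
  have D2 : rip (Xa (- p)) h' = - nm p ^+ 2 by rewrite linearN ripNl rip_adj ripxx.
  have D3 : rip (Xa p) h' = nm p ^+ 2 by rewrite rip_adj ripxx.
  have D4 : rip (adj Yb (- p)) x = - rip (Yb x) p by rewrite linearN ripNl -rip_adjr ripC.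
  have D5 : rip (adj Z h') x = rip (Z x) h' by rewrite -rip_adjr ripC.
  (* A vector whose first two components annihilate the upper left block. *)
  have := h (fun j : 'I_3 => nth 0 [:: - p; h'; x] j).
  rewrite !big_ord_recl !big_ord0 !addr0 /A /= ThId Th01 Th02 Th10 Th11 Th12 Th20 Th21 Th22.
  rewrite complex_ge0 => /andP[_]; rewrite !cReD -!/(rip _ _) bopM bop1 bopZ bop1 ripZl -/p.
  rewrite D2 D3 D4 D5 D1 !ripNl !ripNr !ripxx; lra.
apply/eqP; rewrite -subr_eq0; apply/eqP; apply: bop_eq => x; rewrite bop0.
apply: nm_eq0; apply/eqP; apply: contraT => nz.
have np : 0 < nm (Df x) ^+ 2 by rewrite exprn_gt0// lt0r nz nm_ge0.
have c0 : 0 <= c * nm x ^+ 2 by rewrite mulr_ge0 ?sqr_ge0.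
(* The linear term in the second argument dominates for this multiple of Df x. *)
pose s := (c * nm x ^+ 2 + 1) / nm (Df x) ^+ 2.
have := key x ((- s)%:C *: Df x); rewrite ripZr ripxx mulNr divfK ?gt_eqF//; lra.
Qed.

(** Words in two different tuples form the same multi-index in either order. *)
Lemma T_commute : entries_commute R k n H T.
Proof.
move=> s q j l sq.
have E1 i' w' : word_op (T i') [:: w'] = T i' w' by rewrite /= bopM1.
rewrite -!E1 -!mword_op_single -!mword_op_cat_T; congr (mword_op T _).
apply: functional_extensionality_dep => i; rewrite /single.
have [<-|si] := eqVneq s i; first by rewrite dfwithin dfwithout 1?eq_sym.
by rewrite [X in X ++ _ = _]dfwithout// [X in _ = _ ++ X]dfwithout// cats0.
Qed.

Let W_cat a b : mword_op W (cat2 a b) = mword_op W a \*b mword_op W b.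
Proof.
apply: mword_op_cat.
exact: (W_commute).
Qed.

(** Compatibility with conjugation by all monomials, and not merely Theta Y = Z, is what is
    inherited when Phi is applied to Y. *)
Definition covariant Y (Z : bop H H) := forall a,
  admissible (mword_op W a \*b Y \*b adj (mword_op W a)) /\
  Theta (mword_op W a \*b Y \*b adj (mword_op W a)) = mword_op T a \*b Z \*b adj (mword_op T a).

Lemma covariant_admissible Y Z : covariant Y Z -> admissible Y.
Proof. by move=> /(_ (fun=> [::])) []; rewrite !mword_op_nil !adj1 !bop1M !bopM1. Qed.

Lemma covariantE Y Z : covariant Y Z -> Theta Y = Z.
Proof. by move=> /(_ (fun=> [::])) []; rewrite !mword_op_nil !adj1 !bop1M !bopM1. Qed.

Lemma covariant1 : covariant (bop_id K) (bop_id H).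
Proof. by move=> a; rewrite !bopM1; split; [exact: admissible_word|exact: Theta_word]. Qed.

Lemma conj_linear (U V : hilbertType R) (X : bop U V) c (A B : bop U U) :
  X \*b (c *: A + B) \*b adj X = c *: (X \*b A \*b adj X) + X \*b B \*b adj X.
Proof. by apply: bop_eq => x; rewrite !(bopM, bopD, bopZ) linearP. Qed.

Lemma covariant_linear c Y1 Z1 Y2 Z2 : covariant Y1 Z1 -> covariant Y2 Z2 ->
  covariant (c *: Y1 + Y2) (c *: Z1 + Z2).
Proof.
move=> h1 h2 a; have [a1 e1] := h1 a; have [a2 e2] := h2 a; rewrite !conj_linear; split.
  exact: admissible_linear.
by rewrite Theta_linear// e1 e2.
Qed.

Lemma covariant0 : covariant 0 0.
Proof.
have z (V : hilbertType R) (X : bop V V) : X \*b 0 \*b adj X = 0.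
  by apply: bop_eq => x; rewrite !bopM !bop0 linear0.
by move=> a; rewrite !z; split; [exact: admissible0|exact: Theta0].
Qed.

Lemma covariantB Y1 Z1 Y2 Z2 : covariant Y1 Z1 -> covariant Y2 Z2 -> covariant (Y1 - Y2) (Z1 - Z2).
Proof.
move=> h1 h2; have := covariant_linear (-1) _ _ _ _ h2 h1.
by rewrite !scaleN1r ![- _ + _]addrC.
Qed.

Lemma covariant_conj i v Y Z : covariant Y Z ->
  covariant (word_op (W i) v \*b Y \*b adj (word_op (W i) v)) (word_op (T i) v \*b Z \*b adj (word_op (T i) v)).
Proof.
have assoc (V : hilbertType R) (A B C : bop V V) : A \*b (B \*b C \*b adj B) \*b adj A =
    A \*b B \*b C \*b adj (A \*b B) by rewrite adjM !bopMA.
move=> h a; have := h (cat2 a (single k n i v)).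
by rewrite W_cat mword_op_cat_T !mword_op_single !assoc.
Qed.

Lemma covariant_lim D (G : set_system D) (FG : ProperFilter G) (A : D -> bop K K) (B : D -> bop H H) L (M : R) :
  0 <= M -> (forall s y, nm (A s y) <= M * nm y) -> (forall s, covariant (A s) (B s)) ->
  wot_cvg G A L -> covariant L (Theta L) /\ wot_cvg G B (Theta L).
Proof.
move=> M0 hM hA AL.
have BE : B = fun s => Theta (A s) by apply/funext => s; rewrite (covariantE _ _ (hA s)).
have [LA BL] := Theta_lim _ G FG A L M M0 hM (fun s => covariant_admissible _ _ (hA s)) AL.
split; last by rewrite BE.
move=> a; have [Ma Ma0 hMa] := bop_bound (mword_op W a).
have bd s y : nm ((mword_op W a \*b A s \*b adj (mword_op W a)) y) <= Ma * (M * Ma) * nm y.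
  rewrite !bopM (le_trans (hMa _))// -!mulrA ler_wpM2l// (le_trans (hM _ _))// ler_wpM2l//.
  exact: adj_bound.
have M1 : 0 <= Ma * (M * Ma) by rewrite !mulr_ge0.
have ALa : wot_cvg G (fun s => mword_op W a \*b A s \*b adj (mword_op W a)) (mword_op W a \*b L \*b adj (mword_op W a)).
  exact: wot_conj.
have [LAa BLa] := Theta_lim _ G FG _ _ _ M1 bd (fun s => (hA s a).1) ALa.
split=> //; apply: (wot_uniq BLa).
rewrite (_ : (fun s => _) = fun s => mword_op T a \*b B s \*b adj (mword_op T a)).
  by apply: wot_conj; rewrite BE.
by apply/funext => s; exact: (hA s a).2.
Qed.

Lemma covariant_Phi_sum i Y Z L : covariant Y Z -> covariant (Phi_sum f W i Y L) (Phi_sum f T i Z L).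
Proof.
have add Y1 Z1 Y2 Z2 : covariant Y1 Z1 -> covariant Y2 Z2 -> covariant (Y1 + Y2) (Z1 + Z2).
  by move=> h1 h2; have := covariant_linear 1 _ _ _ _ h1 h2; rewrite !scale1r.
move=> h; rewrite /Phi_sum.
apply: (big_ind2 covariant) => [|Y1 Z1 Y2 Z2|p _]; [exact: covariant0|exact: add|].
apply: (big_ind2 covariant) => [|Y1 Z1 Y2 Z2|v _]; [exact: covariant0|exact: add|].
have := covariant_linear (f i v)%:C _ _ _ _ (covariant_conj i v _ _ h) covariant0.
by rewrite !addr0.
Qed.

Let W_pd := W_polydomain.
Let W_def i : Phi_defined f W i. Proof. by have [_ h _] := W_pd. Qed.

Lemma Phi_sum_psd i Y L : psd Y -> psd (Phi_sum f W i Y L).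
Proof.
move=> pY; rewrite Phi_sumE /series /=; elim/big_ind : _ => [|A B|p _]; [exact: psd0|exact: psdD|].
exact: Phi_comp_psd.
Qed.

Lemma Phi_sum_le i Y L x : psd Y -> quad (Phi_sum f W i Y L) x <= quad (Phi f W i Y) x.
Proof.
move=> pY; have /wotP /(_ x x) := Phi_cvg R k n f K W W_def i Y.
rewrite (_ : (fun s => _) = series (fun p => quad (Phi_comp R k n f K W i Y p.+1) x)).
  move=> h; rewrite /quad Phi_sumE rip_series; apply: series_le_lim h L => p.
  by apply: psd_quad; apply: Phi_comp_psd.
by apply/funext => L'; rewrite Phi_sumE rip_series.
Qed.

(** The partial sums at a positive operator increase to Phi Y. *)
Lemma Phi_sum_bounded i Y : psd Y -> exists2 c : R, 0 <= c &
  forall L, psd (c%:C *: bop_id K - Phi_sum f W i Y L) /\ forall x, nm (Phi_sum f W i Y L x) <= c * nm x.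
Proof.
move=> pY; have pP := Phi_psd R k n f K W f_ge0 W_def i Y pY.
have [c c0 hc] := psd_le_id pP; exists c => // L.
have le x : quad (Phi_sum f W i Y L) x <= c * nm x ^+ 2.
  apply: le_trans (Phi_sum_le i Y L x pY) _.
  by have := psd_quad x hc; rewrite quadB quadZ quad1 subr_ge0.
split; last by apply: bop_of_quad => //; exact: Phi_sum_psd.
apply: psd_mk => [|x]; last by rewrite quadB quadZ quad1 subr_ge0.
by apply: hermB; [exact: hermZ|apply: psd_herm; exact: Phi_sum_psd].
Qed.

Lemma T_Phi_defined i : Phi_defined f T i.
Proof.
have [c c0 hc] := Phi_sum_bounded i (bop_id K) (@psd1 _ K).
apply: (Phi_definedP R k n f H T f_ge0 i c) => L x.
have cv := covariant_Phi_sum i _ _ L covariant1.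
have cv1 : covariant (c%:C *: bop_id K - Phi_sum f W i (bop_id K) L) (c%:C *: bop_id H - Phi_sum f T i (bop_id H) L).
  apply: covariantB cv; have := covariant_linear c%:C _ _ _ _ covariant1 covariant0.
  by rewrite !addr0.
have := Theta_psd _ (covariant_admissible _ _ cv1) (hc L).1.
rewrite (covariantE _ _ cv1) => /psd_quad - /(_ x).
by rewrite quadB quadZ quad1 subr_ge0.
Qed.

Lemma covariant_Phi i Y Z : psd Y -> covariant Y Z -> covariant (Phi f W i Y) (Phi f T i Z).
Proof.
move=> pY h; have [c c0 hc] := Phi_sum_bounded i Y pY.
have [h1 h2] := covariant_lim _ \oo _ _ _ _ c c0 (fun L => (hc L).2)
  (fun L => covariant_Phi_sum i Y Z L h) (Phi_cvg R k n f K W W_def i Y).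
by rewrite (Phi_uniq R k n f H T T_Phi_defined i Z _ h2).
Qed.

(** The successive differences of which Delta is made need not be positive, but they are
    differences of positive operators, for which the series of Phi is bounded. *)
Definition covariant_diff Y (Z : bop H H) := exists Y1 Y2 Z1 Z2,
  [/\ psd Y1, psd Y2, covariant Y1 Z1 & covariant Y2 Z2] /\ (Y = Y1 - Y2 /\ Z = Z1 - Z2).

Lemma covariant_diffP Y Z : covariant_diff Y Z -> covariant Y Z.
Proof. by move=> [Y1 [Y2 [Z1 [Z2 [[_ _ h1 h2] [-> ->]]]]]]; exact: covariantB. Qed.

Lemma covariant_diff1 : covariant_diff (bop_id K) (bop_id H).
Proof.
exists (bop_id K), 0, (bop_id H), 0; rewrite !subr0.
by split=> //; split; [exact: psd1|exact: psd0|exact: covariant1|exact: covariant0].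
Qed.

Lemma covariant_diffB Y Z Y' Z' : covariant_diff Y Z -> covariant_diff Y' Z' ->
  covariant_diff (Y - Y') (Z - Z').
Proof.
have add Y1 Z1 Y2 Z2 : covariant Y1 Z1 -> covariant Y2 Z2 -> covariant (Y1 + Y2) (Z1 + Z2).
  by move=> h1 h2; have := covariant_linear 1 _ _ _ _ h1 h2; rewrite !scale1r.
move=> [Y1 [Y2 [Z1 [Z2 [[p1 p2 h1 h2] [-> ->]]]]]] [Y3 [Y4 [Z3 [Z4 [[p3 p4 h3 h4] [-> ->]]]]]].
exists (Y1 + Y4), (Y2 + Y3), (Z1 + Z4), (Z2 + Z3); split.
  by split; [exact: psdD|exact: psdD|exact: add|exact: add].
have ex (V : zmodType) (a b c d : V) : a - b - (c - d) = a + d - (b + c).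
  by rewrite !opprD opprK [- c + d]addrC addrACA.
by rewrite !ex.
Qed.

Lemma covariant_diff_Phi i Y Z : covariant_diff Y Z -> covariant_diff (Phi f W i Y) (Phi f T i Z).
Proof.
move=> [Y1 [Y2 [Z1 [Z2 [[p1 p2 h1 h2] [-> ->]]]]]].
exists (Phi f W i Y1), (Phi f W i Y2), (Phi f T i Z1), (Phi f T i Z2); split.
  by split; try (exact: Phi_psd); exact: covariant_Phi.
by split; [exact: PhiB W_def _ _ _|exact: PhiB T_Phi_defined _ _ _].
Qed.

Lemma covariant_diff_iter_Phi i q Y Z : covariant_diff Y Z ->
  covariant_diff (iter q (Phi f W i) Y) (iter q (Phi f T i) Z).
Proof. by move=> h; elim: q => [//|q IH]; exact: covariant_diff_Phi. Qed.

Lemma covariant_Delta p : covariant_diff (Delta f W p (bop_id K)) (Delta f T p (bop_id H)).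
Proof.
rewrite /Delta; elim: (enum 'I_k) => [|i s IH] /=; first exact: covariant_diff1.
by elim: (p i) => [//|q IHq] /=; apply: covariant_diffB => //; exact: covariant_diff_Phi.
Qed.

Lemma T_polydomain : polydomain f m T.
Proof.
split; [exact: T_commute|exact: T_Phi_defined|move=> p pm].
have h := covariant_diffP _ _ (covariant_Delta p).
rewrite -(covariantE _ _ h); apply: Theta_psd; first exact: covariant_admissible h.
by have [_ _] := W_pd; apply.
Qed.

Lemma covariant_purity (q : 'I_k -> nat) s :
  covariant_diff (foldl (fun Z i => Z - iter (q i) (Phi f W i) Z) (bop_id K) s)
    (foldl (fun Z i => Z - iter (q i) (Phi f T i) Z) (bop_id H) s).
Proof.
elim/last_ind: s => [|s i IH]; first exact: covariant_diff1.
rewrite !foldl_rcons; apply: covariant_diffB => //; exact: covariant_diff_iter_Phi.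
Qed.

Lemma T_pure : pure f T.
Proof.
have Wp := W_pure.
have bd (q : 'I_k -> nat) y : nm (foldl (fun Z i => Z - iter (q i) (Phi f W i) Z) (bop_id K) (enum 'I_k) y) <= 1 * nm y.
  rewrite mul1r; apply: (diagonal_le _ _ _
    (diagonal_purity q)) => a.
  elim/big_ind : _ => [|x x' /andP[x0 x1] /andP[y0 y1]|i _].
  - by rewrite ler01 lexx.
  - by rewrite mulr_ge0// mulr_ile1.
  - have /andP[] := shiftpow_01 i (q i) (a i).
    by rewrite subr_ge0 lerBlDr lerDl => -> ->.
have [_] := covariant_lim _ _ (multi_index_filter k) _ _ _ 1 ler01 bd
  (fun q => covariant_diffP _ _ (covariant_purity q (enum 'I_k))) Wp.
by rewrite Theta1.
Qed.

Section FunctionalCalculus.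
Variable V : nat -> bop H K.
Hypothesis V_iso : forall x, series (fun p => nm (V p x) ^+ 2) @ \oo --> (nm x ^+ 2 : R).
Hypothesis V_adj : forall p a x, adj (mword_op W a) (V p x) = V p (adj (mword_op T a) x).
Local Notation Lambda := (compress_ampl V).

Lemma Lambda_mword a : Lambda (mword_op W a) = mword_op T a.
Proof.
apply: bop_eq_rip => x y; rewrite /rip compress_amplE//.
rewrite [in RHS]adjP -[in RHS](bop1 x) -(compress_ampl1 V_iso) compress_amplE//.
by congr (Re (csum _)); apply/funext => p; rewrite adjP V_adj bop1.
Qed.

Lemma Lambda0 : Lambda 0 = 0.
Proof.
have := compress_ampl_linear V_iso 1 0 0; rewrite !scale1r addr0 => /eqP.
by rewrite -subr_eq0 opprD addrA subrr sub0r oppr_eq0 => /eqP.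
Qed.

Lemma Lambda_homop c q : Lambda (homop R k n K W c q) = homop R k n H T c q.
Proof.
pose rel (A : bop K K) (B : bop H H) := Lambda A = B.
suff : rel (homop R k n K W c q) (homop R k n H T c q) by [].
rewrite /homop; apply: (big_ind2 rel) => [|A B A' B'|b _]; rewrite /rel.
- exact: Lambda0.
- by move=> <- <-; have := compress_ampl_linear V_iso 1 A A'; rewrite !scale1r.
- have := compress_ampl_linear V_iso (c (fun i => b i)) (mword_op W (fun i => b i)) 0.
  by rewrite !addr0 Lambda0 addr0 Lambda_mword.
Qed.

(** The two maps are compared along limits that both of them preserve. *)
Definition agrees A := admissible A /\ Theta A = Lambda A.

Lemma agrees_linear c A B : agrees A -> agrees B -> agrees (c *: A + B).
Proof.
move=> [a1 e1] [a2 e2]; split; first exact: admissible_linear.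
by rewrite Theta_linear// e1 e2 compress_ampl_linear.
Qed.

Lemma agrees0 : agrees 0.
Proof. by split; [exact: admissible0|rewrite Theta0 Lambda0]. Qed.

Lemma agrees_homop c q : agrees (homop R k n K W c q).
Proof.
rewrite /homop; apply: big_ind => [|A B hA hB|b _]; first exact: agrees0.
  by rewrite -[A]scale1r; exact: agrees_linear.
rewrite -[_ *: _]addr0; apply: agrees_linear; last exact: agrees0.
by split; [exact: admissible_mword|rewrite Theta_mword Lambda_mword].
Qed.

Lemma agrees_lim D (G : set_system D) (FG : ProperFilter G) (A : D -> bop K K) (L : bop K K) (M : R) :
  0 <= M -> (forall s y, nm (A s y) <= M * nm y) -> (forall s, agrees (A s)) ->
  (forall y, (fun s => A s y) @ G --> L y) -> agrees L.
Proof.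
move=> M0 hM hA AL.
have wAL : wot_cvg G A L by apply/wotP => x y; apply: cvg_ripl; exact: AL.
have [aL eL] := Theta_lim _ G FG A L M M0 hM (fun s => (hA s).1) wAL.
split=> //; apply: (wot_uniq eL).
rewrite (_ : (fun s => Theta (A s)) = Lambda \o A); first exact: (compress_ampl_wot V_iso _ M0 hM wAL).
by apply/funext => s; exact: (hA s).2.
Qed.

(** Theta and the compression Lambda along the Berezin kernel agree on the partial sums of
    the means of g, hence on the means and on g. The means of the functional calculus are
    the values of Lambda at the means of g, so they tend to Lambda g = Theta g, which is 0
    because g vanishes under compression to N_J. *)
Lemma func_calculus_zero g : J g -> exists2 c, fourier_rep e t W g c & func_calculus T c 0.
Proof.
move=> Jg; have [_ JF _ _] := hJ.
have gt := Finfty_toeplitz g (JF _ Jg).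
pose c := fourier_coef g.
exists c; first exact: (fourier_rep_coef g gt).
pose Q := homop R k n K W c.
have g_lower := toeplitz_lower g gt.
have Q_coef := hom_part_coef_tbasis g gt.
have [M M0 hM] := bop_bound g.
pose G := abel g; pose GS := abel_sum Q.
have GS_bound r L y : 0 <= r < 1 -> nm (GS r L y) <= M / (1 - r) * nm y.
  exact: (abel_sum_bound g M M0 hM Q Q_coef).
have GS_cvg r y : 0 <= r < 1 -> (fun L => GS r L y) @ \oo --> G r y.
  exact: (abel_sum_cvg g M M0 hM g_lower Q Q_coef).
have G_bound r y : 0 <= r < 1 -> nm (G r y) <= M * nm y.
  exact: (abel_bound g M M0 hM).
have G_cvg y : (fun r => G r y) @ 1^'- --> g y.
  exact: (abel_cvg g M M0 hM g_lower).
have Mr r : 0 <= r < 1 -> 0 <= M / (1 - r).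
  by move=> /andP[_ r1]; rewrite divr_ge0// subr_ge0 ltW.
have agreeG r : 0 <= r < 1 -> agrees (G r).
  move=> r01; apply: (agrees_lim _ \oo _ (GS r) _ _ (Mr r r01)) => [L y|L|y]; [exact: GS_bound| |exact: GS_cvg].
  rewrite /GS /abel_sum /series /=; apply: big_ind => [|A B hA hB|q _]; first exact: agrees0.
    by rewrite -[A]scale1r; exact: agrees_linear.
  by rewrite -[_ *: _]addr0; apply: agrees_linear; [exact: agrees_homop|exact: agrees0].
(* The means are bounded only for 0 <= r < 1, whereas limits are taken along all r. *)
pose cl (r : R) : R := if 0 <= r < 1 then r else 0.
have cl01 r : 0 <= cl r < 1 by rewrite /cl; case: ifP => //; rewrite lexx ltr01.
have near01 : \forall r \near 1^'-, 0 < r < (1 : R).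
  near=> r; apply/andP; split; last by near: r; exact: nbhs_left_lt.
  by near: r; apply: nbhs_left_gt; exact: ltr01.
have G_cvg' y : (fun r => G (cl r) y) @ 1^'- --> g y.
  have /hcvg_eps h := G_cvg y; apply/hcvg_eps => eps /h; apply: filterS2 near01 => r /andP[r0 r1].
  by rewrite /cl (ltW r0) r1.
have [_ eg] : agrees g.
  apply: (agrees_lim _ 1^'- _ (fun r => G (cl r)) _ M M0) => [r y|r|y]; [exact: G_bound|exact: agreeG|exact: G_cvg'].
have Lg : Lambda g = 0.
  rewrite -eg /Theta (_ : compress g = 0) ?Psi0//.
  apply: bop_eq_rip => x y; rewrite bop0 rip0l /compress !bopM rip_adj adjK /rip.
  have /NJP h := NJ_iota y.
  by rewrite h.
have hS r x : 0 <= r < 1 -> series (fun q => (r ^+ q)%:C *: hom_part T c q x) @ \oo --> Lambda (G r) x.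
  move=> r01; rewrite (_ : series _ = fun L => Lambda (GS r L) x).
    apply: (compress_ampl_strong V_iso _ (Mr r r01)).
      by apply: filterE => L y; exact: GS_bound.
    by move=> y; exact: GS_cvg.
  apply/funext => L; rewrite /GS /abel_sum; elim: L => [|L IH].
    by rewrite !series0 Lambda0 bop0.
  have addL A z B : Lambda (A + z *: B) = Lambda A + z *: Lambda B.
    by rewrite addrC compress_ampl_linear// addrC.
  by rewrite !seriesS IH addL bopD bopZ Lambda_homop homopE.
move=> x; split=> [r /andP[r0 r1]|].
  by apply/cvg_ex; exists (Lambda (G r) x); apply: hS; rewrite (ltW r0).
have lim : (fun r => Lambda (G (cl r)) x) @ 1^'- --> Lambda g x.
  apply: (compress_ampl_strong V_iso _ (A := fun r => G (cl r)) M0) => [|y]; last exact: G_cvg'.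
  by apply: filterE => r y; exact: G_bound.
move: lim; rewrite Lg => /hcvg_eps lim; apply/hcvg_eps => eps /lim.
apply: filterS2 near01 => r /andP[r0 r1].
rewrite /cl (ltW r0) r1 /= => h.
rewrite (_ : limn _ = Lambda (G r) x)//; apply: (hcvg_uniq (F := \oo)); last by apply: hS; rewrite (ltW r0).
have : cvgn (series (fun q => (r ^+ q)%:C *: hom_part T c q x)).
  by apply/cvg_ex; exists (Lambda (G r) x); apply: hS; rewrite (ltW r0).
by [].
Unshelve. all: by end_near. Qed.

End FunctionalCalculus.

Lemma map_pure_variety : pure_variety f m e t W J T.
Proof.
split; [exact: T_polydomain|exact: T_pure|move=> g Jg].
have [V [V_iso hV]] := berezin_kernels H hH T T_polydomain T_pure.
exact: (func_calculus_zero V V_iso hV).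
Qed.

End Backward.

End Variety.
End WeightedShifts.
End TensorBasis.

Theorem theorem1p3 (R : realType)
  (k : nat) (hk : (0 < k)%N)
  (n m : 'I_k -> nat)
  (hn : forall i, (0 < n i)%N) (hm : forall i, (0 < m i)%N)
  (f : forall i, seq 'I_(n i) -> R)
  (hf : forall i, positive_regular (f i))
  (* the Fock spaces, their Hilbert tensor product and the universal model *)
  (F : 'I_k -> hilbertType R)
  (e : forall i, seq 'I_(n i) -> F i)
  (he : forall i, orthonormal_basis (e i))
  (K : hilbertType R) (t : (forall i, F i) -> K)
  (ht : hilbert_tensor t)
  (w : forall i, 'I_(n i) -> bop (F i) (F i))
  (hw : weighted_shifts f m e w)
  (W : forall i, 'I_(n i) -> bop K K)
  (hW : ampliation t W w)
  (J : set (bop K K))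
  (hJ : wstar_closed_left_ideal W J)
  (hNJ : NJ J <> [set 0])
  (* N_J as a Hilbert space, iota being its inclusion *)
  (N : hilbertType R) (iota : bop N K)
  (hiota : forall x y, '[iota x, iota y] = '[x, y])
  (hiotaJ : range iota = NJ J)
  (H : hilbertType R) (hH : separable H)
  (T : forall i, 'I_(n i) -> bop H H) :
  let S := compression iota W in
  pure_variety f m e t W J T <->
  exists Psi : bop N N -> bop H H,
    [/\ linear_on (op_space S) Psi,
        unital Psi,
        completely_positive (op_space S) Psi,
        wstar_continuous (op_space S) Psi &
        forall alpha beta : mword n,
          Psi (mword_op S alpha \*b adj (mword_op S beta)) =
          mword_op T alpha \*b adj (mword_op T beta)].
Proof.
have f_ge0 i v : 0 <= f i v by have [] := hf i.
have f_nil i : f i [::] = 0 by have [] := hf i.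
have f_letter i j : 0 < f i [:: j] by have [] := hf i.
move=> S; split.
  exact: (pure_variety_map R k n F e he K t ht m f f_ge0 f_nil f_letter hm w hw W hW J hJ N iota hiota hiotaJ H hH T).
move=> [Psi [Psi_lin Psi1 Psi_cp Psi_cont Psi_gen]].
exact: (map_pure_variety R k n F e he K t ht m f f_ge0 f_nil f_letter hm w hw W hW J hJ N iota hiota hiotaJ H hH T Psi).
Qed.
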